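(* For each integer $n\ge 5$, we have $$P(g(n))\le 1.328\sqrt{n\log n}.$$
   Context: For a positive integer $n$, $S_n$ denotes the symmetric group on $n$ letters, and $g(n)=\max\{\operatorname{ord}(\sigma)\mid \sigma\in S_n\}$ is the maximal order of an element of $S_n$. For an integer $m\ge 2$, $P(m)$ denotes the largest prime divisor of $m$; thus $P(g(n))$ is the largest prime dividing $g(n)$. Here $\log$ is the natural logarithm. *)

(* Defs.v *)
From mathcomp Require Import all_boot all_fingroup.

Set Implicit Arguments.
Unset Strict Implicit.
Unset Printing Implicit Defensive.

(* The maximal order of an element of 'S_n (Landau's function). *)
Definition landau (n : nat) : nat := \max_(s : 'S_n) #[s]%g.

(* Main.v *)
Require Import Defs.
From Stdlib Require Import NArith ZArith.
From mathcomp Require Import all_boot all_order all_algebra all_fingroup.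
From mathcomp Require Import reals exp.
From mathcomp Require boolp classical_sets topology normedtype derive realfun.
From mathcomp Require Import cyclic zify ssrZ ring lra.

Set Implicit Arguments.
Unset Strict Implicit.
Unset Printing Implicit Defensive.

(** Suppose that a prime [p] divides [landau n] while the primes [r1 < r2 < p] do not. If
    [r1 + r2 <= p + s] for a prime [s] (or [s = 0]) dividing [landau n], then exchanging
    [p] and [s] for [r1] and [r2] does not enlarge the support of a permutation, so
    maximality of the order forces [r1 * r2 <= p * s]. When the primes are dense enough
    there is an [s] violating this, which therefore does not divide [landau n] either, and
    descent on [r1 + r2] shows that at most one prime between [sqrt p] and a fixed fraction
    [r] of [p] fails to divide [landau n]. The primes dividing [landau n] have sum at most
    [n], so [n + r] is at least the sum of the primes up to [r], roughly
    [r ^ 2 / (2 ln r)], and this gives [p ^ 2 <= 1.328 ^ 2 * n ln n].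

    For large [p], the density of the primes and their sum are controlled by bounds
    [a x <= psi x <= b x] of Chebyshev's function. They are bootstrapped: [psi x] is
    compared with a combination of [ln (x / k)!] and of [psi (x / m)], with weights found
    by linear programming, so that bounds at the points [x / m] produce sharper bounds at
    [x]. Up to [6 * 10 ^ 10], where these bounds are still too weak, an explicit chain of
    primes with certificates [3 ^ ((q - 1) / 2) = -1 (mod q)] provides the gaps. The small
    [p] are treated by sieving, and the smallest ones by searching through the possible sets
    of primes not dividing [landau n] and by tabulating [landau n]. *)

(** * Element orders and the function [ell] *)

(** A permutation of order [m] exists on [n] letters exactly when [ell m <= n]; this turns
    maximality of the order into the exchange inequalities. The identity [r1 * r2 = p * (r1 + r2 -
    p) + (p - r1) * (p - r2)] shows which [s] is wanted: a prime from [r1 + r2 - p] on, exceeding it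
    by less than [(p - r1) * (p - r2) / p]. So with [r1, r2 <= r] the primes up to [2 * r - p] may
    have gaps of about [(p - r) ^ 2 / p]: the denser the primes, the larger the [r] that can be
    chosen. To first order [n ln n] is [r ^ 2], hence [1.328] has to pay for [p / r], for the
    inaccuracy of Chebyshev's bounds and for the term [ln (2 ln r)] lost in
    [ln n = 2 ln r - ln (2 ln r)]. The last loss fades slowly. This is why moderate [p] need [p / r]
    near [1.157], thus gaps of 2.4 percent, which the chain of primes provides, while from about
    [8 * 10 ^ 10] on the ratio [11 / 9] is affordable, for which gaps of about 5 percent suffice;
    those follow from the bounds on [psi]. *)

Definition ell (m : nat) : nat := \sum_(q <- primes m) q ^ logn q m.

Lemma prime_power_gt1 q a : prime q -> 0 < a -> 1 < q ^ a.
Proof. by move=> qp a0; rewrite -(exp1n a) ltn_exp2r ?prime_gt1. Qed.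

(** Numbers greater than [1] have a sum at most their product, and the prime powers are pairwise
    coprime divisors of [c]. *)
Lemma sum_prime_powers_le (l : seq nat) (a : nat -> nat) (c : nat) :
  uniq l -> 0 < c -> {in l, forall q, prime q} ->
  {in l, forall q, 0 < a q} -> {in l, forall q, q ^ a q %| c} ->
  \sum_(q <- l) q ^ a q <= c.
Proof.
elim: l c => [|q l IH] c; first by rewrite big_nil.
case/andP=> qNl ul c0 lp la ld; rewrite big_cons.
have qp := lp q (mem_head q l).
have q2 := prime_power_gt1 qp (la q (mem_head q l)).
case/dvdnP: (ld q (mem_head q l)) => c' Ec.
have c'0 : 0 < c' by move: c0; rewrite Ec; case: (c').
have tl r : r \in l -> r \in q :: l by rewrite inE orbC => ->.
have hl r : r \in l -> r ^ a r %| c'.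
  move=> rl; have rp := lp r (tl r rl); have := ld r (tl r rl).
  rewrite Ec Gauss_dvdl // coprimeXl // coprimeXr // prime_coprime // dvdn_prime2 //.
  by apply: contra qNl => /eqP <-.
have := IH c' ul c'0 (fun r rl => lp r (tl r rl)) (fun r rl => la r (tl r rl)) hl.
case: l {IH qNl ul ld} lp la tl hl => [|r l] lp la tl hl.
  by rewrite big_nil => _; rewrite Ec; nia.
have rl := tl r (mem_head r l).
have := prime_power_gt1 (lp r rl) (la r rl).
have /(dvdn_leq c'0) := hl r (mem_head r l).
by set S := \sum_(_ <- _) _; move: (r ^ _) => u; rewrite Ec; nia.
Qed.

Section PermOrder.
Variables (T : finType) (s : {perm T}).
Import GroupScope.

Lemma card_porbit_dvd_order x : (#|porbit s x| %| #[s])%N.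
Proof. by rewrite porbitE; exact: dvdn_orbit. Qed.

Lemma order_dvd_porbits d : (forall x, (#|porbit s x| %| d)%N) -> (#[s] %| d)%N.
Proof.
move=> h; rewrite order_dvdn; apply/eqP/permP=> x; rewrite permX perm1.
have /dvdnP [k ->] := h x; elim: k => [|k IH] //.
by rewrite mulSn iterD IH iter_porbit.
Qed.

(** If the full power divided no cycle length, every cycle length would divide [#[s] %/ q], and so
    would the order. *)
Lemma prime_power_dvd_porbit q : prime q ->
  (q %| #[s])%N -> exists x, (q ^ logn q #[s] %| #|porbit s x|)%N.
Proof.
move=> qp qs; have m0 := order_gt0 s.
have [/existsP [x hx]|/existsPn h] := boolP [exists x, q ^ logn q #[s] %| #|porbit s x|]%N.
  by exists x.
have q0 := prime_gt0 qp.
suff : (#[s] %| #[s] %/ q)%N.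
  move=> /dvdn_leq -/(_ _); rewrite divn_gt0 // => hh.
  have := hh (dvdn_leq m0 qs); rewrite leqNgt ltn_Pdiv // prime_gt1 //.
apply: order_dvd_porbits => x; have /dvdnP [e Ee] := card_porbit_dvd_order x.
have c0 : (0 < #|porbit s x|)%N by rewrite lt0n card_porbit_neq0.
have e0 : (0 < e)%N by move: m0; rewrite Ee; case: (e).
have := h x; rewrite pfactor_dvdn // -ltnNge Ee lognM // -{1}[logn q #|_|]add0n ltn_add2r.
rewrite logn_gt0 mem_primes => /and3P [_ _ qe].
by case/dvdnP: qe => f ->; rewrite mulnAC mulnK // dvdn_mull.
Qed.

(** [O] sends each prime of the order to a cycle whose length is divisible by its full power. The
    powers sent to one cycle have sum at most its length by [sum_prime_powers_le], and the cycles
    partition [T]. *)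
Lemma ell_order_le : (ell #[s] <= #|T|)%N.
Proof.
pose m := #[s]; pose O q := if [pick x | q ^ logn q m %| #|porbit s x|]%N is Some x then porbit s x
    else set0.
have hO q : q \in primes m -> (O q \in porbits s) && (q ^ logn q m %| #|O q|)%N.
  rewrite mem_primes => /and3P [qp _ qm]; rewrite /O; case: pickP => [x -> |h].
    by rewrite andbT; apply: imset_f.
  by have [x] := prime_power_dvd_porbit qp qm; rewrite h.
have part : partition (porbits s) [set: T].
  have -> : porbits s = [set orbit 'P <[s]> x | x in [set: T]].
    by apply/setP=> A; apply/imsetP/imsetP=> [] [x _ ->]; exists x => //; rewrite porbitE.
  apply: orbit_partition; apply/actsP => a _ x; by rewrite !inE.
rewrite -cardsT (card_partition part) /ell big_seq.
rewrite (partition_big O (mem (porbits s))) /=; last by move=> q /hO /andP [].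
apply: leq_sum => A /imsetP [x _ EA].
rewrite -big_seq_cond -big_filter; apply: sum_prime_powers_le.
- by rewrite filter_uniq // primes_uniq.
- by rewrite EA lt0n card_porbit_neq0.
- by move=> q; rewrite mem_filter mem_primes => /and3P [].
- by move=> q; rewrite mem_filter logn_gt0 => /andP [].
- by move=> q; rewrite mem_filter => /andP [/eqP <- /hO /andP []].
Qed.

End PermOrder.

Section CyclePerm.
Variable (T : finType).
Import GroupScope.

(** [next] along the enumeration of [A] rotates [A] and fixes every other point. *)
Lemma exists_cycle_perm (A : {set T}) : (0 < #|A|)%N ->
  exists t : {perm T}, perm_on A t /\ #[t] = #|A|.
Proof.
move=> /card_gt0P [x0 x0A].
have ue := enum_uniq A.
pose t := perm (can_inj (prev_next ue)).
have tE x : t x = next (enum A) x by rewrite permE.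
have fc : fcycle t (enum A).
  by rewrite (eq_cycle (e' := frel (next (enum A)))) ?cycle_next // => x y /=; rewrite tE.
have x0e : x0 \in enum A by rewrite mem_enum.
have o x : x \in A -> fingraph.order t x = #|A|.
  by move=> xA; rewrite (order_cycle fc) -?cardE // mem_enum.
exists t; split.
  by apply/subsetP=> x; rewrite inE tE next_nth mem_enum; case: ifP => //; rewrite eqxx.
apply/eqP; rewrite eqn_dvd; apply/andP; split.
  rewrite order_dvdn; apply/eqP/permP=> x; rewrite permX perm1.
  have [xA|xA] := boolP (x \in A).
    by rewrite -(o _ xA) iter_order //; exact: perm_inj.
  elim: #|A| => //= k ->; rewrite tE next_nth mem_enum (negbTE xA) //.
rewrite -(o _ x0A).
have -> : fingraph.order t x0 = #|porbit t x0|.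
  apply: eq_card => y; rewrite !inE; apply/idP/porbitP => [/iter_findex <-|[i ->]].
    by exists (findex t x0 y); rewrite permX.
  by rewrite permX; exact: fconnect_iter.
exact: card_porbit_dvd_order.
Qed.

Lemma exists_subset_card (D : {set T}) k : (k <= #|D|)%N ->
  exists A : {set T}, A \subset D /\ #|A| = k.
Proof.
move=> kD; exists [set x in take k (enum D)]; split.
  by apply/subsetP=> x; rewrite inE => /mem_take; rewrite mem_enum.
rewrite cardsE (card_uniqP _) ?take_uniq ?enum_uniq // size_take -cardE.
by case: ltnP => // h; apply/eqP; rewrite eqn_leq kD h.
Qed.

Lemma exists_perm_prod (l : seq nat) (D : {set T}) :
  all (leq 1) l -> pairwise coprime l -> (sumn l <= #|D|)%N ->
  exists t : {perm T}, perm_on D t /\ #[t] = (\prod_(k <- l) k)%N.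
Proof.
elim: l D => [|k l IH] D /=.
  by move=> _ _ _; exists 1; rewrite big_nil order1; split=> //; apply: perm_on1.
case/andP=> k0 hl /andP [ck cl] hs.
have [A [AD cA]] := exists_subset_card (leq_trans (leq_addr _ _) hs).
have [t [tA ot]] : exists t : {perm T}, perm_on A t /\ #[t] = #|A|.
  by apply: exists_cycle_perm; rewrite cA.
have [|u [uD ou]] := IH (D :\: A) hl cl.
  by rewrite cardsDS // cA leq_subRL // (leq_trans _ hs) // leq_addr.
exists (t * u); split.
  apply: perm_onM; first exact: subset_trans tA AD.
  by apply: subset_trans uD _; exact: subsetDl.
rewrite orderM.
- by rewrite big_cons ot ou cA.
- apply: perm_onC tA uD _; by rewrite disjoint_sym disjoints_subset setDE subsetIr.
rewrite ot ou cA coprime_sym; elim: l ck {IH hl cl hs ou} => [|r l IHl] /=;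
    first by rewrite big_nil coprime1n.
by case/andP=> kr /IHl h; rewrite big_cons coprimeMl h coprime_sym kr.
Qed.

(** The converse of [ell_order_le]: disjoint cycles, one for each prime power of [m]. *)
Lemma exists_perm_ell (m : nat) : (0 < m)%N -> (ell m <= #|T|)%N ->
  exists t : {perm T}, #[t] = m.
Proof.
move=> m0 hm.
have [|||t [_ ot]] := @exists_perm_prod [seq (q ^ logn q m)%N | q <- primes m] [set: T].
- apply/allP => _ /mapP [q + ->]; rewrite mem_primes => /andP [qp _].
  by rewrite expn_gt0 prime_gt0.
- rewrite pairwise_map; have := primes_uniq m.
  have : all prime (primes m) by apply/allP=> q; rewrite mem_primes => /andP [].
  elim: (primes m) => //= q l IH /andP [qp lp] /andP [ql ul].
  rewrite IH // andbT; apply/allP=> r rl /=.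
  rewrite coprimeXl // coprimeXr // prime_coprime // dvdn_prime2 ?(allP lp _ rl) //.
  by apply: contra ql => /eqP ->.
- by rewrite sumnE big_map; apply: leq_trans hm _; rewrite cardsT.
by exists t; rewrite ot big_map [RHS](prod_prime_decomp m0) prime_decompE big_map.
Qed.

End CyclePerm.

Lemma landau_gt0 n : 0 < landau n.
Proof.
by apply: leq_trans (leq_bigmax (1%g : 'S_n)); rewrite order1.
Qed.

Lemma landau_max n m : 0 < m -> ell m <= n -> m <= landau n.
Proof.
move=> m0 hm; have [|t <-] := @exists_perm_ell 'I_n m m0; first by rewrite card_ord.
exact: (leq_bigmax t).
Qed.

Lemma ell_landau n : ell (landau n) <= n.
Proof.
rewrite /landau; have [|s ->] := @eq_bigmax 'S_n (fun s => #[s]%g).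
  by apply/card_gt0P; exists 1%g.
by have := ell_order_le s; rewrite card_ord.
Qed.

Lemma ellM a b : 0 < a -> 0 < b -> coprime a b -> ell (a * b) = ell a + ell b.
Proof.
move=> a0 b0 cab; rewrite /ell.
have disj q : q \in primes a -> q \notin primes b.
  by move: cab; rewrite coprime_has_primes // => /hasPn h qa; apply: contraL qa => /h.
rewrite (perm_big (primes a ++ primes b)) /=; last first.
  apply: uniq_perm => [||q]; first exact: primes_uniq.
    rewrite cat_uniq !primes_uniq /= andbT; apply/hasPn=> q qb.
    by apply: contraL qb => /disj.
  by rewrite mem_cat primesM.
rewrite big_cat /=; congr (_ + _); apply: eq_big_seq => q qa; rewrite lognM //.
  by have := disj _ qa; rewrite -logn_gt0 lt0n negbK => /eqP ->; rewrite addn0.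
suff : q \notin primes a by rewrite -logn_gt0 lt0n negbK => /eqP ->.
by apply: contraL qa => /disj.
Qed.

Lemma ell_prime_pow q k : prime q -> 0 < k -> ell (q ^ k) = q ^ k.
Proof.
move=> qp k0; rewrite /ell primesX // primes_prime // big_seq1.
by rewrite lognX logn_prime // eqxx muln1.
Qed.

Lemma ell_mul_prime m r : 0 < m -> prime r -> ~~ (r %| m) -> ell (m * r) = ell m + r.
Proof.
move=> m0 rp rm; rewrite ellM // ?prime_gt0 //.
  by rewrite -{1}[r]expn1 ell_prime_pow // expn1.
by rewrite coprime_sym prime_coprime.
Qed.

(** Lowering the exponent of [p] from [a + 1] to [a] saves [p ^ (a + 1) - p ^ a >= p] if [a > 0]; if
    [a = 0], the prime disappears and saves [p]. *)
Lemma ell_div_prime g p : 0 < g -> prime p -> p %| g -> ell (g %/ p) + p <= ell g.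
Proof.
move=> g0 pp pg; have [m cpm Eg] := pfactor_coprime pp g0.
have a0 : 0 < logn p g by rewrite logn_gt0 mem_primes pp g0.
move: Eg a0; case: (logn p g) => // a Eg _.
have m0 : 0 < m by move: g0; rewrite Eg; case: (m).
have p1 := prime_gt1 pp.
have p0 := prime_gt0 pp.
have -> : g %/ p = m * p ^ a by rewrite Eg expnSr mulnA mulnK.
have -> : ell g = ell m + p ^ a.+1.
  rewrite {1}Eg ellM ?expn_gt0 ?p0 //; last by rewrite coprimeXr // coprime_sym.
  by rewrite ell_prime_pow.
case: a {Eg} => [|a].
  by rewrite expn0 muln1 expn1.
rewrite ellM ?expn_gt0 ?p0 //; last by rewrite coprimeXr // coprime_sym.
rewrite ell_prime_pow // -addnA leq_add2l [p ^ a.+2]expnS.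
have : p <= p ^ a.+1 by rewrite -{1}[p]expn1 leq_pexp2l.
by move: (p ^ a.+1) => u; nia.
Qed.

Lemma sum_prime_divisors_le_ell g (l : seq nat) : 0 < g -> uniq l ->
  {in l, forall q, prime q /\ q %| g} -> \sum_(q <- l) q <= ell g.
Proof.
move=> g0 ul hl.
have -> : \sum_(q <- l) q = \sum_(q <- [seq q <- primes g | q \in l]) q.
  apply: perm_big; apply: uniq_perm; rewrite ?filter_uniq ?primes_uniq // => q.
  rewrite mem_filter; apply/idP/andP=> [ql|[]//]; split=> //.
  by have [qp qg] := hl _ ql; rewrite mem_primes qp g0.
rewrite big_filter big_mkcond /ell big_seq [in leqRHS]big_seq; apply: leq_sum => q.
rewrite -logn_gt0 => q0; case: ifP => // ql; have [qp _] := hl _ ql.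
by rewrite -{1}[q]expn1 leq_pexp2l // prime_gt0.
Qed.

Section Exchange.
Variables (n p : nat).
Hypotheses (pp : prime p) (pg : p %| landau n).

Let g0 : 0 < landau n := landau_gt0 n.

Lemma ell_mul2_primes m r1 r2 : 0 < m -> prime r1 -> prime r2 -> r1 != r2 ->
  ~~ (r1 %| m) -> ~~ (r2 %| m) -> ell (m * (r1 * r2)) = ell m + (r1 + r2).
Proof.
move=> m0 p1 p2 n12 d1 d2; rewrite mulnA ell_mul_prime ?muln_gt0 ?m0 ?prime_gt0 //.
  by rewrite ell_mul_prime // addnA.
by rewrite Euclid_dvdM // negb_or d2 dvdn_prime2 // eq_sym.
Qed.

Lemma landau_exchange1 r1 r2 : prime r1 -> prime r2 -> r1 != r2 ->
  ~~ (r1 %| landau n) -> ~~ (r2 %| landau n) -> r1 + r2 <= p -> r1 * r2 <= p.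
Proof.
move=> p1 p2 n12 d1 d2 hs; rewrite leqNgt; apply/negP=> hp.
have Eg := divnK pg; set m := landau n %/ p in Eg.
have m0 : 0 < m by move: g0; rewrite -Eg; case: (m).
have mg : m %| landau n by rewrite -Eg dvdn_mulr.
have nd r : ~~ (r %| landau n) -> ~~ (r %| m) by apply: contra => /dvdn_trans; apply.
have := @landau_max n (m * (r1 * r2)).
rewrite muln_gt0 m0 muln_gt0 !prime_gt0 // => /(_ isT).
rewrite ell_mul2_primes ?nd // -Eg leq_pmul2l // [r1 * r2 <= _]leqNgt hp.
move=> h; apply: (elimF idP _ (h _)) => //.
apply: leq_trans (ell_landau n).
by apply: leq_trans (ell_div_prime g0 pp pg); rewrite leq_add2l.
Qed.

Lemma landau_exchange2 s r1 r2 : prime r1 -> prime r2 -> r1 != r2 ->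
  ~~ (r1 %| landau n) -> ~~ (r2 %| landau n) -> prime s -> s != p -> s %| landau n ->
  r1 + r2 <= p + s -> r1 * r2 <= p * s.
Proof.
move=> p1 p2 n12 d1 d2 sp nsp sg hs; rewrite leqNgt; apply/negP=> hp.
have Eg := divnK pg; set m := landau n %/ p in Eg.
have m0 : 0 < m by move: g0; rewrite -Eg; case: (m).
have sm : s %| m by move: sg; rewrite -Eg Euclid_dvdM // => /orP [] //;
    rewrite dvdn_prime2 // (negbTE nsp).
have Em := divnK sm; set k := m %/ s in Em.
have k0 : 0 < k by move: m0; rewrite -Em; case: (k).
have kg : k %| landau n by rewrite -Eg -Em -mulnA dvdn_mulr.
have nd r : ~~ (r %| landau n) -> ~~ (r %| k) by apply: contra => /dvdn_trans; apply.
have := @landau_max n (k * (r1 * r2)).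
rewrite muln_gt0 k0 muln_gt0 !prime_gt0 // => /(_ isT).
rewrite ell_mul2_primes ?nd // -Eg -Em -mulnA leq_pmul2l // [r1 * r2 <= _]leqNgt [s * p]mulnC hp.
move=> h; apply: (elimF idP _ (h _)) => //.
apply: leq_trans (ell_landau n).
apply: leq_trans (ell_div_prime g0 pp pg); rewrite -/m.
have := ell_div_prime m0 sp sm; rewrite -/k; move: (ell k) (ell m) hs => a b; clear; lia.
Qed.

End Exchange.

(** * Primes not dividing [landau n] *)

Section Nondividing.
Variables (n p : nat).
Hypotheses (pp : prime p) (pg : p %| landau n).

(* Exchanging [p] and [s] for [r1] and [r2] is forbidden, so [s] is again a
   nondividing prime, and the pair [(s, r1)] is smaller than [(r1, r2)]. *)
Lemma nondividing_pair_absurd R : R <= p ->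
  (forall r1 r2, prime r1 -> prime r2 -> p < r1 * r1 -> r1 < r2 <= R -> p < r1 + r2 ->
     exists s, [/\ prime s, p < s * s, r1 + r2 <= p + s & p * s < r1 * r2]) ->
  forall r1 r2, prime r1 -> prime r2 -> p < r1 * r1 -> r1 < r2 <= R ->
    ~~ (r1 %| landau n) -> ~~ (r2 %| landau n) -> False.
Proof.
move=> Rp hgap r1 r2; have [k] := ubnP (r1 + r2).
elim: k r1 r2 => // k IH r1 r2 hk p1 p2 h1 /andP [h12 h2] d1 d2.
have n12 : r1 != r2 by rewrite neq_ltn h12.
have [hs|hs] := leqP (r1 + r2) p.
  by have := landau_exchange1 pp pg p1 p2 n12 d1 d2 hs; clear -h1 h12; nia.
have [|s [sp ss hrs hps]] := hgap r1 r2 p1 p2 h1 _ hs; first by rewrite h12.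
have s1 : s < r1 by move: hps h12 h2 Rp; clear; nia.
have [sg|sg] := boolP (s %| landau n); last first.
  apply: (IH s r1) => //; first by move: hk s1 h12; clear; lia.
  by rewrite s1 (leq_trans (ltnW h12)).
have nsp : s != p by rewrite neq_ltn (leq_trans s1) // (leq_trans (ltnW h12)) // (leq_trans h2).
by have := landau_exchange2 pp pg p1 p2 n12 d1 d2 sp nsp sg hrs; rewrite leqNgt hps.
Qed.

(** The primes of [l] dividing [landau n] have sum at most [n - p], since [p] divides it too; of the
    others there is at most one, and it is at most [R]. *)
Lemma sum_primes_le_landau R (l : seq nat) : R < p -> uniq l ->
  {in l, forall q, [/\ prime q, p < q * q & q <= R]} ->
  (forall r1 r2, prime r1 -> prime r2 -> p < r1 * r1 -> r1 < r2 <= R ->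
    ~~ (r1 %| landau n) -> ~~ (r2 %| landau n) -> False) ->
  \sum_(q <- l) q + p <= n + R.
Proof.
move=> Rp ul hl habs.
have h1 : \sum_(q <- l | q %| landau n) q + p <= n.
  rewrite -big_filter addnC -(big_cons _ _ p _ xpredT id).
  apply: leq_trans (ell_landau n); apply: sum_prime_divisors_le_ell.
  - exact: landau_gt0.
  - rewrite /= filter_uniq // andbT mem_filter negb_and; apply/orP; right.
    by apply/negP=> /hl [_ _]; rewrite leqNgt Rp.
  - move=> q; rewrite inE => /orP [/eqP -> //|]; rewrite mem_filter => /andP [qg /hl []].
    by [].
have h2 : \sum_(q <- l | ~~ (q %| landau n)) q <= R.
  rewrite -big_filter; set l' := [seq _ <- _ | _].
  have hl' q : q \in l' -> [/\ prime q, p < q * q, q <= R & ~~ (q %| landau n)].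
    by rewrite mem_filter => /andP [qg /hl []].
  have : uniq l' by rewrite filter_uniq.
  case: l' hl' => [|a [|b l']] hl'; first by rewrite big_nil.
    by rewrite big_seq1; have [] := hl' a (mem_head _ _).
  have [a1 a2 a3 a4] := hl' a (mem_head _ _).
  have [|b1 b2 b3 b4] := hl' b; first by rewrite !inE eqxx orbT.
  rewrite /= inE negb_or => /andP [/andP [nab _] _]; exfalso.
  move: nab; rewrite neq_ltn => /orP [ab|ab].
    by apply: (habs a b); rewrite ?ab.
  by apply: (habs b a); rewrite ?ab.
rewrite (bigID (fun q => q %| landau n)) /=; lia.
Qed.

End Nondividing.

(** * Search through the sets of nondividing primes *)

Lemma mem_cat_consCA (T : eqType) (x y : T) (s t : seq T) :
  (x \in s ++ y :: t) = (x \in y :: s ++ t).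
Proof. by rewrite !(mem_cat, inE) orbCA. Qed.

(* [U]: nondividing primes, [D]: dividing primes in decreasing order. *)
Section Search.
Variables (n : nat) (p : N).
Hypotheses (pp : prime p) (pg : p %| landau n).

(** [true] means that no contradictory exchange was found; as [D] decreases, the scan may stop at
    the first [s] too small for the sum. *)
Fixpoint no_swap (sm pr : N) (D : seq N) : bool :=
  if D is s :: D' then
    if N.ltb (N.add p s) sm then true
    else if N.ltb (N.mul p s) pr then false else no_swap sm pr D'
  else true.

(** A useful [s] satisfies [p * s < u * q], so it is smaller than both [u] and [q]. With the primes
    treated in increasing order, it has been classified before [q] is. *)
Definition compatible (D : seq N) (q u : N) : bool :=
  if N.leb (N.add u q) p then ~~ N.ltb p (N.mul u q)
  else no_swap (N.add u q) (N.mul u q) D.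

Fixpoint may_not_divide (U D : seq N) (q : N) : bool :=
  if U is u :: U' then if compatible D q u then may_not_divide U' D q else false
  else true.

Lemma may_not_divideE U D q : may_not_divide U D q = all (compatible D q) U.
Proof. by elim: U => //= u U ->; case: compatible. Qed.

(** [t] is what the dividing primes still have to contribute. A branch closes when the truncated
    subtraction reaches [0], and fails when the primes run out before. *)
Fixpoint search (l U D : seq N) (t : N) : bool :=
  if t is N0 then true else
  if l is q :: l' then
    search l' U (q :: D) (N.sub t q) &&
    (if may_not_divide U D q then search l' (q :: U) D t else true)
  else false.

Lemma no_swapP sm pr D : ~~ no_swap sm pr D ->
  exists2 s, s \in D & (sm <= p + s) && (p * s < pr).
Proof.
elim: D => //= s D IH; case: N.ltb_spec => // h1; case: N.ltb_spec => h2.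
  by move=> _; exists s; [exact: mem_head | lia].
by move=> /IH [s' s'D hs']; exists s' => //; rewrite inE s'D orbT.
Qed.

Lemma searchP l U D t : search l U D t ->
  uniq (l ++ U) -> {in l ++ U, forall q : N, prime q} -> {in l ++ D, forall q : N, q < p} ->
  {in D, forall q : N, prime q && (q %| landau n)} ->
  {in U, forall q : N, ~~ (q %| landau n)} ->
  t <= \sum_(q <- l | q %| landau n) (q : nat).
Proof.
elim: l U D t => [|q l IH] U D t /=; first by case: t.
case: t => [//|t]; move: {t}(Npos t) => t.
move=> /andP [h1 h2] /andP [uq ul] hp hlt hD hU.
have qp : prime q by apply: hp; exact: mem_head.
have qltp : q < p by apply: hlt; exact: mem_head.
have hp' : {in l ++ U, forall q : N, prime q} by move=> x xl; apply: hp; rewrite inE xl orbT.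
rewrite big_cons; case: ifP => [qg|qg].
  have := IH U (q :: D) _ h1 ul hp' _ _ hU.
  have hlt' : {in l ++ q :: D, forall q : N, q < p}.
    by move=> x; rewrite mem_cat_consCA; exact: hlt.
  have hD' : {in q :: D, forall q : N, prime q && (q %| landau n)}.
    by move=> x; rewrite inE => /orP [/eqP ->|/hD //]; rewrite qp qg.
  by move=> /(_ hlt' hD'); lia.
move: h2; case: ifP => [_ h2|/negbT nd _].
  apply: IH h2 _ _ _ hD _.
  - move: uq ul; rewrite !cat_uniq mem_cat negb_or /= => /andP [ql qU] /and3P [-> ha ->].
    by rewrite (negbTE ql) /= ha qU.
  - by move=> x; rewrite mem_cat_consCA; exact: hp.
  - by move=> x xl; apply: hlt; rewrite inE xl orbT.
  - by move=> x; rewrite inE => /orP [/eqP ->|/hU //]; rewrite qg.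
exfalso; rewrite may_not_divideE in nd; case/allPn: nd => u uU; rewrite /compatible.
have up : prime u by apply: hp; rewrite inE mem_cat uU !orbT.
have nuq : (u : nat) != q.
  apply: contra uq => /eqP E; have -> : q = u by lia.
  by rewrite mem_cat uU orbT.
have ud := hU u uU.
case: N.leb_spec => h.
  rewrite negbK; case: N.ltb_spec => // hpr _.
  by have := landau_exchange1 pp pg up qp nuq ud (negbT qg); clear -h hpr; lia.
case/no_swapP => s sD /andP [hs1 hs2].
have /andP [sp sg] := hD s sD.
have nsp : (s : nat) != p by rewrite neq_ltn hlt // inE mem_cat sD !orbT.
by have := landau_exchange2 pp pg up qp nuq ud (negbT qg) sp nsp sg; clear -hs1 hs2; lia.
Qed.

End Search.

(** * Sieve *)

(* Clears the entries [c], [c + q], [c + 2 q], ... of [l]. *)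
Fixpoint mark (q c : nat) (l : seq bool) : seq bool :=
  if l is b :: l' then
    if c is c'.+1 then b :: mark q c' l' else false :: mark q q.-1 l'
  else [::].

(** All primes below [317]. Since [317 * 317 = 100489], they suffice for sieving up to [100480], the
    largest bound used. *)
Definition small_primes : seq nat :=
  [:: 2; 3; 5; 7; 11; 13; 17; 19; 23; 29; 31; 37; 41; 43; 47; 53; 59; 61; 67; 71;
   73; 79; 83; 89; 97; 101; 103; 107; 109; 113; 127; 131; 137; 139; 149; 151; 157;
   163; 167; 173; 179; 181; 191; 193; 197; 199; 211; 223; 227; 229; 233; 239; 241;
   251; 257; 263; 269; 271; 277; 281; 283; 293; 307; 311; 313].

Definition prime_flags (B : nat) : seq bool :=
  foldr (fun q l => mark q (2 * q) l) [:: false, false & nseq B true] small_primes.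

Fixpoint indices (y : N) (l : seq bool) : seq N :=
  if l is b :: l' then
    if b then y :: indices (N.succ y) l' else indices (N.succ y) l'
  else [::].

Lemma size_mark q c l : size (mark q c l) = size l.
Proof. by elim: l c => //= b l IH [|c] /=; rewrite IH. Qed.

Lemma nth_mark q c l i : 0 < q ->
  nth false (mark q c l) i = nth false l i && ~~ ((c <= i) && (q %| i - c)).
Proof.
move=> q0; elim: l c i => [|b l IH] c i; first by rewrite /= !nth_nil.
case: c i => [|c] [|i] //=.
- by rewrite subnn dvdn0 andbF.
- rewrite IH subn0; case: (leqP q.-1 i) => h /=; last first.
    suff -> : q %| i.+1 = false by rewrite ?andbT.
    by rewrite /dvdn modn_small //; lia.
  have -> : i.+1 = q + (i - q.-1) by lia.
  by rewrite dvdn_addr ?dvdnn.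
- by rewrite andbT.
- by rewrite IH ltnS subSS.
Qed.

Lemma small_primesP q : (q < 317) && prime q = (q \in small_primes).
Proof.
have [h|h] /= := ltnP q 317.
  have : all (fun q => prime q == (q \in small_primes)) (iota 0 317) by vm_compute.
  by move=> /allP /(_ q); rewrite mem_iota => /(_ h) /eqP.
symmetry; apply: contraTF h => ql.
have : all (fun q => q < 317) small_primes by vm_compute.
by move=> /allP /(_ q ql); rewrite ltnNge.
Qed.

Lemma nth_prime_flags B i : i < 317 * 317 -> i < B.+2 ->
  nth false (prime_flags B) i = prime i.
Proof.
move=> iM iB.
have h : nth false (prime_flags B) i =
    (1 < i) && all (fun q => ~~ ((2 * q <= i) && (q %| i - 2 * q))) small_primes.
  rewrite /prime_flags; have : all (leq 1) small_primes by vm_compute.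
  elim: small_primes => [_|q l IH /= /andP [q0 ql]].
    by case: i iB {iM} => [|[|i]] //= iB; rewrite nth_nseq; case: ltnP => //; lia.
  by rewrite nth_mark // IH // -andbA [all _ _ && _]andbC.
rewrite h; apply/andP/idP=> [[i1 /allP ha]|ip].
  have [//|[q qp /andP [q2 qi]]] : prime i \/ exists2 q, prime q & (q * q <= i) && (q %| i).
    have [ip|/primePn [|[d /andP [d1 di] dd]]] := boolP (prime i); [by left|lia|].
    right; have m0 : 0 < i by lia.
    exists (pdiv i); first exact: pdiv_prime.
    rewrite pdiv_dvd andbT; case/dvdnP: dd => e Ee.
    have pd : pdiv i <= d by apply: pdiv_min_dvd => //; rewrite Ee dvdn_mull.
    have pe : pdiv i <= e by apply: pdiv_min_dvd; [nia|rewrite Ee dvdn_mulr].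
    by rewrite Ee; apply: leq_mul; rewrite -Ee.
  have ql : q \in small_primes.
    rewrite -small_primesP qp andbT ltnNge; apply/negP=> hq.
    by rewrite ltnNge (leq_trans (leq_mul hq hq)) in iM.
  have q2i : 2 * q <= i by apply: leq_trans q2; rewrite leq_mul2r prime_gt1 ?orbT.
  by have := ha q ql; rewrite q2i dvdn_sub ?dvdn_mull.
split; first exact: prime_gt1.
apply/allP=> q; rewrite -small_primesP => /andP [_ qp]; apply/negP=> /andP [h1 h2].
move: h2; rewrite dvdn_subl ?dvdn_mull // dvdn_prime2 // => /eqP E.
by have := prime_gt1 qp; rewrite E; lia.
Qed.

Lemma size_prime_flags B : size (prime_flags B) = B.+2.
Proof.
rewrite /prime_flags; elim: small_primes => [|q l IH] /=; first by rewrite size_nseq.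
by rewrite size_mark.
Qed.

Lemma mem_indices y l (q : N) :
  (q \in indices y l) = (y <= q) && nth false l (q - y).
Proof.
elim: l y => [|b l IH] y /=; first by rewrite nth_nil andbF.
have E : (nat_of_bin (N.succ y) = y.+1)%N by lia.
case: b; rewrite ?inE IH E.
  case: eqP => [->|nq] /=; first by rewrite leqnn subnn.
  have [h|h] := leqP y q; last by rewrite ltnNge (ltnW h).
  have -> : (q - y = (q - y.+1).+1)%N by lia.
  by have -> : (y < q)%N by lia.
have [h|h] := ltnP y q.
  by rewrite (ltnW h); have -> : (q - y = (q - y.+1).+1)%N by lia.
by have [->|] := eqVneq (y : nat) q; [rewrite subnn andbF | case: leqP => //; lia].
Qed.

Definition primes_below (B : N) : seq N := indices 0 (prime_flags (nat_of_bin B).-2).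

Lemma mem_primes_below (B q : N) : N.leb 2 B && N.leb B (317 * 317) ->
  (q \in primes_below B) = (q < B) && prime q.
Proof.
move=> /andP [/N.leb_spec0 B2 /N.leb_spec0 hB].
have {B2}B2 : 2 <= B by lia.
have {hB}hB : B <= 317 * 317.
  have e : nat_of_bin 317 = 317%N by [].
  by rewrite -e; move: hB; move: (317%num) => c; clear; lia.
rewrite mem_indices leq0n subn0 /=.
have [h|h] := ltnP q B; last by rewrite nth_default // size_prime_flags; lia.
by rewrite nth_prime_flags ?(leq_trans h) //; lia.
Qed.

Lemma mem_primes_belowN (B q : N) : N.leb 2 B && N.leb B (317 * 317) ->
  (q \in primes_below B) = N.ltb q B && prime q.
Proof.
move=> hB; rewrite mem_primes_below //; congr (_ && _).
by case: N.ltb_spec => h; [apply/idP | apply/negbTE]; lia.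
Qed.

Lemma uniq_indices y l : uniq (indices y l).
Proof.
elim: l y => [|[] l IH] y //=; rewrite IH andbT mem_indices negb_and -ltnNge.
by apply/orP; left; lia.
Qed.

Lemma uniq_primes_below B : uniq (primes_below B).
Proof. exact: uniq_indices. Qed.

(** * Bounds for the logarithm *)

Section LnBounds.
Import Order.TTheory GRing.Theory Num.Theory.
Import classical_sets boolp topology normedtype derive realfun numFieldNormedType.Exports.
Local Open Scope ring_scope.
Variable R : realType.
Implicit Types (u x y : R).

Lemma monotone_of_derive_ge0 (f df : R -> R) (a b : R) : a <= b ->
  (forall x, a <= x -> is_derive x 1 f (df x)) ->
  (forall x, a <= x -> 0 <= df x) -> f a <= f b.
Proof.
move=> ab hf hd.
apply: (@ger0_derive1_le_cc R f a b) => //; rewrite ?in_itv/= ?lexx ?ab //.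
- by move=> x; rewrite in_itv /= => /andP [/ltW /hf h _]; exact: ex_derive.
- move=> x; rewrite in_itv /= => /andP [/ltW ax _]; rewrite derive1E.
  by have [_ ->] := hf x ax; exact: hd.
- apply: derivable_within_continuous => x; rewrite in_itv /= => /andP [/hf h _].
  exact: ex_derive.
Qed.

(** Both rational bounds for [ln] have this partial fraction form up to a constant. *)
Lemma is_derive_partial_fraction (a b c d x : R) : 0 < x -> 0 <= d ->
  is_derive x 1 (fun y => a * y + b * y^-1 + c * (y + d)^-1)
    (a - b / x ^+ 2 - c / (x + d) ^+ 2).
Proof.
move=> x0 d0.
have x00 : x != 0 by rewrite gt_eqF.
have xd0 : x + d != 0 by rewrite gt_eqF // ltr_wpDr.
have h1 : is_derive x 1 (fun y : R => y + d) 1.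
  by apply: is_derive_eq; rewrite addr0.
have h2 := is_deriveV (f := fun y : R => y + d) xd0 h1.
have h3 := is_deriveV (f := fun y : R => y) x00 (is_derive_id x 1).
have h4 := @is_deriveZ _ _ _ _ a x _ _ (is_derive_id x 1).
have h5 := @is_deriveZ _ _ _ _ b x _ _ h3.
have h6 := @is_deriveZ _ _ _ _ c x _ _ h2.
have h7 := @is_deriveD _ _ _ _ _ x _ _ _ (@is_deriveD _ _ _ _ _ x _ _ _ h4 h5) h6.
apply: (@is_derive_eq _ _ _ _ _ _ _ _ h7).
by rewrite /GRing.scale /= !mulr1 !mulrN.
Qed.

(** The image of the bound in [ln_le] under [u -> 1 / u]. The difference from [ln] has a derivative
    with a triple zero at [1], so the error is of order [(u - 1) ^ 4]. *)
Lemma ln_ge u : 1 <= u -> (u - 1) * (5 * u + 1) / (2 * u * (u + 2)) <= ln u.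
Proof.
move=> u1.
pose r (x : R) := 0 * x + (-1/4) * x^-1 + (-27/4) * (x + 2)^-1.
pose f (x : R) := ln x - r x.
pose df (x : R) := x^-1 - (0 - (-1/4) / x ^+ 2 - (-27/4) / (x + 2) ^+ 2).
have : f 1 <= f u.
  apply: (@monotone_of_derive_ge0 f df 1 u u1) => x x1; have x0 : 0 < x by lra.
    have h2 := is_derive_partial_fraction 0 (-1/4) (-27/4) x0 (ler0n R 2).
    exact: (@is_deriveB _ _ _ _ _ x _ _ _ (is_derive1_ln x0) h2).
  have -> : df x = (x - 1) ^+ 3 / (x ^+ 2 * (x + 2) ^+ 2) by rewrite /df; field; lra.
  apply: divr_ge0; first by rewrite exprn_ge0 // subr_ge0.
  by rewrite mulr_ge0 ?sqr_ge0.
rewrite /f ln1 /r.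
have -> : (u - 1) * (5 * u + 1) / (2 * u * (u + 2)) =
   5/2 + (0 * u + (-1/4) * u^-1 + (-27/4) * (u + 2)^-1) by field; lra.
have -> : 0 * 1 + -1 / 4 * 1^-1 + -27 / 4 * (1 + 2)^-1 = - (5/2) :> R by field.
lra.
Qed.

(** The Padé approximant of [ln] at [1] with numerator of degree 2 and denominator of degree 1. *)
Lemma ln_le u : 1 <= u -> ln u <= (u - 1) * (u + 5) / (4 * u + 2).
Proof.
move=> u1.
pose r (x : R) := (1/4) * x + 0 * x^-1 + (-27/16) * (x + 1/2)^-1.
pose f (x : R) := r x - ln x.
pose df (x : R) := (1/4 - 0 / x ^+ 2 - (-27/16) / (x + 1/2) ^+ 2) - x^-1.
have : f 1 <= f u.
  apply: (@monotone_of_derive_ge0 f df 1 u u1) => x x1; have x0 : 0 < x by lra.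
    have h2 := @is_derive_partial_fraction (1/4) 0 (-27/16) (1/2) x x0 ltac:(lra).
    exact: (@is_deriveB _ _ _ _ _ x _ _ _ h2 (is_derive1_ln x0)).
  have -> : df x = (x - 1) ^+ 3 / (x * (2 * x + 1) ^+ 2) by rewrite /df; field; lra.
  apply: divr_ge0; first by rewrite exprn_ge0 // subr_ge0.
  by rewrite mulr_ge0 ?sqr_ge0 // ltW.
rewrite /f ln1 /r.
have -> : (u - 1) * (u + 5) / (4 * u + 2) =
   7/8 + (1/4 * u + 0 * u^-1 + (-27/16) * (u + 1/2)^-1) by field; lra.
have -> : 1 / 4 * 1 + 0 * 1^-1 + -27 / 16 * (1 + 1 / 2)^-1 = - (7/8) :> R by field.
lra.
Qed.

(** The three arguments are close to [1], where the rational bounds are sharp. *)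
Lemma ln2_decomposition : ln 2 = 7 * ln (16/15) + 5 * ln (25/24) + 3 * ln (81/80) :> R.
Proof.
have E : 2 = (16/15) ^+ 7 * (25/24) ^+ 5 * (81/80) ^+ 3 :> R by field.
have p1 : (0 : R) < 16/15 by lra.
have p2 : (0 : R) < 25/24 by lra.
have p3 : (0 : R) < 81/80 by lra.
rewrite [X in ln X = _]E; move: (16/15) (25/24) (81/80) p1 p2 p3 {E} => a b c a0 b0 c0.
have h1 : 0 < a ^+ 7 by rewrite exprn_gt0.
have h2 : 0 < b ^+ 5 by rewrite exprn_gt0.
have h3 : 0 < c ^+ 3 by rewrite exprn_gt0.
have e1 : ln (a ^+ 7) = 7 * ln a by rewrite lnXn // mulr_natl.
have e2 : ln (b ^+ 5) = 5 * ln b by rewrite lnXn // mulr_natl.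
have e3 : ln (c ^+ 3) = 3 * ln c by rewrite lnXn // mulr_natl.
rewrite -e1 -e2 -e3.
move: (a ^+ 7) (b ^+ 5) (c ^+ 3) h1 h2 h3 => x y z x0 y0 z0.
by rewrite lnM ?posrE ?mulr_gt0 // lnM ?posrE.
Qed.

(** [192 / 277] is a convergent of the continued fraction of [ln 2], less than [10 ^ -5] below
    it. *)
Lemma ln2_ge : 192 / 277 <= ln 2 :> R.
Proof.
have h u x : 1 <= u -> (u - 1) * (5 * u + 1) / (2 * u * (u + 2)) = x -> x <= ln u.
  by move=> u1 <-; exact: ln_ge.
have h1 : 95 / 1472 <= ln (16 / 15) :> R by apply: h; [lra | field].
have h2 : 149 / 3650 <= ln (25 / 24) :> R by apply: h; [lra | field].
have h3 : 485 / (54 * 723) <= ln (81 / 80) :> R by apply: h; [lra | field].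
rewrite ln2_decomposition; lra.
Qed.

Lemma ln2_le : ln 2 <= 314 / 453 :> R.
Proof.
have h u x : 1 <= u -> (u - 1) * (u + 5) / (4 * u + 2) = x -> ln u <= x.
  by move=> u1 <-; exact: ln_le.
have h1 : ln (16 / 15) <= 91 / 1410 :> R by apply: h; [lra | field].
have h2 : ln (25 / 24) <= 145 / 3552 :> R by apply: h; [lra | field].
have h3 : ln (81 / 80) <= 481 / (88 * 440) :> R by apply: h; [lra | field].
rewrite ln2_decomposition; lra.
Qed.

End LnBounds.

(** * The target inequality and its integer form *)

Section Target.
Import Order.TTheory GRing.Theory Num.Theory.
Local Open Scope ring_scope.

Lemma nat_of_binX (a b : N) : nat_of_bin (N.pow a b) = (nat_of_bin a ^ nat_of_bin b)%N.
Proof.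
elim/N.peano_ind: b => [|b IH]; first by rewrite N.pow_0_r.
have -> : nat_of_bin (N.succ b) = (nat_of_bin b).+1 by lia.
by rewrite N.pow_succ_r' expnS -IH; lia.
Qed.

(** The 64th power refines the integer logarithm: [log2_64 M / 64] is less than [1 / 64] below the
    binary logarithm of [M]. *)
Definition log2_64 (M : N) : N := N.log2 (N.pow M 64).

(* [192 / 277 < ln 2] and [166 / 125 = 1.328]. *)
Definition enough (M p : N) : bool :=
  N.leb (64 * 277 * (125 * 125) * (p * p)) (192 * (166 * 166) * (M * log2_64 M)).

Section Enough.
Variable R : realType.

Definition largest_prime_bound (n p : nat) : Prop :=
  p%:R <= 1328%:R / 1000%:R * Num.sqrt (n%:R * ln (n%:R : R)) :> R.

Lemma ln_nat_ge0 (n : nat) : 0 <= ln (n%:R : R).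
Proof. by case: n => [|n]; [rewrite ln0 | apply: ln_ge0; rewrite ler1n]. Qed.

Lemma bound_of_square (n p : nat) :
  p%:R ^+ 2 <= (166 / 125) ^+ 2 * (n%:R * ln (n%:R : R)) -> largest_prime_bound n p.
Proof.
move=> h; rewrite /largest_prime_bound.
have x0 : 0 <= n%:R * ln (n%:R : R) by rewrite mulr_ge0 ?ler0n ?ln_nat_ge0.
set c : R := 1328%:R / 1000%:R.
have c0 : 0 <= c by rewrite /c; lra.
have c2 : c = 166 / 125 by rewrite /c; field.
clearbody c; move: (n%:R * ln _) x0 h => x x0 h.
have h1 : 0 <= c * Num.sqrt x by rewrite mulr_ge0 ?sqrtr_ge0.
by rewrite -(@ler_pXn2r _ 2) ?nnegrE ?ler0n // exprMn sqr_sqrtr // c2.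
Qed.

Lemma ln_ge_log2 (M : N) : (0 < M)%N ->
  (log2_64 M : nat)%:R / 64%:R * (192 / 277) <= ln ((M : nat)%:R : R).
Proof.
move=> M0; set k := log2_64 M.
have h : ((2 ^ k)%N <= M ^ 64)%N.
  have e1 := nat_of_binX 2 k; have e2 := nat_of_binX M 64.
  have h0 : (0 < nat_of_bin (N.pow M 64))%N by rewrite e2 expn_gt0 M0.
  have e3 : nat_of_bin 2 = 2%N by [].
  have e4 : nat_of_bin 64 = 64%N by [].
  rewrite e3 in e1; rewrite e4 in e2; rewrite -e1 -e2 {e1 e2 e3 e4}.
  move: (N.log2_spec (N.pow M 64)); rewrite -/(log2_64 M) -/k.
  move: h0; move: (N.pow M 64) (N.pow 2 k) (N.pow 2 (N.succ k)) => a b c; clear.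
  by move=> a0 /(_ _) []; lia.
have M0' : 0 < ((M : nat)%:R : R) by rewrite ltr0n.
have h' : k%:R * ln 2 <= 64%:R * ln ((M : nat)%:R : R).
  rewrite !mulr_natl -!lnXn // ler_ln ?posrE ?exprn_gt0 //.
  by rewrite -!natrX ler_nat.
have h2 : (k : nat)%:R * (192 / 277) <= (k : nat)%:R * ln 2 :> R.
  by apply: ler_wpM2l; [exact: ler0n | exact: ln2_ge].
lra.
Qed.

Lemma enoughP (M p : N) (n q : nat) : enough M p -> (M <= n)%N -> (q <= p)%N ->
  largest_prime_bound n q.
Proof.
move=> /N.leb_spec0 h Mn qp; apply: bound_of_square.
(* [M = 0] admits only [p = 0]; this is the state in which [check_row] starts. *)
have [M0|M0] := posnP (nat_of_bin M).
  have -> : q = 0%N.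
    have : M = 0%num by lia.
    move=> E; move: h; rewrite E N.mul_0_l N.mul_0_r; case: p qp => [|p] qp; first by lia.
    by rewrite N.le_0_r.
  by rewrite expr0n mulr_ge0 ?mulr_ge0 ?ler0n ?ln_nat_ge0 //; lra.
have h1 := ln_ge_log2 M0.
have h2 : ln ((M : nat)%:R : R) <= ln n%:R.
  by rewrite ler_ln ?posrE ?ltr0n ?ler_nat // (leq_trans M0).
have h3 : 64 * 277 * (125 * 125) * ((p : nat)%:R * (p : nat)%:R) <=
    192 * (166 * 166) * ((M : nat)%:R * (log2_64 M : nat)%:R) :> R.
  have cast (a b c d e x y z : N) :
      (a * b * (c * c) * (x * x) <= d * (e * e) * (y * z))%num ->
      (a * b * (c * c) * (x * x) <= d * (e * e) * (y * z))%N.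
    by clear; lia.
  by have := cast _ _ _ _ _ _ _ _ h; rewrite -(ler_nat R) !natrM.
have h4 : (q%:R : R) ^+ 2 <= (p : nat)%:R ^+ 2.
  by rewrite ler_pXn2r ?nnegrE ?ler0n // ler_nat.
have h5 : ((M : nat)%:R : R) <= n%:R by rewrite ler_nat.
have h6 : 0 < ((M : nat)%:R : R) by rewrite ltr0n.
have h7 := ler0n R (log2_64 M).
have h8 : 0 <= ln ((M : nat)%:R : R) by exact: ln_nat_ge0.
apply: le_trans h4 _.
have h9 : (M : nat)%:R * ln ((M : nat)%:R : R) <= n%:R * ln n%:R by apply: ler_pM => //; lra.
have h10 : (M : nat)%:R * ((log2_64 M : nat)%:R / 64%:R * (192 / 277)) <=
    (M : nat)%:R * ln ((M : nat)%:R : R) :> R by apply: ler_wpM2l => //; lra.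
rewrite expr2; lra.
Qed.
End Enough.

End Target.

(** * Primes below 100000 *)

(* An entry [(p, a, b, M)] claims that [p] cannot divide [landau n] for [n < M];
   only the primes between [a] and [b] are used in the search. *)
Definition search_table : seq (N * N * N * N) := ([::
  (73, 8, 67, 489); (79, 8, 71, 560); (83, 9, 73, 610); (89, 18, 83, 688);
   (97, 19, 83, 799); (101, 20, 89, 858); (103, 10, 89, 888); (107, 20, 101, 949);
   (109, 20, 101, 980); (113, 10, 97, 1043); (127, 22, 107, 1280); (131, 22, 109, 1352);
   (137, 23, 113, 1463); (139, 23, 113, 1499); (149, 24, 137, 1695);
   (151, 24, 131, 1736); (157, 25, 137, 1858); (163, 25, 139, 1985);
   (167, 12, 139, 2072); (173, 26, 151, 2207); (179, 26, 163, 2343);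
   (181, 26, 167, 2389); (191, 41, 173, 2628); (193, 41, 173, 2679);
   (197, 42, 179, 2776); (199, 42, 181, 2829); (211, 43, 193, 3138);
   (223, 44, 197, 3463); (227, 45, 197, 3574); (229, 45, 199, 3632);
   (233, 45, 199, 3745); (239, 46, 199, 3920); (241, 46, 211, 3975);
   (251, 47, 227, 4278); (257, 48, 227, 4462); (263, 48, 229, 4649);
   (269, 49, 239, 4839); (271, 49, 233, 4905); (277, 49, 241, 5098);
   (281, 50, 239, 5233); (283, 50, 241, 5302); (293, 51, 251, 5640);
   (307, 52, 269, 6130); (311, 52, 271, 6275); (313, 53, 271, 6349);
   (317, 53, 269, 6496); (331, 72, 281, 7021); (337, 73, 283, 7252);
   (347, 55, 293, 7642); (349, 56, 293, 7721); (353, 56, 293, 7880);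
   (359, 56, 307, 8120); (367, 76, 313, 8456); (373, 77, 317, 8703);
   (379, 77, 331, 8953); (383, 78, 349, 9130); (389, 78, 337, 9387);
   (397, 79, 347, 9742); (401, 80, 353, 9917); (409, 80, 353, 10280);
   (419, 81, 359, 10738); (421, 82, 373, 10828); (431, 83, 379, 11296);
   (433, 83, 373, 11388); (439, 83, 379, 11679); (443, 84, 389, 11865);
   (449, 84, 383, 12161); (457, 85, 389, 12554); (461, 85, 401, 12760);
   (463, 86, 397, 12857); (467, 86, 409, 13052); (479, 87, 409, 13667);
   (487, 88, 419, 14079); (491, 88, 421, 14295); (499, 89, 431, 14714)])%num.

Definition search_window (a b : N) : seq N :=
  [seq q <- primes_below 503 | N.leb a q && N.leb q b].

Lemma uniq_search_window a b : uniq (search_window a b).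
Proof. by apply: filter_uniq; apply: uniq_primes_below. Qed.

(** [p] itself counts in the sum of the dividing primes, so the others need to supply only
    [M - p]. *)
Definition search_entry_ok (e : N * N * N * N) : bool :=
  let: (p, a, b, M) := e in
  [&& N.ltb b p, enough M p & search p (search_window a b) [::] [::] (N.sub M p)].

Lemma search_table_ok : all search_entry_ok search_table.
Proof. by vm_cast_no_check (erefl true). Qed.

Lemma search_table_complete :
  all (fun p => N.ltb p 73 || has (fun e => N.eqb e.1.1.1 p) search_table) (primes_below 503).
Proof. by vm_cast_no_check (erefl true). Qed.

Lemma sum_dividing_le n p (l : seq N) : p %| landau n -> prime p ->
  uniq l -> {in l, forall q : N, prime q && (q < p)} ->
  p + \sum_(q <- l | q %| landau n) (q : nat) <= n.
Proof.
move=> pg pp ul hl; apply: leq_trans (ell_landau n).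
pose l' := [seq nat_of_bin q | q <- [seq q <- l | nat_of_bin q %| landau n]].
have -> : p + \sum_(q <- l | q %| landau n) (q : nat) = \sum_(q <- p :: l') q.
  by rewrite big_cons big_map big_filter.
have hl' q : q \in l' -> [/\ prime q, q %| landau n & q < p].
  by case/mapP=> x; rewrite mem_filter => /andP [xg /hl /andP [xp xl]] ->.
apply: sum_prime_divisors_le_ell; first exact: landau_gt0.
  rewrite /= map_inj_uniq ?filter_uniq // ?andbT; last by move=> x y; lia.
  by apply/negP=> /hl' []; rewrite ltnn.
by move=> q; rewrite inE => /orP [/eqP -> //|/hl' []].
Qed.

Lemma largest_prime_bound_search (R : realType) n p :
  prime p -> p %| landau n -> 73 <= p < 503 -> largest_prime_bound R n p.
Proof.
move=> pp pg /andP [p73 p503].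
have Ep := bin_of_natK p; move: (bin_of_nat p) Ep => P Ep.
have PP : P \in primes_below 503.
  by rewrite mem_primes_below // Ep pp andbT.
have /orP [/N.ltb_spec0|/hasP [[[[P' a] b] M] e_in /N.eqb_spec E]] := allP search_table_complete _ PP.
  by lia.
rewrite /= in E; subst P'; have := allP search_table_ok _ e_in.
case/and3P=> /N.ltb_spec0 bP hM hs.
apply: (enoughP _ hM); last by rewrite Ep.
have pP : prime P by rewrite Ep.
have gP : P %| landau n by rewrite Ep.
have hw q : q \in search_window a b -> prime q && (q < P).
  rewrite mem_filter => /andP [/andP [_ /N.leb_spec0 qb]].
  rewrite mem_primes_below // => /andP [_ ->] /=; lia.
have := searchP pP gP hs; rewrite cats0 => h.
have hsum := h _ _ _ _ _; clear h.
have {hsum} h : (N.sub M P <= \sum_(q <- search_window a b | q %| landau n) (q : nat)).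
  apply: hsum => //.
  - exact: uniq_search_window.
  - by move=> q /hw /andP [].
  - by move=> q /hw /andP [].
move: h (sum_dividing_le gP pP (uniq_search_window a b) hw).
by move: (\sum_(_ <- _ | _) _) => S; clear; lia.
Qed.

(* Entry [k] of a row is the largest [m] with [ell m <= k] whose prime factors
   have all been processed. *)
Fixpoint max_rows (s t : seq N) : seq N :=
  match s, t with
  | x :: s', y :: t' => N.max x y :: max_rows s' t'
  | _, _ => [::]
  end.

Definition shift_row (c : N) (row : seq N) : seq N :=
  nseq (nat_of_bin c) 1%num ++ [seq N.mul c x | x <- row].

(** The powers multiply [row], which does not contain [q] yet, and not [acc]; so [q] enters with a
    single exponent. *)
Fixpoint add_powers (fuel : nat) (q c : N) (row acc : seq N) : seq N :=
  if fuel is f.+1 then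
    if N.ltb c 466 then add_powers f q (N.mul c q) row (max_rows acc (shift_row c row))
    else acc
  else acc.

(* [2 ^ 9 > 466], so nine powers of each prime suffice. *)
Definition landau_rows (l : seq N) : seq N :=
  foldr (fun q row => add_powers 9 q q row row) (nseq 466 1%num) l.

Lemma size_max_rows s t : size (max_rows s t) = minn (size s) (size t).
Proof. by elim: s t => [|x s IH] [|y t] //=; rewrite IH minnSS. Qed.

Lemma nth_max_rows s t k : k < size s -> k < size t ->
  nth 1%num (max_rows s t) k = N.max (nth 1%num s k) (nth 1%num t k).
Proof. by elim: s t k => [|x s IH] [|y t] [|k] //= hs ht; exact: IH. Qed.

Lemma size_shift_row c row : size (shift_row c row) = c + size row.
Proof. by rewrite size_cat size_nseq size_map. Qed.

Lemma nth_shift_row c row k : k < size row ->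
  nth 1%num (shift_row c row) k =
  if k < c then 1%num else N.mul c (nth 1%num row (k - c)).
Proof.
move=> hk; rewrite nth_cat size_nseq nth_nseq; case: ltnP => // h.
by rewrite (nth_map 1%num) //; apply: leq_ltn_trans hk; exact: leq_subr.
Qed.

Lemma size_add_powers f q c row acc : size acc = size row ->
  size (add_powers f q c row acc) = size row.
Proof.
elim: f c acc => //= f IH c acc h; case: ifP => // _; apply: IH.
by rewrite size_max_rows h size_shift_row; apply/minn_idPl; exact: leq_addl.
Qed.

(** An entry is a maximum of candidates: the old entry, [1], and the products with powers of [q]. A
    property [P] of all candidates passes to it, which later yields that its value is attained. *)
Lemma nth_add_powers f (q c : N) (row acc : seq N) k : 0 < q -> k < 466 ->
  size acc = size row -> k < size row ->
  (forall P : N -> Prop, P (nth 1%num acc k) -> P 1%num ->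
     (forall i, i < f -> c * q ^ i <= k ->
        P (N.mul (N.mul c (N.pow q (N.of_nat i))) (nth 1%num row (k - c * q ^ i)))) ->
     P (nth 1%num (add_powers f q c row acc) k))
  /\ nth 1%num acc k <= nth 1%num (add_powers f q c row acc) k
  /\ (forall i, i < f -> c * q ^ i <= k ->
     c * q ^ i * nth 1%num row (k - c * q ^ i) <= nth 1%num (add_powers f q c row acc) k).
Proof.
move=> q0 k466; elim: f c acc => [|f IH] c acc hs hk /=; first by split=> //; split.
case: N.ltb_spec => hc; last first.
  split=> //; split=> // i _ ck; exfalso.
  have : c <= c * q ^ i by rewrite leq_pmulr // expn_gt0 q0.
  by move: ck k466 hc; move: (c * q ^ i) => u; clear; lia.
have hs' : size (max_rows acc (shift_row c row)) = size row.
  by rewrite size_max_rows hs size_shift_row; apply/minn_idPl; exact: leq_addl.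
have {IH} [h1 [h2 h3]] := IH (N.mul c q) _ hs' hk.
have E := nth_max_rows (s := acc) (t := shift_row c row) (k := k).
rewrite hs size_shift_row in E; have {}E := E hk (ltn_addl _ hk).
rewrite nth_shift_row // in E.
have Ei i : (N.mul c q * q ^ i)%N = (c * q ^ i.+1)%N by rewrite expnS mulnA; lia.
have Ep i : N.mul (N.mul c q) (N.pow q (N.of_nat i)) = N.mul c (N.pow q (N.of_nat i.+1)).
  by rewrite Nnat.Nat2N.inj_succ N.pow_succ_r'; lia.
split; last split.
- move=> P pa p1 pi; apply: h1 => //.
    rewrite E; case: (N.max_spec (nth 1%num acc k)
      (if k < c then 1%num else N.mul c (nth 1%num row (k - c)))) => -[_ ->] //.
    case: ltnP => // ck.
    by have := pi 0 isT; rewrite expn0 muln1 N.pow_0_r N.mul_1_r; exact.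
  by move=> i fi; rewrite Ei Ep; exact: (pi i.+1).
- apply: leq_trans h2; rewrite E; lia.
- case=> [|i] fi.
    rewrite expn0 muln1 => ck; apply: leq_trans h2; rewrite E ltnNge ck /=; lia.
  by rewrite -Ei; exact: h3.
Qed.

Definition row_spec (l row : seq N) : Prop :=
  size row = 466 /\ forall k, k < 466 ->
  [/\ 0 < nth 1%num row k, ell (nth 1%num row k) <= k,
      forall q, prime q -> q %| nth 1%num row k -> exists2 x : N, x \in l & q = x
    & forall m, 0 < m -> (forall q, prime q -> q %| m -> exists2 x : N, x \in l & q = x) ->
        ell m <= k -> m <= nth 1%num row k].

Lemma row_spec_nil : row_spec [::] (nseq 466 1%num).
Proof.
split; first by rewrite size_nseq.
move=> k hk; rewrite nth_nseq hk (_ : nat_of_bin 1 = 1) //; split=> //.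
- by rewrite /ell big_nil.
- by move=> q qp; rewrite dvdn1 => /eqP q1; move: qp; rewrite q1.
move=> m m0 hm _; rewrite leqNgt; apply/negP=> m1.
by have [x] := hm _ (pdiv_prime m1) (pdiv_dvd m).
Qed.

Lemma row_spec_cons (q : N) l row : prime q -> q \notin l -> row_spec l row ->
  row_spec (q :: l) (add_powers 9 q q row row).
Proof.
move=> qp ql [hs hrow]; split; first by rewrite size_add_powers.
move=> k hk; have hk' : k < size row by rewrite hs.
have [h1 [h2 h3]] := nth_add_powers 9 q (prime_gt0 qp) hk (erefl (size row)) hk'.
have [r0 re rd rm] := hrow k hk.
have powE i : nat_of_bin (N.mul q (N.pow q (N.of_nat i))) = q ^ i.+1.
  have e : nat_of_bin (N.of_nat i) = i by lia.
  by rewrite expnS -{2}e -nat_of_binX; lia.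
have qNdvd (m : nat) : (forall r, prime r -> r %| m -> exists2 x : N, x \in l & r = x) -> ~~ (q %| m).
  move=> hm; apply/negP=> qm; have [x xl E] := hm _ qp qm.
  have Eq : q = x by lia.
  by move: ql; rewrite Eq xl.
have cop (m : nat) i : ~~ (q %| m) -> coprime (q ^ i) m.
  by move=> qm; rewrite coprimeXl // prime_coprime.
move: h1 => /(_ (fun x : N => [/\ 0 < x, ell x <= k &
   forall r, prime r -> r %| x -> exists2 y : N, y \in q :: l & r = y])) h1.
have [] := h1.
- split=> // r rp /(rd r rp) [x xl ->]; exists x => //; by rewrite inE xl orbT.
- split=> //; first by rewrite (_ : nat_of_bin 1 = 1) // /ell big_nil.
  by move=> r rp; rewrite (_ : nat_of_bin 1 = 1) // dvdn1 => /eqP r1; move: rp; rewrite r1.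
- move=> i i9; rewrite -expnS => qk.
  have kk : k - q ^ i.+1 < 466 by apply: leq_ltn_trans hk; exact: leq_subr.
  have [s0 se sd _] := hrow _ kk.
  set x := nth _ _ _ in s0 se sd *.
  have -> : nat_of_bin (N.mul (N.mul q (N.pow q (N.of_nat i))) x) = q ^ i.+1 * x.
    by rewrite -powE; lia.
  have qx := qNdvd _ sd.
  have q0 : 0 < q ^ i.+1 by rewrite expn_gt0 prime_gt0.
  split; first by rewrite muln_gt0 q0.
    by rewrite ellM ?cop // ell_prime_pow //; move: se qk; move: (q ^ _) => u; clear; lia.
  move=> r rp; rewrite Euclid_dvdM // => /orP [|/(sd _ rp) [y yl ->]].
    by rewrite Euclid_dvdX // dvdn_prime2 // => /andP [/eqP -> _]; exists q; rewrite ?mem_head.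
  by exists y => //; rewrite inE yl orbT.
move=> a0 ae ad; split=> // m m0 hm me.
have [mq|mq] := boolP (q %| m); last first.
  apply: leq_trans h2; apply: rm => // r rp rm'; have [x + E] := hm _ rp rm'.
  rewrite inE => /orP [/eqP xq|xl]; last by exists x.
  by move: mq; rewrite -xq -E rm'.
have [m' cm Em] := pfactor_coprime qp m0.
have : 0 < logn q m by rewrite logn_gt0 mem_primes qp m0.
case: (logn q m) Em => // i Em _.
have m'0 : 0 < m' by move: m0; rewrite Em; case: (m').
have Ee : ell m = q ^ i.+1 + ell m'.
  by rewrite Em mulnC ellM ?coprimeXl // ?ell_prime_pow // expn_gt0 prime_gt0.
have hq : q ^ i.+1 <= k by apply: leq_trans me; rewrite Ee leq_addr.
have i9 : i < 9.
  rewrite ltnNge; apply/negP=> i9.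
  have : 2 ^ 10 <= q ^ i.+1.
    apply: (@leq_trans (2 ^ i.+1)); first by rewrite leq_exp2l.
    by rewrite leq_exp2r // prime_gt1.
  by move: hq hk; clear; move: (q ^ _) => u; rewrite (_ : 2 ^ 10 = 1024) //; lia.
have := h3 i i9; rewrite -expnS => /(_ hq); apply: leq_trans.
rewrite Em mulnC leq_mul2l; apply/orP; right.
have kk : k - q ^ i.+1 < 466 by apply: leq_ltn_trans hk; exact: leq_subr.
have [_ _ _ hmax] := hrow _ kk.
apply: hmax => //; last by rewrite leq_subRL // -Ee.
move=> r rp rm'; have [|x + E] := hm r rp; first by rewrite Em dvdn_mulr.
rewrite inE => /orP [/eqP xq|xl]; last by exists x.
exfalso; move: cm; rewrite prime_coprime // -xq -E rm'; by [].
Qed.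

Lemma row_spec_landau_rows (l : seq N) : uniq l -> {in l, forall q : N, prime q} ->
  row_spec l (landau_rows l).
Proof.
elim: l => [|q l IH] /=; first by move=> _ _; exact: row_spec_nil.
case/andP=> ql ul hl; apply: row_spec_cons => //; first by apply: hl; exact: mem_head.
by apply: IH => // x xl; apply: hl; rewrite inE xl orbT.
Qed.

Lemma prime_divisor_le_ell g q : 0 < g -> prime q -> q %| g -> q <= ell g.
Proof.
move=> g0 qp qg; have := @sum_prime_divisors_le_ell g [:: q] g0.
by rewrite big_seq1; apply=> // x; rewrite inE => /eqP ->.
Qed.

Lemma row_spec_primes_below :
  row_spec (primes_below 466) (landau_rows (primes_below 466)).
Proof.
apply: row_spec_landau_rows; first exact: uniq_primes_below.
by move=> q; rewrite mem_primes_below // => /andP [].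
Qed.

(** The primes dividing [landau k] are at most [ell (landau k) <= k < 466], so the table has treated
    them all. *)
Lemma landau_rowsE k : k < 466 ->
  landau k = nth 1%num (landau_rows (primes_below 466)) k.
Proof.
move=> hk; have [_ hrow] := row_spec_primes_below.
have [s0 se sd smax] := hrow k hk.
apply/eqP; rewrite eqn_leq landau_max // andbT.
apply: smax (landau_gt0 k) _ (ell_landau k) => q qp qg.
have qk := leq_trans (prime_divisor_le_ell (landau_gt0 k) qp qg) (ell_landau k).
exists (bin_of_nat q); last by rewrite bin_of_natK.
rewrite mem_primes_below // bin_of_natK qp andbT.
by rewrite (_ : nat_of_bin 466 = 466) // (leq_ltn_trans qk).
Qed.

Definition max_divisor (m : N) (l : seq N) : N :=
  foldr (fun q acc => if N.eqb (N.modulo m q) 0 then N.max q acc else acc) 0%num l.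

Lemma max_divisor_ge (m : N) (l : seq N) (q : N) : q \in l -> q %| m -> q <= max_divisor m l.
Proof.
move=> + qm; have Eq : N.eqb (N.modulo m q) 0.
  apply/N.eqb_spec; apply/N.Lcm0.mod_divide; case/dvdnP: qm => k Ek.
  by exists (bin_of_nat k); have := bin_of_natK k; lia.
elim: l => //= r l IH; rewrite inE => /orP [/eqP <-|/IH h]; first by rewrite Eq; lia.
by case: ifP => // _; lia.
Qed.

(* [enough M P] holds at every stage, and all primes met so far are at most [P]. *)
Fixpoint check_row (k M P : N) (l row : seq N) : bool :=
  if row is m :: row' then
    if N.ltb k 5 then check_row (N.succ k) M P l row' else
    let q := max_divisor m l in
    if N.leb q P then check_row (N.succ k) M P l row'
    else if enough k q then check_row (N.succ k) k q l row' else false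
  else true.

Lemma check_rowP (R : realType) (k M P : N) l row i (q : N) : enough M P -> M <= k ->
  check_row k M P l row -> i < size row -> 5 <= k + i ->
  q \in l -> q %| nth 1%num row i -> largest_prime_bound R (k + i) q.
Proof.
move=> hM Mk + + + ql; elim: row k M P i hM Mk => //= m row IH k M P i hM Mk.
have Ek : nat_of_bin (N.succ k) = k.+1 by lia.
case: N.ltb_spec => hk5.
  case: i => [|i] h hs h5; first by exfalso; lia.
  by rewrite addnS -addSn -Ek; apply: IH h hs _ => //; lia.
case: N.leb_spec => hqP.
  case: i => [|i] h hs h5 qm.
    apply: (enoughP _ hM); first by rewrite addn0.
    by move: (max_divisor_ge ql qm) hqP; move: (max_divisor m l) => u; clear; lia.
  by move: qm; rewrite addnS -addSn -Ek; apply: IH h hs _ => //; lia.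
case: ifP => // he; case: i => [|i] h hs h5 qm.
  apply: (enoughP _ he); first by rewrite addn0.
  exact: max_divisor_ge ql qm.
by move: qm; rewrite addnS -addSn -Ek; apply: IH he _ h hs _ => //; lia.
Qed.

Lemma check_row_landau : check_row 0 0 0 (primes_below 73) (landau_rows (primes_below 466)).
Proof. by vm_cast_no_check (erefl true). Qed.

(** From [n = 466] on, the claimed bound exceeds [71], the largest prime below [73]; this fixes the
    length of the table. *)
Lemma enough_466_71 : enough 466 71.
Proof. by vm_compute. Qed.

Lemma largest_prime_bound_small (R : realType) n p : 5 <= n -> prime p ->
  p %| landau n -> p < 73 -> largest_prime_bound R n p.
Proof.
move=> n5 pp pg p73; have [hn|hn] := ltnP n 466; last first.
  have p71 : p <= nat_of_bin 71.
    have n72 : p != 72 by apply: contraL pp => /eqP ->.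
    by rewrite (_ : nat_of_bin 71 = 71) // -ltnS ltn_neqAle n72.
  by apply: enoughP enough_466_71 _ p71.
have pin : bin_of_nat p \in primes_below 73.
  by rewrite mem_primes_below // bin_of_natK pp (_ : nat_of_bin 73 = 73) // p73.
have h0 : enough 0 0 by [].
have [hs _] := row_spec_primes_below.
have hn' : n < size (landau_rows (primes_below 466)) by rewrite hs; exact: hn.
have := @check_rowP R 0 0 0 _ _ n (bin_of_nat p) h0 (leqnn 0) check_row_landau hn' n5 pin.
rewrite bin_of_natK -(landau_rowsE hn) add0n; apply; exact: pg.
Qed.

(** * Primes from 503 to 100000: gaps and checkpoints *)

Fixpoint gaps_le (g hi prev : N) (l : seq N) : bool :=
  if N.leb hi prev then true else
  if l is s :: l' then if N.leb (N.sub s prev) g then gaps_le g hi s l' else false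
  else false.

Lemma gaps_leP (g hi prev : N) (l : seq N) (x : nat) : gaps_le g hi prev l ->
  prev < x <= hi -> exists2 s : N, s \in l & x <= s < x + g.
Proof.
elim: l prev => [|s l IH] prev /=.
  by case: N.leb_spec => // h _ /andP [h1 h2]; exfalso; lia.
case: N.leb_spec => h; first by move=> _ /andP [h1 h2]; exfalso; lia.
case: N.leb_spec => // hs /IH {}IH /andP [h1 h2].
have [sx|sx] := leqP x s.
  by exists s; [exact: mem_head | lia].
have [|s' s'l hs'] := IH; first by rewrite sx.
by exists s' => //; rewrite inE s'l orbT.
Qed.

(** Stopping at the first prime above [r] can only lower the sum, and only a lower bound is
    needed. *)
Fixpoint sum_window (k r : N) (l : seq N) (acc : N) : N :=
  if l is q :: l' then
    if N.leb q r then sum_window k r l' (if N.leb k q then N.add acc q else acc) else acc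
  else acc.

Lemma sum_window_le k r l acc :
  sum_window k r l acc <= acc + \sum_(q <- l | N.leb k q && N.leb q r) (q : nat).
Proof.
elim: l acc => [|q l IH] acc /=; first by rewrite big_nil addn0.
rewrite big_cons; case: (N.leb q r); last by rewrite andbF leq_addr.
by apply: leq_trans (IH _) _; case: N.leb => //=; lia.
Qed.

(** The choice is a prime [s] in the window of length [g] from [x = r1 + r2 - p]: then
    [r1 * r2 - p * x = (p - r1) * (p - r2)] is at least [(p - r) ^ 2], which exceeds [p * (g - 1)].
    If [x < k], then [k] replaces it to keep [p < s * s], and [p * s < r1 * r2] follows from
    [2 * s < p - r <= r1] and [p < 2 * r2]. *)
Lemma exists_swap_prime (p r g k p0 p1 : nat) (Q : nat -> Prop) :
  p0 <= p <= p1 -> r < p0 -> p1 < k * k -> p0 * g < (p0 - r) * (p0 - r) + p0 ->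
  2 * (k + g) <= p0 - r ->
  (forall x, k <= x -> (x <= 2 * r - p0) || (x <= k) -> exists2 s, Q s & x <= s < x + g) ->
  forall r1 r2, r1 < r2 <= r -> p < r1 + r2 ->
  exists s, [/\ Q s, p < s * s, r1 + r2 <= p + s & p * s < r1 * r2].
Proof.
move=> /andP [p0p pp1] rp0 hk hg hkg hQ r1 r2 /andP [r12 r2r] hp.
have hlen : p * g < (p - r1) * (p - r2) + p.
  have h1 : (p - r) * (p - r) <= (p - r1) * (p - r2) by apply: leq_mul; lia.
  have h2 : p * g < (p - r) * (p - r) + p.
    (* Passing from [p0] to [p0 + d] adds [d * g] on the left and at least as much on the right,
       because [hg] forces [g <= p0 - r]. *)
    have [d Ed] : exists d, p = p0 + d by exists (p - p0); lia.
    have [e Ee] : exists e, p0 = r + e by exists (p0 - r); lia.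
    move: hg; rewrite Ed Ee; have -> : r + e + d - r = e + d by lia.
    have -> : r + e - r = e by lia.
    move: (hkg) rp0; rewrite Ee => _ _; clear; case: g => [|g]; first by nia.
    move=> h; have : (r + e) * g < e * e by nia.
    by clear; nia.
  by lia.
have [x [x0 hx h1 h2]] : exists x, [/\ k <= x, (x <= 2 * r - p0) || (x <= k),
    (r1 + r2 <= p + x) && (k <= x) & forall s, s < x + g -> p * s < r1 * r2].
  have k0 : 0 < k by case: (k) hk => //; lia.
  have [hc|hc] := leqP k (r1 + r2 - p).
    exists (r1 + r2 - p); split; [by [] | apply/orP; left; lia | lia |].
    move=> s hs; have e1 : r1 * r2 = p * (r1 + r2 - p) + (p - r1) * (p - r2).
      have [a Ea] : exists a, p = r1 + a by exists (p - r1); lia.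
      have [b Eb] : exists b, p = r2 + b by exists (p - r2); lia.
      have -> : r1 + r2 - p = r1 - b by lia.
      have -> : p - r1 = a by lia.
      have -> : p - r2 = b by lia.
      have [c Ec] : exists c, r1 = b + c by exists (r1 - b); lia.
      by rewrite Ec Eb in Ea *; have -> : r2 = c + a by [lia]; rewrite addKn; clear; nia.
    have h3 : p * s.+1 <= p * (r1 + r2 - p + g) by rewrite leq_mul2l hs orbT.
    rewrite mulnS mulnDr in h3.
    by rewrite e1; move: h3 hlen; clear; lia.
  exists k; split; [exact: leqnn | by rewrite leqnn orbT | lia |].
  move=> s hs; have : 2 * s < p - r by lia.
  have : p - r <= r1 by lia.
  have : p < 2 * r2 by lia.
  by clear; nia.
have [s Qs hs] := hQ x x0 hx; exists s; split => //.
- apply: (leq_ltn_trans pp1); apply: (leq_trans hk); apply: leq_mul; move: h1 hs; clear; lia.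
- by lia.
- by apply: h2; lia.
Qed.

(* An entry [(p0, p1, r, g, k, M)]: if a prime in [p0, p1] divides [landau n], then
   at most one prime in [k, r] does not, which forces [M <= n]. *)
Definition checkpoints : seq (N * N * N * N * N * N) := ([::
  (503, 509, 421, 14, 23, 15258); (521, 523, 433, 14, 23, 16033);
   (541, 557, 457, 14, 24, 17969); (563, 577, 467, 14, 25, 19155);
   (587, 613, 499, 14, 25, 21385); (617, 643, 523, 14, 26, 23326);
   (647, 661, 547, 14, 26, 24518); (673, 701, 577, 14, 27, 27283);
   (709, 743, 607, 14, 28, 30361); (751, 773, 631, 14, 28, 32622);
   (787, 827, 661, 18, 29, 36914); (829, 863, 709, 18, 30, 39870);
   (877, 919, 751, 18, 31, 44755); (929, 977, 797, 18, 32, 50025);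
   (983, 1039, 853, 18, 33, 56015); (1049, 1117, 911, 18, 34, 63980);
   (1123, 1201, 983, 18, 35, 73035); (1213, 1307, 1061, 20, 37, 85340);
   (1319, 1429, 1153, 20, 38, 100576); (1433, 1553, 1259, 20, 40, 117244);
   (1559, 1693, 1373, 22, 42, 137422); (1697, 1867, 1499, 22, 44, 164559);
   (1871, 2029, 1621, 34, 46, 191932); (2039, 2203, 1777, 34, 47, 223477);
   (2207, 2393, 1933, 34, 49, 260479); (2399, 2621, 2113, 34, 52, 308386);
   (2633, 2879, 2333, 34, 54, 366827); (2887, 3169, 2557, 34, 57, 438519);
   (3181, 3571, 2857, 34, 60, 547501); (3581, 4003, 3229, 34, 64, 677115);
   (4007, 4549, 3643, 34, 68, 859171); (4561, 5209, 4159, 34, 73, 1106385);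
   (5227, 5987, 4801, 34, 78, 1434740); (6007, 6917, 5557, 34, 84, 1879178);
   (6947, 8081, 6451, 34, 90, 2513933); (8087, 9439, 7561, 34, 98, 3363086);
   (9461, 11131, 8893, 34, 106, 4581076); (11149, 13187, 10513, 36, 115, 6300668);
   (13217, 15683, 12527, 36, 126, 8730290); (15727, 18803, 14983, 36, 138, 12282971);
   (18839, 22511, 17929, 44, 151, 17250259); (22531, 26903, 21433, 52, 165, 24151319);
   (26921, 32363, 25747, 52, 180, 34250632); (32369, 39043, 31081, 52, 198, 48842364);
   (39047, 47111, 37379, 72, 218, 69706201); (47119, 57073, 45289, 72, 239, 100258097);
   (57077, 69403, 55061, 72, 264, 145351452); (69427, 84737, 67189, 72, 292, 212390588);
   (84751, 103993, 82279, 72, 323, 313511036)])%num.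

(** [100480] stays below [317 * 317], the limit of the sieve, and leaves room to follow the gaps up
    to [100300], where the chain of primes takes over. *)
Definition sieved_primes : seq N := primes_below 100480.

(** Each condition is stated at the endpoint of the interval from [p0] to [p1] where it is hardest
    to satisfy. *)
Definition checkpoint_ok (l : seq N) (e : N * N * N * N * N * N) : bool :=
  let: (p0, p1, r, g, k, M) := e in
  [&& enough M p1, N.ltb r p0, N.ltb p1 (k * k),
      N.ltb (p0 * g) ((p0 - r) * (p0 - r) + p0), N.leb (2 * (k + g)) (p0 - r),
      gaps_le g (N.max (2 * r - p0) k) 0 l & N.leb (M + r) (sum_window k r l 0 + p0)]%num.

Lemma checkpoints_ok : all (checkpoint_ok sieved_primes) checkpoints.
Proof. by vm_cast_no_check (erefl true). Qed.

Lemma checkpoints_complete :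
  all (fun p => N.ltb p 503 || N.leb 100000 p ||
       has (fun e : N * N * N * N * N * N => N.leb e.1.1.1.1.1 p && N.leb p e.1.1.1.1.2) (rev
           checkpoints))
    sieved_primes.
Proof. by vm_cast_no_check (erefl true). Qed.

Lemma mem_sieved_primes (q : N) : (q \in sieved_primes) = N.ltb q 100480 && prime q.
Proof. exact: mem_primes_belowN. Qed.

Lemma uniq_sieved_primes : uniq sieved_primes.
Proof. exact: uniq_primes_below. Qed.

Lemma largest_prime_bound_checkpoint (R : realType) n p L e :
  uniq L -> {in L, forall q : N, prime q} ->
  prime p -> p %| landau n -> checkpoint_ok L e ->
  (e.1.1.1.1.1 : N) <= p <= (e.1.1.1.1.2 : N) -> largest_prime_bound R n p.
Proof.
case: e => [[[[[p0 p1] r] g] k] M] uL pL pp pg /and5P [hM /N.ltb_spec0 rp0 /N.ltb_spec0 hk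
    /N.ltb_spec0 hg].
case/and3P=> /N.leb_spec0 hkg hgap /N.leb_spec0 hsum /= hp.
have [p0p pp1] := andP hp.
apply: (enoughP _ hM _ pp1) => {hM}.
have rp : r < p by move: rp0 p0p; clear; lia.
pose l := [seq nat_of_bin q | q <- L & N.leb k q && N.leb q r].
have hl q : q \in l -> [/\ prime q, p < q * q & q <= r].
  case/mapP=> x; rewrite mem_filter => /andP [/andP [/N.leb_spec0 kx /N.leb_spec0 xr]].
  move=> /pL xp ->; split; [exact: xp | | by move: xr; clear; lia].
  apply: (leq_ltn_trans pp1); apply: (@leq_trans (k * k)).
    by move: hk; clear; lia.
  by apply: leq_mul; move: kx; clear; lia.
have ul : uniq l.
  rewrite map_inj_uniq ?filter_uniq //; move=> x y; clear; lia.
have := @sum_primes_le_landau n p pp pg r l rp ul hl.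
have {}hsum : M + r <= \sum_(q <- l) q + p0.
  rewrite /l big_map big_filter; move: (sum_window_le k r L 0) hsum.
  by move: (sum_window _ _ _ _) (\sum_(_ <- _ | _) _) => u v; clear; lia.
move=> h; suff /h : forall r1 r2, prime r1 -> prime r2 -> p < r1 * r1 -> r1 < r2 <= r ->
    ~~ (r1 %| landau n) -> ~~ (r2 %| landau n) -> False.
  by move: hsum p0p; clear; move: (\sum_(_ <- _) _) => u; lia.
apply: (nondividing_pair_absurd pp pg (ltnW rp)) => r1 r2 _ _ _ h12 h3.
apply: (@exists_swap_prime p r g k p0 p1 (fun s => prime s) hp) h12 h3.
- by move: rp0; clear; lia.
- by move: hk; clear; lia.
- by move: hg; clear; lia.
- by move: hkg; clear; lia.
move=> x x0 hx; have [|s sL hs] := gaps_leP (x := x) hgap.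
  by move: x0 hx hk pp1 p0p (prime_gt0 pp); clear; case: (k) => //; lia.
by exists s => //; exact: pL.
Qed.

Lemma largest_prime_bound_checkpoints (R : realType) n p : prime p -> p %| landau n ->
  503 <= p < nat_of_bin 100000 -> largest_prime_bound R n p.
Proof.
move=> pp pg /andP [h1 h2].
have hL q : q \in sieved_primes -> prime q by rewrite mem_sieved_primes => /andP [].
have pin : bin_of_nat p \in sieved_primes.
  rewrite mem_sieved_primes bin_of_natK pp andbT; apply/N.ltb_spec0.
  apply: (@N.lt_trans _ 100000); last by [].
  by move: h2; rewrite -{1}(bin_of_natK p); move: (100000%num) (bin_of_nat p) => c d; clear; lia.
have := allP checkpoints_complete _ pin;
    rewrite -orbA => /or3P [/N.ltb_spec0 h|/N.leb_spec0 h|/hasP [e]].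
- exfalso; move: h h1; rewrite -{2}(bin_of_natK p); move: (bin_of_nat p) => d; clear; lia.
- exfalso; move: h h2; rewrite -{2}(bin_of_natK p); move: (100000%num) (bin_of_nat p) => c d;
    clear; lia.
rewrite mem_rev => ein /andP [/N.leb_spec0 e1 /N.leb_spec0 e2].
apply: (largest_prime_bound_checkpoint R uniq_sieved_primes hL pp pg (allP checkpoints_ok _ ein)).
by move: e1 e2; rewrite -{3 4}(bin_of_natK p); move: (bin_of_nat p) => d; clear; lia.
Qed.

(** * Chebyshev estimates *)

Section Chebyshev.
Import Order.TTheory GRing.Theory Num.Theory.
Local Open Scope ring_scope.
Variable R : realType.
Implicit Types (x y k m : nat) (f g : nat -> R).

(* The sum of [Lambda(d) f(x %/ d)] over the prime powers [d = q ^ j <= x]. *)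
Definition mangoldt_sum x f : R :=
  \sum_(0 <= q < x.+1 | prime q) ln q%:R * \sum_(1 <= j < x.+1) f (x %/ q ^ j)%N.

Definition psi x : R := mangoldt_sum x (fun y => (0 < y)%:R).

Lemma ln_prime_ge0 q : 0 <= ln (q%:R : R).
Proof. by case: q => [|q]; [rewrite ln0 | apply: ln_ge0; rewrite ler1n]. Qed.

(** The additional terms have [q ^ j > x] and vanish because [f 0 = 0]. *)
Lemma mangoldt_sum_widen z x f : (x <= z)%N -> f 0%N = 0 ->
  mangoldt_sum x f =
  \sum_(0 <= q < z.+1 | prime q) ln q%:R * \sum_(1 <= j < z.+1) f (x %/ q ^ j)%N.
Proof.
move=> xz f0; rewrite /mangoldt_sum [RHS](big_cat_nat (n := x.+1)) //= ?ltnS //.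
rewrite [X in _ = _ + X]big1_seq ?addr0 => [|q]; last first.
  rewrite mem_index_iota => /andP [qp /andP [xq _]].
  rewrite big1_seq ?mulr0 // => j; rewrite mem_index_iota => /andP [_ /andP [j1 _]].
  rewrite divn_small // (leq_trans xq) // -{1}[q]expn1 leq_exp2l // prime_gt1 //.
apply: eq_bigr => q qp; congr (_ * _).
rewrite [RHS](big_cat_nat (n := x.+1)) //= ?ltnS //.
rewrite [X in _ = _ + X]big1_seq ?addr0 // => j.
rewrite mem_index_iota => /andP [_ /andP [xj _]].
by rewrite divn_small // (leq_trans xj) // ltnW // ltn_expl // prime_gt1.
Qed.

Lemma mangoldt_sum_div x k f : f 0%N = 0 ->
  mangoldt_sum (x %/ k) f = mangoldt_sum x (fun y => f (y %/ k)%N).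
Proof.
move=> f0; rewrite (mangoldt_sum_widen (leq_div x k) f0).
by apply: eq_bigr => q _; congr (_ * _); apply: eq_bigr => j _; rewrite divnAC.
Qed.

Lemma psi_div x m : (0 < m)%N -> psi (x %/ m) = mangoldt_sum x (fun y => (m <= y)%:R).
Proof.
move=> m0; rewrite /psi mangoldt_sum_div //.
by apply: eq_bigr => q _; congr (_ * _); apply: eq_bigr => j _; rewrite divn_gt0.
Qed.

(** Since the weights [Lambda(d)] are nonnegative, comparing two such sums reduces to comparing two
    functions at the positive integers. *)
Lemma mangoldt_sum_sub x f g : (forall y, (0 < y)%N -> f y <= g y) -> f 0%N = g 0%N ->
  mangoldt_sum x f <= mangoldt_sum x g.
Proof.
move=> h h0; apply: ler_sum => q qp; apply: ler_wpM2l; first exact: ln_prime_ge0.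
by apply: ler_sum => j _; case: (x %/ q ^ j)%N => [|y]; [rewrite h0 | exact: h].
Qed.

Lemma mangoldt_sumD x f g :
  mangoldt_sum x (fun y => f y + g y) = mangoldt_sum x f + mangoldt_sum x g.
Proof.
rewrite -big_split; apply: eq_bigr => q _ /=; rewrite -mulrDr; congr (_ * _).
by rewrite big_split.
Qed.

Lemma mangoldt_sumZ x c f : mangoldt_sum x (fun y => c * f y) = c * mangoldt_sum x f.
Proof.
rewrite /mangoldt_sum mulr_sumr; apply: eq_bigr => q _; rewrite mulrCA; congr (_ * _).
by rewrite mulr_sumr.
Qed.

Lemma mangoldt_sum_big x (I : Type) (s : seq I) (c : I -> R) (f : I -> nat -> R) :
  mangoldt_sum x (fun y => \sum_(i <- s) c i * f i y) = \sum_(i <- s) c i * mangoldt_sum x (f i).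
Proof.
elim: s => [|i s IH].
  rewrite big_nil /mangoldt_sum big1 // => q _; rewrite big1 ?mulr0 // => j _.
  by rewrite big_nil.
rewrite big_cons -IH -mangoldt_sumZ -mangoldt_sumD.
by apply: eq_bigr => q _; congr (_ * _); apply: eq_bigr => j _; rewrite big_cons.
Qed.

(** Legendre's formula for the exponents of the primes in [x!]. *)
Lemma fact_mangoldt x : ln (x`!%:R : R) = mangoldt_sum x (fun y => y%:R).
Proof.
have h (a : nat) : (0 < a)%N -> (forall q, prime q -> (x < q)%N -> logn q a = 0%N) ->
    a = (\prod_(0 <= q < x.+1 | prime q) q ^ logn q a)%N.
  move=> a0 ha.
  rewrite -[LHS](partnT a0) (@widen_partn (x + a)) ?leq_addl //.
  rewrite (big_cat_nat (n := x.+1)) //= ?ltnS ?leq_addr //.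
  rewrite [X in (_ * X)%N]big1_seq ?muln1 => [|q]; last first.
    rewrite mem_index_iota => /andP [_ /andP [xq _]].
    have [qp|qp] := boolP (prime q); first by rewrite ha.
    by rewrite lognE (negbTE qp).
  rewrite [RHS]big_mkcond; apply: eq_bigr => q _.
  by case: ifP => // /negbT qp; rewrite lognE (negbTE qp).
have lnprod (s : seq nat) (e : nat -> nat) :
    ln ((\prod_(q <- s | prime q) q ^ e q)%N%:R : R) = \sum_(q <- s | prime q) (e q)%:R * ln q%:R.
  elim: s => [|q s IH]; first by rewrite !big_nil ln1.
  rewrite !big_cons; case: ifP => // qp.
  rewrite natrM lnM ?posrE ?ltr0n.
  - by rewrite IH natrX lnXn ?ltr0n ?prime_gt0 // mulr_natl.
  - by rewrite expn_gt0 prime_gt0.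
  - by rewrite prodn_cond_gt0 // => r rp; rewrite expn_gt0 prime_gt0.
rewrite {1}(h x`!) ?fact_gt0 // => [|q qp xq]; last first.
  rewrite logn_fact // big1_seq // => j; rewrite mem_index_iota => /andP [_ /andP [j1 _]].
  by rewrite divn_small // (leq_trans xq) // -{1}[q]expn1 leq_exp2l // prime_gt1.
rewrite lnprod; apply: eq_bigr => q qp; rewrite mulrC; congr (_ * _).
by rewrite logn_fact // natr_sum.
Qed.

Lemma fact_div_mangoldt x k :
  ln ((x %/ k)`!%:R : R) = mangoldt_sum x (fun y => (y %/ k)%:R).
Proof. by rewrite fact_mangoldt mangoldt_sum_div. Qed.

End Chebyshev.

(** * Explicit Stirling bounds *)

Section Stirling.
Import Order.TTheory GRing.Theory Num.Theory.
Local Open Scope ring_scope.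
Variable R : realType.
Implicit Types z : R.

Lemma ln_le_subr1 z : 0 < z -> ln z <= z - 1.
Proof. by move=> z0; have := @le_ln1Dx R (z - 1); rewrite subrKC; apply; lra. Qed.

(** From [n] to [n + 1] the difference [ln n! - (n + 1 / 2) * ln n + n] decreases by
    [(n + 1 / 2) * ln ((n + 1) / n) - 1]. By the rational bounds for [ln] this lies between [0] and
    [1 / (4 * n) - 1 / (4 * (n + 1))], which telescopes. *)
Lemma ln_fact_bounds (N : nat) : (0 < N)%N ->
  (N%:R + 1 / 2) * ln N%:R - N%:R + 3 / 4 + 1 / (4 * N%:R) <= ln (N`!%:R : R)
    <= (N%:R + 1 / 2) * ln N%:R - N%:R + 1.
Proof.
case: N => // N _; elim: N => [|N IH]; first by rewrite ln1; lra.
rewrite factS natrM lnM ?posrE ?ltr0n ?fact_gt0 //.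
move: IH; move: (ln (N.+1)`!%:R) => t.
have -> : (N.+2%:R : R) = N.+1%:R + 1 by rewrite natr1.
have : 1 <= (N.+1%:R : R) by rewrite ler1n.
move: (N.+1%:R : R) => n n1 /andP [h1 h2].
have u1 : 1 <= (n + 1) / n by rewrite ler_pdivlMr; lra.
have Eln : ln ((n + 1) / n) = ln (n + 1) - ln n by rewrite ln_div ?posrE //; lra.
have g1 : 1 <= (n + 1 / 2) * (ln (n + 1) - ln n).
  have := ln_ge u1; rewrite Eln => h.
  have e : 1 <= (n + 1 / 2) * (((n + 1) / n - 1) * (5 * ((n + 1) / n) + 1) / (2 * ((n
      + 1) / n) * ((n + 1) / n + 2))).
    have -> : (n + 1 / 2) * (((n + 1) / n - 1) * (5 * ((n + 1) / n) + 1) / (2 * ((n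
        + 1) / n) * ((n + 1) / n + 2))) =
      1 + 1 / (4 * (n + 1) * (3 * n + 1)) by field; lra.
    by rewrite lerDl divr_ge0 // !mulr_ge0 //; lra.
  apply: le_trans e _; apply: ler_wpM2l => //; lra.
have g2 : (n + 1 / 2) * (ln (n + 1) - ln n) <= 1 + 1 / (4 * n) - 1 / (4 * (n + 1)).
  have := ln_le u1; rewrite Eln => h.
  have e : (n + 1 / 2) * (((n + 1) / n - 1) * ((n + 1) / n + 5) / (4 * ((n + 1) / n) + 2)) <=
      1 + 1 / (4 * n) - 1 / (4 * (n + 1)).
    have -> : (n + 1 / 2) * (((n + 1) / n - 1) * ((n + 1) / n + 5) / (4 * ((n + 1) / n) + 2)) =
      1 + 1 / (4 * n) - 1 / (4 * (n + 1)) - (2 * n + 1) / (4 * n * (n + 1) * (3 * n + 2)) by field;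
          lra.
    rewrite gerBl divr_ge0 //; first lra.
    by rewrite !mulr_ge0 //; lra.
  apply: le_trans e; apply: ler_wpM2l => //; lra.
apply/andP; split; nra.
Qed.

(** Replacing the integer part of [z] by [z] changes [z * ln z - z] by at most [ln z]; the half
    logarithm in Stirling's formula centres the resulting error. *)
Lemma ln_fact_div_bounds (x k : nat) z : (0 < k <= x)%N -> z = x%:R / k%:R ->
  `|ln ((x %/ k)`!%:R) - (z * ln z - z + 1 / 2)| <= 1 / 2 * ln z + 1 / 2.
Proof.
move=> /andP [k0 kx] Ez.
have N0 : (0 < x %/ k)%N by rewrite divn_gt0.
have k0' : 0 < (k%:R : R) by rewrite ltr0n.
have zN : (x %/ k)%:R <= z.
  by rewrite Ez ler_pdivlMr // -natrM ler_nat leq_divM.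
have zN1 : z <= (x %/ k)%:R + 1.
  by rewrite Ez ler_pdivrMr // natr1 -natrM ler_nat ltnW // ltn_ceil.
have := ln_fact_bounds N0; move: (ln _`!%:R) => t.
have : 1 <= ((x %/ k)%:R : R) by rewrite ler1n.
move: (x %/ k)%:R zN zN1 => n nz zn1 n1 /andP [h1 h2].
have n0 : 0 < n by lra.
have z0 : 0 < z by lra.
have lnz : 0 <= ln z by apply: ln_ge0; lra.
have e0 : 0 <= 1 / (4 * n) by rewrite divr_ge0 //; lra.
have lnn : ln n <= ln z by rewrite ler_ln ?posrE.
have zn : ln z - ln n <= z / n - 1.
  by rewrite -ln_div ?posrE //; apply: ln_le_subr1; rewrite divr_gt0.
have zn2 : z / n - 1 <= 1 by rewrite lerBlDr ler_pdivrMr //; lra.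
have nz2 : ln n - ln z <= n / z - 1.
  by rewrite -ln_div ?posrE //; apply: ln_le_subr1; rewrite divr_gt0.
have iz : ln z >= 1 - 1 / z.
  have := @ln_le_subr1 (1 / z) ltac:(by rewrite divr_gt0).
  by rewrite div1r lnV ?posrE //; lra.
have c1 : n * (ln z - ln n) <= z - n.
  have -> : z - n = n * (z / n - 1) by field; lra.
  by apply: ler_wpM2l => //; lra.
have c2 : n * (n / z - 1) >= n * (ln n - ln z).
  by apply: ler_wpM2l => //; lra.
have c3 : (z - n) * (ln z - 1 + n / z) >= 0.
  apply: mulr_ge0; first lra.
  have : 1 / z <= n / z by rewrite ler_pM2r ?invr_gt0.
  lra.
have c4 : n * (n / z - 1) = - (z - n) * (n / z) by field; lra.
have c5 : (z - n) * ln z <= ln z by rewrite -[leRHS]mul1r; apply: ler_wpM2r => //; lra.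
rewrite ler_norml; apply/andP; split; nra.
Qed.

End Stirling.

(** * Certificates for combinations of [ln (x / k)!] and [psi (x / m)] *)

Section LinearCombinations.
Import Order.TTheory GRing.Theory Num.Theory.
Local Open Scope ring_scope.

Section ZtoR.
Variable R : realType.

Definition zR (z : Z) : R := (int_of_Z z)%:~R.

Lemma zRD (a b : Z) : zR (Z.add a b) = zR a + zR b.
Proof. by rewrite /zR -intrD -rmorphD. Qed.

Lemma zRM (a b : Z) : zR (Z.mul a b) = zR a * zR b.
Proof. by rewrite /zR -intrM -rmorphM. Qed.

Lemma zRN (a : Z) : zR (Z.opp a) = - zR a.
Proof. by rewrite /zR -mulrNz -rmorphN. Qed.

Lemma zR_nat (n : nat) : zR (Z.of_nat n) = n%:R.
Proof.
rewrite /zR; have -> : int_of_Z (Z.of_nat n) = n :> int by lia.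
by rewrite -pmulrn.
Qed.

Lemma zR_N (n : N) : zR (Z.of_N n) = (nat_of_bin n)%:R.
Proof. by rewrite -zR_nat; congr zR; lia. Qed.

Lemma zR_ge0 (a : Z) : Z.le 0 a -> 0 <= zR a.
Proof. by move=> h; rewrite -(Z2Nat.id a h) zR_nat ler0n. Qed.

Lemma zR_le (a b : Z) : Z.le a b -> zR a <= zR b.
Proof. by move=> h; rewrite -subr_ge0 -zRN -zRD; apply: zR_ge0; lia. Qed.

Lemma zR_gt0 (a : Z) : Z.lt 0 a -> 0 < zR a.
Proof.
move=> h; apply: (@lt_le_trans _ _ 1); first exact: ltr01.
by have := @zR_le 1 a ltac:(lia).
Qed.

Lemma zR_abs (a : Z) : zR (Z.abs a) = `|zR a|.
Proof.
case: (Z.abs_spec a) => -[h ->].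
  by rewrite ger0_norm // zR_ge0.
by rewrite zRN ltr0_norm // -oppr_gt0 -zRN zR_gt0 //; lia.
Qed.

Definition cdiv (a b : Z) : Z := Z.opp (Z.div (Z.opp a) b).

Lemma cdivP (a b : Z) : Z.lt 0 b -> zR a / zR b <= zR (cdiv a b).
Proof.
move=> b0; rewrite ler_pdivrMr ?zR_gt0 // -zRM; apply: zR_le.
by rewrite /cdiv; have := Z.mul_div_le (- a) b b0; lia.
Qed.

End ZtoR.

(* [(l, w)] stands for the coefficient [w] at the integer [k] whose prime factors
   are listed in [l]; [(m, h)] stands for [h * psi (x %/ m)]. *)
Definition prod_list (l : seq N) : N := foldr N.mul 1%num l.

Section Cover.
Variables (W : seq (seq N * Z)) (H : seq (N * Z)) (D : Z) (Y : N).
Local Open Scope Z_scope.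

Definition sumZ (T : Type) (f : T -> Z) (s : seq T) : Z := foldr (fun x acc => f x + acc) 0 s.

Definition floor_part (ks : seq (Z * Z)) (y : Z) : Z :=
  sumZ (fun e : Z * Z => e.2 * (e.1 * (y / e.1))) ks.

Definition step_part (y : Z) : Z :=
  sumZ (fun e : N * Z => if Z.of_N e.1 <=? y then e.2 else 0) H.

Definition keys : seq (Z * Z) := [seq (Z.of_N (prod_list e.1), e.2) | e <- W].

(* An entry [(c, k, d)] increases the value by [d] after [c + 1] steps, and then again
   every [k + 1] steps. *)
Fixpoint tick (v : Z) (cs : seq (nat * nat * Z)) : Z * seq (nat * nat * Z) :=
  match cs with
  | [::] => (v, [::])
  | (0%N, k, d) :: cs' => let: (v', r) := tick (v + d) cs' in (v', (k, k, d) :: r)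
  | (c.+1, k, d) :: cs' => let: (v', r) := tick v cs' in (v', (c, k, d) :: r)
  end.

Fixpoint cover_walk (n : nat) (v : Z) (y : N) (cs : seq (nat * nat * Z)) (hs : seq (N * Z)) : bool :=
  if n is n'.+1 then
    let: (v1, cs') := tick v cs in
    let y' := N.succ y in
    let: (v2, hs') :=
      if hs is (m, h) :: hs1 then if N.eqb m y' then (v1 + h, hs1) else (v1, hs) else (v1, hs) in
    if D <=? v2 then cover_walk n' v2 y' cs' hs' else false
  else true.

Definition counters : seq (nat * nat * Z) :=
  [seq ((nat_of_bin (prod_list e.1)).-1, (nat_of_bin (prod_list e.1)).-1,
        e.2 * Z.of_N (prod_list e.1)) | e <- W].

(** For [y >= Y] all steps are switched on. Since the weights sum to zero, the linear parts of
    [w * (k * (y / k))] cancel, and each positive [w] loses at most [w * (k - 1)]; so one comparison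
    settles the tail, and the finitely many smaller [y] are walked through. *)
Definition covers : bool :=
  [&& cover_walk (nat_of_bin Y) 0 0 counters H && sorted N.ltb (unzip1 H),
      all (fun e : Z * Z => 0 <? e.1) keys,
      all (fun e : N * Z => N.leb e.1 Y && N.ltb 0 e.1) H,
      sumZ snd keys =? 0
    & D <=? sumZ snd H - sumZ (fun e : Z * Z => Z.max e.2 0 * (e.1 - 1)) keys].

(** The state of an entry of [counters] after [y] calls of [tick]. *)
Let counter (y : nat) (e : seq N * Z) : nat * nat * Z :=
  let k := nat_of_bin (prod_list e.1) in ((k.-1 - y %% k)%N, k.-1, e.2 * Z.of_N (prod_list e.1)).

Lemma tickE (s : seq (seq N * Z)) y v : all (fun e : seq N * Z => (0 < nat_of_bin (prod_list
    e.1))%N) s ->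
  tick v [seq counter y e | e <- s] =
  (v + sumZ (fun e => if (nat_of_bin (prod_list e.1) %| y.+1)%N then e.2 * Z.of_N (prod_list e.1)
      else 0) s,
   [seq counter y.+1 e | e <- s]).
Proof.
elim: s v => [|[l w] s IH] v /=; first by rewrite Z.add_0_r.
move=> /andP [k0 /IH {}IH]; move: k0; rewrite {1 3}/counter /=.
case: (nat_of_bin _) => // k _ /=.
have ymod : (y %% k.+1 <= k)%N by rewrite -ltnS ltn_pmod.
have Ed : (k.+1 %| y.+1)%N = ((k - y %% k.+1)%N == 0%N).
  rewrite /dvdn -addn1 -modnDml addn1; have [E|E] := eqVneq (k - y %% k.+1)%N 0%N.
    have -> : (y %% k.+1)%N = k by lia.
    by rewrite modnn.
  by rewrite modn_small //; lia.
have Em : (k - y.+1 %% k.+1)%N = if (k - y %% k.+1)%N is c.+1 then c else k.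
  rewrite -[y.+1]addn1 -modnDml addn1; case E: (k - y %% k.+1)%N => [|c].
    have -> : (y %% k.+1)%N = k by lia.
    by rewrite modnn subn0.
  by rewrite modn_small; lia.
rewrite /counter /= Ed Em; case: (k - y %% k.+1)%N => [|c] /=; rewrite IH //.
by rewrite Z.add_assoc.
Qed.

Lemma floor_partS (s : seq (seq N * Z)) (y : nat) :
  all (fun e : seq N * Z => (0 < nat_of_bin (prod_list e.1))%N) s ->
  floor_part [seq (Z.of_N (prod_list e.1), e.2) | e <- s] (Z.of_nat y.+1) =
  floor_part [seq (Z.of_N (prod_list e.1), e.2) | e <- s] (Z.of_nat y) +
  sumZ (fun e => if (nat_of_bin (prod_list e.1) %| y.+1)%N then e.2 * Z.of_N (prod_list e.1) else
      0) s.
Proof.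
have divE (q : N) (z : nat) : (0 < nat_of_bin q)%N -> Z.of_nat z / Z.of_N q = Z.of_nat (z %/
    nat_of_bin q).
  move=> q0; symmetry; apply: (Z.div_unique _ _ _ (Z.of_nat (z %% nat_of_bin q)%N)).
    by left; have := ltn_pmod z q0; move: (z %% nat_of_bin q)%N => r; clear; lia.
  have := divn_eq z (nat_of_bin q);
      move: (z %% nat_of_bin q)%N (z %/ nat_of_bin q)%N => r d -> {q0 z}.
  by rewrite Nat2Z.inj_add Nat2Z.inj_mul; lia.
have E (q : N) : (0 < nat_of_bin q)%N -> Z.of_nat y.+1 / Z.of_N q =
    Z.of_nat y / Z.of_N q + (if (nat_of_bin q %| y.+1)%N then 1 else 0).
  move=> q0; rewrite !divE // divnS //; move: (y %/ nat_of_bin q)%N => d; clear.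
  by case: (_ %| _)%N; rewrite ?add1n ?add0n; lia.
rewrite /floor_part; move: (Z.of_nat y.+1) (Z.of_nat y) E => z1 z0 E.
elim: s => [|[l w] s IH] //= /andP [k0 /IH ->]; rewrite E //.
by case: (_ %| _)%N; lia.
Qed.

Lemma step_partS (s : seq (N * Z)) (y : N) :
  sumZ (fun e : N * Z => if Z.of_N e.1 <=? Z.of_N (N.succ y) then e.2 else 0) s =
  sumZ (fun e : N * Z => if Z.of_N e.1 <=? Z.of_N y then e.2 else 0) s +
  sumZ (fun e : N * Z => if N.eqb e.1 (N.succ y) then e.2 else 0) s.
Proof.
elim: s => //= [[m h] s] ->; do ?[case: Z.leb_spec]; case: N.eqb_spec => /=; lia.
Qed.

Lemma sum_head (s : seq (N * Z)) (y : N) : all (fun e : N * Z => N.ltb y e.1) s -> sorted N.ltb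
    (unzip1 s) ->
  [/\ (if s is (m, h) :: s1 then if N.eqb m (N.succ y) then h else 0 else 0) =
      sumZ (fun e : N * Z => if N.eqb e.1 (N.succ y) then e.2 else 0) s
    & all (fun e : N * Z => N.ltb (N.succ y) e.1)
       (if s is (m, h) :: s1 then if N.eqb m (N.succ y) then s1 else s else s)].
Proof.
have z (t : seq (N * Z)) : all (fun e : N * Z => N.ltb (N.succ y) e.1) t ->
    sumZ (fun e : N * Z => if N.eqb e.1 (N.succ y) then e.2 else 0) t = 0.
  by elim: t => //= e t IH /andP [/N.ltb_spec0 h /IH ->]; case: N.eqb_spec => //; lia.
case: s => [|[m h] s] //= /andP [/N.ltb_spec0 ym _] srt.
have hs : all (fun e : N * Z => N.ltb m e.1) s.
  have tr : transitive N.ltb by move=> a b c /N.ltb_spec0 h1 /N.ltb_spec0 h2; apply/N.ltb_spec0; lia.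
  by have := order_path_min tr srt; rewrite all_map.
case: N.eqb_spec => [E|nE].
  by rewrite -E in z *; rewrite z //; split; [lia|].
have hs' : all (fun e : N * Z => N.ltb (N.succ y) e.1) s.
  by apply: sub_all hs => e /N.ltb_spec0 h1; apply/N.ltb_spec0; lia.
by rewrite z //; split=> //=; apply/andP; split=> //; apply/N.ltb_spec0; lia.
Qed.

Lemma cover_walkP n v (y : N) hs t z :
  all (fun e : seq N * Z => (0 < nat_of_bin (prod_list e.1))%N) W ->
  cover_walk n v y [seq counter (nat_of_bin y) e | e <- W] hs ->
  all (fun e : N * Z => N.ltb y e.1) hs -> sorted N.ltb (unzip1 hs) ->
  H = t ++ hs -> all (fun e : N * Z => N.leb e.1 y) t ->
  v = floor_part keys (Z.of_N y) + step_part (Z.of_N y) ->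
  Z.of_N y < z <= Z.of_N y + Z.of_nat n -> D <= floor_part keys z + step_part z.
Proof.
move=> W0; elim: n v y hs t => [|n IH] v y hs t; first by move=> _ _ _ _ _ _ h; lia.
cbn [cover_walk]; rewrite tickE //.
set dF := sumZ _ W; move=> hw hall srt EH ht Ev hz.
have [E1 E2] := sum_head hall srt.
have yS : nat_of_bin (N.succ y) = (nat_of_bin y).+1 by lia.
have EF : floor_part keys (Z.of_N (N.succ y)) = floor_part keys (Z.of_N y) + dF.
  have -> : Z.of_N (N.succ y) = Z.of_nat (nat_of_bin y).+1 by lia.
  have -> : Z.of_N y = Z.of_nat (nat_of_bin y) by lia.
  exact: floor_partS.
have ES : step_part (Z.of_N (N.succ y)) = step_part (Z.of_N y) +
    (if hs is (m, h) :: s1 then if N.eqb m (N.succ y) then h else 0 else 0).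
  rewrite E1 /step_part step_partS; congr (_ + _); rewrite EH.
  elim: t ht {EH} => //= e t IHt /andP [/N.leb_spec0 h1 /IHt ->].
  by case: N.eqb_spec => //; lia.
have W1 : Z.of_N (N.succ y) = Z.of_N y + 1 by lia.
have yy (e : N * Z) : N.leb e.1 y -> N.leb e.1 (N.succ y) by move=> /N.leb_spec0 h;
    apply/N.leb_spec0; lia.
have fin v2 hs' t' : D <= v2 -> cover_walk n v2 (N.succ y) [seq counter (nat_of_bin y).+1 e | e <-
    W] hs' ->
    v2 = floor_part keys (Z.of_N (N.succ y)) + step_part (Z.of_N (N.succ y)) ->
    all (fun e : N * Z => N.ltb (N.succ y) e.1) hs' -> sorted N.ltb (unzip1 hs') ->
    H = t' ++ hs' -> all (fun e : N * Z => N.leb e.1 (N.succ y)) t' ->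
    D <= floor_part keys z + step_part z.
  move=> hD hw2 E2' hall' srt' EH' ht'.
  have [->|hz'] := Z.eq_dec z (Z.of_N (N.succ y)); first by rewrite -E2'.
  rewrite -yS in hw2; apply: (IH v2 (N.succ y) hs' t') => //.
  by move: hz hz' W1; clear; lia.
case: hs EH hall srt hw E1 E2 ES => [|[m h] hs] EH hall srt.
  case: Z.leb_spec => // hD hw E1 E2 ES; apply: (fin _ _ t hD hw) => //; first by rewrite EF ES Ev;
      lia.
  exact: sub_all ht.
case: N.eqb_spec => Em; case: Z.leb_spec => // hD hw E1 E2 ES.
  apply: (fin _ _ (rcons t (m, h)) hD hw) => //.
  - by rewrite EF ES Ev; lia.
  - exact: path_sorted srt.
  - by rewrite cat_rcons.
  by rewrite all_rcons (sub_all yy ht) andbT /=; apply/N.leb_spec0; lia.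
apply: (fin _ _ t hD hw) => //; first by rewrite EF ES Ev; lia.
exact: sub_all ht.
Qed.

Lemma floor_part_ge ks y : all (fun e : Z * Z => 0 <? e.1) ks -> 0 <= y ->
  sumZ snd ks * y - sumZ (fun e : Z * Z => Z.max e.2 0 * (e.1 - 1)) ks <= floor_part ks y.
Proof.
move=> + y0; elim: ks => [|[k w] ks IH] /=; first by lia.
move=> /andP [/Z.ltb_spec0 k0 /IH {}IH].
have h1 := Z.div_mod y k ltac:(lia).
have h2 := Z.mod_pos_bound y k k0.
have h3 : w * y - Z.max w 0 * (k - 1) <= w * (k * (y / k)).
  have -> : k * (y / k) = y - y mod k by lia.
  have [hw|hw] := Z.le_gt_cases 0 w.
    by rewrite Z.max_l //; nia.
  by rewrite Z.max_r; nia.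
by rewrite /floor_part /= in IH *; lia.
Qed.

Lemma coversP z : covers -> 0 < z -> D <= floor_part keys z + step_part z.
Proof.
case/and5P=> /andP [hw srt] h2 h3 /Z.eqb_spec h4 /Z.leb_spec0 h5 z0.
have [hz|hz] := Z.le_gt_cases (Z.of_N Y) z; last first.
  have W0 : all (fun e : seq N * Z => (0 < nat_of_bin (prod_list e.1))%N) W.
    move: h2; rewrite all_map; apply: sub_all => e /= /Z.ltb_spec0.
    by move: (prod_list _) => q; clear; lia.
  have hc : counters = [seq counter (nat_of_bin 0) e | e <- W].
    by apply: eq_map => e; rewrite /counter mod0n subn0.
  rewrite hc in hw; apply: (cover_walkP (t := [::]) W0 hw) => //.
  - by apply: sub_all h3 => e /andP [].
  - have -> : floor_part keys (Z.of_N 0) = 0.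
      by rewrite /floor_part; elim: keys => //= e s ->; rewrite Zdiv.Zdiv_0_l !Z.mul_0_r.
    rewrite /step_part; elim: H h3 => //= e s IH /andP [/andP [_ /N.ltb_spec0 h] /IH <-].
    by case: Z.leb_spec => //; lia.
  by move: z0 hz; clear; lia.
have := floor_part_ge h2 (Z.lt_le_incl _ _ z0); rewrite h4.
have -> : step_part z = sumZ snd H.
  rewrite /step_part; elim: H h3 => //= e s IH /andP [/andP [/N.leb_spec0 e1 _] /IH ->].
  by case: Z.leb_spec => //; lia.
by lia.
Qed.

End Cover.

Lemma Zdiv_divn (y : nat) (q : N) : (0 < nat_of_bin q)%N ->
  Z.div (Z.of_nat y) (Z.of_N q) = Z.of_nat (y %/ q).
Proof.
move=> q0; symmetry; apply: (Z.div_unique _ _ _ (Z.of_nat (y %% q)%N)).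
  by left; have := ltn_pmod y q0; move: (y %% q)%N => r; clear; lia.
have := divn_eq y q; move: (y %% q)%N (y %/ q)%N => r d -> {y q0}.
by rewrite Nat2Z.inj_add Nat2Z.inj_mul; lia.
Qed.

Section Stage.
Variable R : realType.
Variables (W : seq (seq N * Z)) (H : seq (N * Z)) (D : Z) (Y : N).
(* Lower and upper bounds for [ln p], in units of [1 / S]. *)
Variables (S : Z) (lnlo lnhi : N -> Z).
(* Lower and upper bounds for [psi y / y], in units of [10 ^ -4]. *)
Variables (alo ahi : N -> Z).
Variables (X LX : Z).

(** An upper bound for [- w * ln k], so the sign of [w] decides which bound of [ln k] enters. *)
Definition ln_term (e : seq N * Z) : Z :=
  if Z.leb 0 e.2 then Z.opp (Z.mul e.2 (sumZ lnlo e.1))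
  else Z.opp (Z.mul e.2 (sumZ lnhi e.1)).

Definition psi_term (e : N * Z) : Z :=
  cdiv (Z.mul (Z.mul e.2 (if Z.leb 0 e.2 then ahi e.1 else alo e.1)) S)
    (Z.mul (Z.of_N e.1) (Z.mul 100 100)).

Definition key (e : seq N * Z) : Z := Z.of_N (prod_list e.1).

(** Twice the error: the centre [1 / 2] of each factorial bound and its radius [(1 + ln X) / 2],
    weighted by [w * k] and by its absolute value, and [|h|] for the integer part in [x / m].
    [stage_value] divides it by [2 * X], which gives the relative error at [X]. *)
Definition error_term : Z :=
  Z.add (Z.abs (sumZ (fun e => Z.mul e.2 (key e)) W))
   (Z.add (Z.mul (sumZ (fun e => Z.mul (Z.abs e.2) (key e)) W) (Z.add 1 LX))
          (Z.mul 2 (sumZ (fun e : N * Z => Z.abs e.2) H))).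

Definition stage_value : Z :=
  Z.add (sumZ ln_term W) (Z.add (sumZ psi_term H) (cdiv (Z.mul error_term S) (Z.mul 2 X))).

Lemma zR_sumZ (T : Type) (f : T -> Z) (s : seq T) :
  zR R (sumZ f s) = \sum_(e <- s) zR R (f e).
Proof. by elim: s => [|e s IH]; rewrite ?big_nil ?big_cons //= zRD IH. Qed.

Hypothesis S0 : Z.lt 0 S.
Hypothesis X0 : Z.lt 0 X.
Hypothesis hln : forall e, e \in W -> forall p, p \in e.1 ->
  zR R (lnlo p) / zR R S <= ln ((nat_of_bin p)%:R : R) <= zR R (lnhi p) / zR R S.
Hypothesis hpos : forall e, e \in W -> forall p, p \in e.1 -> (0 < nat_of_bin p)%N.
Hypothesis hcov : covers W H D Y.

Let T (x : nat) (e : seq N * Z) : R := ln ((x %/ prod_list e.1)`!%:R).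

Lemma key_gt0 e : e \in W -> (0 < nat_of_bin (prod_list e.1))%N.
Proof.
case/and5P: hcov => _ /allP h _ _ _ eW.
have /Z.ltb_spec0 := h _ (map_f (fun e => (Z.of_N (prod_list e.1), e.2)) eW).
by rewrite /=; move: (prod_list _) => q; clear; lia.
Qed.

(** All terms are Mangoldt sums, so the inequality follows pointwise from [coversP]. *)
Lemma psi_le_combination (x : nat) :
  zR R D * psi R x <= \sum_(e <- W) zR R (e.2 * key e)%R * T x e
    + \sum_(e <- H) zR R e.2 * psi R (x %/ e.1).
Proof.
have hH : all (fun e : N * Z => N.leb e.1 Y && N.ltb 0 e.1) H by case/and5P: hcov.
have -> : \sum_(e <- H) zR R e.2 * psi R (x %/ e.1) =
    \sum_(e <- H) zR R e.2 * mangoldt_sum x (fun y => (nat_of_bin e.1 <= y)%N%:R).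
  apply: eq_big_seq => e eH; rewrite psi_div //.
  by have /andP [_ /N.ltb_spec0] := allP hH e eH; lia.
have -> : \sum_(e <- W) zR R (e.2 * key e)%R * T x e =
    \sum_(e <- W) zR R (e.2 * key e)%R * mangoldt_sum x (fun y => (y %/ prod_list e.1)%N%:R).
  by apply: eq_bigr => e _; rewrite /T fact_div_mangoldt.
rewrite -!mangoldt_sum_big -mangoldt_sumD /psi -mangoldt_sumZ.
apply: mangoldt_sum_sub => [y y0|]; last first.
  rewrite ltnn mulr0 !big1_seq ?addr0 //.
    move=> [m h] /andP [_ eH]; have /andP [_ /N.ltb_spec0 /= m0] := allP hH _ eH.
    have h' : (0 < nat_of_bin m)%N by lia.
    by rewrite /= leqNgt h' mulr0.
  by move=> e _; rewrite div0n mulr0.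
rewrite y0 mulr1; have := @coversP W H D Y (Z.of_nat y) hcov ltac:(lia).
move/(zR_le R)/le_trans; apply; rewrite zRD /floor_part /step_part !zR_sumZ lerD //.
  rewrite /keys big_map; rewrite big_seq [leRHS]big_seq; apply: ler_sum => e eW /=.
  have -> : Z.mul e.2 (Z.mul (key e) (Z.div (Z.of_nat y) (key e))) =
      Z.mul (Z.mul e.2 (key e)) (Z.of_nat (y %/ prod_list e.1)).
    rewrite Zdiv_divn; last exact: key_gt0.
    by move: (key e) (Z.of_nat _) => a b; clear; lia.
  by rewrite zRM zR_nat.
apply: ler_sum => [[m h0]] _ /=; case: Z.leb_spec => h.
  have -> : (nat_of_bin m <= y)%N by lia.
  by rewrite mulr1.
have h' : (y < nat_of_bin m)%N by lia.
by rewrite leqNgt h' mulr0.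
Qed.

Hypothesis hLX : ln (zR R X) <= zR R LX.
Hypothesis LX1 : Z.le 1 LX.
Hypothesis hkeys : all (fun e => Z.leb (key e) X) W.

Lemma ln_prod_list (l : seq N) : (forall p, p \in l -> (0 < nat_of_bin p)%N) ->
  (0 < nat_of_bin (prod_list l))%N /\
  ln ((nat_of_bin (prod_list l))%:R : R) = \sum_(p <- l) ln (nat_of_bin p)%:R.
Proof.
elim: l => [|p l IH] h /=; first by rewrite big_nil ln1.
have [|h1 h2] := IH; first by move=> q ql; apply: h; rewrite inE ql orbT.
have p0 := h p (mem_head p l).
have -> : nat_of_bin (p * prod_list l) = (nat_of_bin p * nat_of_bin (prod_list l))%N by lia.
rewrite muln_gt0 p0 h1; split=> //.
by rewrite big_cons -h2 natrM lnM ?posrE ?ltr0n.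
Qed.

Lemma ln_termP e : e \in W ->
  - zR R e.2 * ln ((nat_of_bin (prod_list e.1))%:R : R) <= zR R (ln_term e) / zR R S.
Proof.
move=> eW; have [_ ->] := ln_prod_list (hpos eW).
have S0' : 0 < zR R S by apply: zR_gt0.
have hlo : zR R (sumZ lnlo e.1) / zR R S <= \sum_(p <- e.1) ln (nat_of_bin p)%:R.
  rewrite zR_sumZ mulr_suml big_seq [leRHS]big_seq; apply: ler_sum => p pe.
  by have /andP [] := hln eW pe.
have hhi : \sum_(p <- e.1) ln (nat_of_bin p)%:R <= zR R (sumZ lnhi e.1) / zR R S.
  rewrite zR_sumZ mulr_suml big_seq [leRHS]big_seq; apply: ler_sum => p pe.
  by have /andP [] := hln eW pe.
rewrite /ln_term; case: Z.leb_spec => h; rewrite zRN zRM !mulNr lerN2 -mulrA.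
  by apply: ler_wpM2l => //; exact: zR_ge0.
rewrite -lerN2 -!mulNr; apply: ler_wpM2l => //.
by rewrite -zRN; apply: zR_ge0; move: h; move: (e.2) => w; clear; lia.
Qed.

Variable x : nat.
Hypothesis Xx : Z.le X (Z.of_nat x).
Let r : R := x%:R.

Let r0 : 0 < r. Proof. by rewrite ltr0n; lia. Qed.
Let Xr : zR R X <= r. Proof. by rewrite /r -zR_nat; exact: zR_le. Qed.
Let X0' : 0 < zR R X. Proof. exact: zR_gt0. Qed.

Lemma ln_termT e : e \in W ->
  zR R (e.2 * key e)%R * T x e <= zR R e.2 * (r * (ln r - 1)) + r * (zR R (ln_term e) / zR R S)
   + zR R (e.2 * key e)%R / 2 + zR R (Z.mul (Z.abs e.2) (key e)) * (1 / 2 * ln r + 1 / 2).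
Proof.
move=> eW; have k0 := key_gt0 eW; have hl := ln_termP eW.
have kX : (nat_of_bin (prod_list e.1) <= x)%N.
  by have /Z.leb_spec0 := allP hkeys e eW; rewrite /key; move: Xx (prod_list _); clear; lia.
have Ek : zR R (key e) = (nat_of_bin (prod_list e.1))%:R by rewrite zR_N.
have := @ln_fact_div_bounds R x (prod_list e.1) _ _ erefl; rewrite k0 kX => /(_ isT).
rewrite -/r !zRM zR_abs Ek /T; move: (ln _`!%:R) => t.
have k1 : 1 <= (nat_of_bin (prod_list e.1))%:R :> R by rewrite ler1n.
move: hl; move: (nat_of_bin _)%:R k1 => k k1 hl.
have k00 : 0 < k by lra.
have -> : ln (r / k) = ln r - ln k by rewrite ln_div ?posrE.
have lnk : 0 <= ln k by apply: ln_ge0.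
set w := zR R e.2 in hl *; move=> h.
have Ez : w * k * t = w * (r * (ln r - 1)) + r * (- w * ln k) + w * k / 2
    + w * k * (t - (r / k * (ln r - ln k) - r / k + 1 / 2)) by field; lra.
rewrite Ez.
have h1 : r * (- w * ln k) <= r * (zR R (ln_term e) / zR R S) by rewrite ler_pM2l.
have h2 : w * k * (t - (r / k * (ln r - ln k) - r / k + 1 / 2)) <= `|w| * k * (1 / 2 * ln r + 1 / 2).
  apply: le_trans (ler_norm _) _; rewrite !normrM (ger0_norm (ltW k00)).
  apply: ler_wpM2l; first by rewrite mulr_ge0 // ltW.
  by apply: le_trans h _; lra.
lra.
Qed.

Hypothesis hpsi : forall e, e \in H ->
  zR R (alo e.1) / (100 * 100) * (x %/ e.1)%N%:R <= psi R (x %/ e.1) <=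
  zR R (ahi e.1) / (100 * 100) * (x %/ e.1)%N%:R.
Hypothesis hbounds : all (fun e : N * Z => Z.leb 0 (alo e.1) && Z.leb (alo e.1) 10000 && Z.leb 0
    (ahi e.1)) H.

Lemma psi_termP e : e \in H ->
  zR R e.2 * psi R (x %/ e.1) <= r * (zR R (psi_term e) / zR R S) + zR R (Z.abs e.2).
Proof.
move=> eH; have /andP [hlo hhi] := hpsi eH.
have /andP [/andP [/Z.leb_spec0 a0 /Z.leb_spec0 a1] /Z.leb_spec0 b0] := allP hbounds e eH.
have m0 : (0 < nat_of_bin e.1)%N.
  have : all (fun e : N * Z => N.leb e.1 Y && N.ltb 0 e.1) H by case/and5P: hcov.
  by move=> /allP /(_ e eH) /andP [_ /N.ltb_spec0]; move: (e.1) => m; clear; lia.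
have S0' : 0 < zR R S by apply: zR_gt0.
have m0' : 0 < ((nat_of_bin e.1)%:R : R) by rewrite ltr0n.
have N1 : (x %/ e.1)%N%:R <= r / (nat_of_bin e.1)%:R.
  by rewrite ler_pdivlMr // -natrM ler_nat leq_divM.
have N2 : r / (nat_of_bin e.1)%:R <= (x %/ e.1)%N%:R + 1.
  by rewrite ler_pdivrMr // natr1 -natrM ler_nat ltnW // ltn_ceil.
have c100 : zR R 100 = 100 by rewrite (zR_nat R 100).
have key (b : Z) : b = (if Z.leb 0 e.2 then ahi e.1 else alo e.1) ->
    zR R e.2 * (zR R b / (100 * 100)) * (r / (nat_of_bin e.1)%:R) <= r * (zR R (psi_term e) / zR R S).
  move=> Eb; rewrite /psi_term -Eb.
  have -> : zR R e.2 * (zR R b / (100 * 100)) * (r / (nat_of_bin e.1)%:R) =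
      r * ((zR R e.2 * zR R b * zR R S) / ((nat_of_bin e.1)%:R * (100 * 100)) / zR R S).
    move: (zR R e.2) (zR R b) (zR R S) (_%:R) r S0' m0' => h0 b1 s k r1 s0 k0.
    by field; rewrite !gt_eqF.
  rewrite ler_pM2l // ler_pM2r ?invr_gt0 //.
  have m1 : Z.lt 0 (Z.mul (Z.of_N e.1) (Z.mul 100 100)).
    by move: m0; move: (e.1) => m; clear; lia.
  have := cdivP R (Z.mul (Z.mul e.2 b) S) m1.
  by rewrite !zRM zR_N c100.
have psi0 : 0 <= (x %/ e.1)%N%:R :> R by rewrite ler0n.
have abs0 : 0 <= zR R (Z.abs e.2) by apply: zR_ge0; exact: Z.abs_nonneg.
move: key; case: Z.leb_spec => h /(_ _ erefl) key.
  have h0 := zR_ge0 R h.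
  have b0' := zR_ge0 R b0.
  have q0 : 0 <= zR R e.2 * (zR R (ahi e.1) / (100 * 100)).
    by rewrite mulr_ge0 // divr_ge0 // mulr_ge0.
  have c1 := ler_wpM2l h0 hhi.
  have c2 := ler_wpM2l q0 N1.
  rewrite mulrA in c1; lra.
have h0 : zR R e.2 <= 0.
  by rewrite -oppr_ge0 -zRN; apply: zR_ge0; move: h; move: (e.2) => w; clear; lia.
have Eabs : zR R (Z.abs e.2) = - zR R e.2.
  by rewrite -zRN; congr zR; move: h; move: (e.2) => w; clear; lia.
have a0' := zR_ge0 R a0.
(* As the lower bound for [psi y / y] is at most [1], the integer part in [x / m] costs at most
   [|h|]. *)
have a1' : zR R (alo e.1) <= 100 * 100 by have := zR_le R a1; rewrite (zRM R 100 100) c100.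
have q1 : zR R (alo e.1) / (100 * 100) <= 1 by rewrite ler_pdivrMr ?mul1r // mulr_gt0.
have q2 : 0 <= zR R (alo e.1) / (100 * 100) by rewrite divr_ge0 // mulr_ge0.
rewrite Eabs in abs0 *.
move: (zR R (alo e.1) / (100 * 100)) q1 q2 hlo key => a q1 q2 hlo key.
have c1 := ler_wnM2l h0 hlo.
have q3 : 0 <= - zR R e.2 * a by rewrite mulr_ge0.
have c2 := ler_wpM2l q3 N2.
have c3 := ler_wpM2l abs0 q1.
rewrite mulrA in c1; lra.
Qed.

(** The zero sum of the weights cancels the terms [w * x * (ln x - 1)], so only [- w * x * ln k]
    remains of the factorials. [D] may be negative; then this is a lower bound for [psi]. *)
Lemma stage_bound : zR R D * psi R x <= r * (zR R stage_value / zR R S).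
Proof.
have S0' : 0 < zR R S by apply: zR_gt0.
apply: le_trans (psi_le_combination x) _.
pose WA := \sum_(e <- W) zR R (ln_term e) / zR R S.
pose HA := \sum_(e <- H) zR R (psi_term e) / zR R S.
pose C := \sum_(e <- W) zR R (Z.mul (Z.abs e.2) (key e)).
pose B := \sum_(e <- W) zR R (e.2 * key e)%R.
pose E := \sum_(e <- H) zR R (Z.abs e.2).
have w0 : \sum_(e <- W) zR R e.2 = 0.
  have := hcov; case/and5P=> _ _ _ /Z.eqb_spec h _.
  have := congr1 (zR R) h; rewrite zR_sumZ /keys big_map => ->.
  by rewrite (zR_nat R 0).
have h1 : \sum_(e <- W) zR R (e.2 * key e)%R * T x e <=
    r * WA + B / 2 + C * (1 / 2 * ln r + 1 / 2).
  apply: (@le_trans _ _ (\sum_(e <- W) (zR R e.2 * (r * (ln r - 1)) + r * (zR R (ln_term e) / zR R S)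
     + zR R (e.2 * key e)%R / 2 + zR R (Z.mul (Z.abs e.2) (key e)) * (1 / 2 * ln r + 1 / 2)))).
    by rewrite big_seq [leRHS]big_seq; apply: ler_sum => e eW; exact: ln_termT.
  by rewrite !big_split /= -!mulr_suml -!mulr_sumr w0 mul0r add0r.
have h2 : \sum_(e <- H) zR R e.2 * psi R (x %/ e.1) <= r * HA + E.
  apply: (@le_trans _ _ (\sum_(e <- H) (r * (zR R (psi_term e) / zR R S) + zR R (Z.abs e.2)))).
    by rewrite big_seq [leRHS]big_seq; apply: ler_sum => e eH; exact: psi_termP.
  by rewrite big_split /= -mulr_sumr.
(* [ln r <= LX + (r / X - 1)], and [LX >= 1] absorbs the second term. *)
have lnr : ln r <= zR R LX * (r / zR R X).
  have rX : 1 <= r / zR R X by rewrite ler_pdivlMr // mul1r.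
  have : ln r = ln (zR R X) + ln (r / zR R X) by rewrite ln_div ?posrE // subrKC.
  have := @ln_le_subr1 R (r / zR R X) ltac:(by rewrite divr_gt0).
  have : 1 <= zR R LX by have := zR_le R LX1; rewrite (zR_nat R 1).
  move: (zR R LX) (r / zR R X) rX hLX => L t; move: (ln (zR R X)) (ln r) (ln t) => u v w; nra.
have c0 : 0 <= C by apply: sumr_ge0 => e _; rewrite zRM mulr_ge0 //; apply: zR_ge0;
    [exact: Z.abs_nonneg | rewrite /key; exact: N2Z.is_nonneg].
have e0 : 0 <= E by apply: sumr_ge0 => e _; apply: zR_ge0; exact: Z.abs_nonneg.
have Eerr : zR R error_term = `|B| + (C * (1 + zR R LX) + 2 * E).
  rewrite /error_term !zRD !zRM zRD !zR_sumZ zR_abs zR_sumZ (zR_nat R 1) (zR_nat R 2).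
  by [].
have herr : B / 2 + C * (1 / 2 * ln r + 1 / 2)
    + E <= r * (zR R (cdiv (Z.mul error_term S) (Z.mul 2 X)) / zR R S).
  have X2 : Z.lt 0 (Z.mul 2 X) by move: X0; clear; lia.
  have := cdivP R (Z.mul error_term S) X2; rewrite !zRM Eerr (zR_nat R 2) => hc.
  have {}hc : (`|B| + (C * (1 + zR R LX)
      + 2 * E)) / (2 * zR R X) <= zR R (cdiv (Z.mul error_term S) (Z.mul 2 X)) / zR R S.
    rewrite ler_pdivlMr //; apply: le_trans hc; rewrite le_eqVlt; apply/orP; left; apply/eqP.
    by field; rewrite gt_eqF.
  apply: le_trans (_ : r * ((`|B| + (C * (1 + zR R LX) + 2 * E)) / (2 * zR R X)) <= _);
      last by rewrite ler_pM2l.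
  have -> : r * ((`|B| + (C * (1 + zR R LX) + 2 * E)) / (2 * zR R X)) =
      (`|B| + (C * (1 + zR R LX) + 2 * E)) / 2 * (r / zR R X) by field; rewrite gt_eqF.
  have rX : 1 <= r / zR R X by rewrite ler_pdivlMr // mul1r.
  have := ler_norm B; have : 0 <= `|B| by [].
  move: (r / zR R X) rX lnr => t t1 lnr; move: (`|B|) => b b0 Bb.
  have k1 := ler_wpM2l c0 lnr.
  have k2 := ler_wpM2l c0 t1.
  have k3 := ler_wpM2l e0 t1.
  have k4 := ler_wpM2l b0 t1.
  rewrite !mulr1 in k2 k3 k4; nra.
have Ev : zR R stage_value / zR R S = WA + HA + zR R (cdiv (Z.mul error_term S) (Z.mul 2 X)) / zR R S.
  by rewrite /stage_value !zRD !zR_sumZ !mulrDl !mulr_suml addrA.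
rewrite Ev; lra.
Qed.

End Stage.

End LinearCombinations.

(** * Chebyshev's function below 100000 *)

Section SmallArguments.
Import Order.TTheory GRing.Theory Num.Theory.

(* The pairs [(q ^ j, q)] with [v <= q ^ j < B], for [v] a power of [q]. *)
Fixpoint powers_below (fuel : nat) (B q v : N) : seq (N * N) :=
  if fuel is f.+1 then
    if N.ltb v B then (v, q) :: powers_below f B q (N.mul v q) else [::]
  else [::].

Definition prime_powers_below (B : N) : seq (N * N) :=
  flatten [seq powers_below 17 B q q | q <- primes_below B].

Definition le_fst (e f : N * N) : bool := N.leb e.1 f.1.

Definition sorted_prime_powers (B : N) : seq (N * N) :=
  sort le_fst (prime_powers_below B).

Lemma powers_below_sum fuel (B q v : N) (y : nat) : 0 < q -> y < B ->
  \sum_(e <- powers_below fuel B q v) ((e.1 : nat) <= y) =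
  \sum_(0 <= i < fuel) (v * q ^ i <= y).
Proof.
move=> q0 yB; elim: fuel v => [|f IH] v; first by rewrite big_nil big_geq.
rewrite big_nat_recl //= muln1.
case: N.ltb_spec => h.
  rewrite big_cons IH /=; congr (_ + _); apply: eq_bigr => i _.
  by rewrite expnS mulnA; congr (nat_of_bool (_ * _ <= y)); lia.
rewrite big_nil; have hv : y < v by lia.
rewrite leqNgt hv big1 // => i _; rewrite leqNgt.
by have -> : y < v * q ^ i.+1 by apply: (leq_trans hv); rewrite leq_pmulr // expn_gt0 q0.
Qed.

Lemma powers_below_base fuel (B q v : N) e : e \in powers_below fuel B q v -> e.2 = q.
Proof.
elim: fuel v => //= f IH v; case: N.ltb => //; rewrite inE => /orP [/eqP -> //|]; exact: IH.
Qed.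

Section Base.
Variable R : realType.
Variable B : N.
Hypothesis hB : N.leb 2 B && N.leb B (317 * 317).
Hypothesis hB' : N.leb 18 B && N.leb B (2 ^ 17).

Lemma mem_map_primes_below (q : nat) :
  (q \in [seq nat_of_bin u | u <- primes_below B]) = (q < B) && prime q.
Proof.
have mem := fun u => mem_primes_below u hB.
move: (primes_below B) mem => L mem; apply/mapP/idP => [[u]|h].
  by rewrite mem => h ->.
by exists (bin_of_nat q); rewrite ?mem bin_of_natK.
Qed.

Lemma psi_prime_powers y : y < B ->
  psi R y = (\sum_(e <- prime_powers_below B) ((e.1 : nat) <= y)%:R * ln (nat_of_bin e.2)%:R)%R.
Proof.
have /andP [/N.leb_spec0 B18 /N.leb_spec0 B17] := hB'.
have {}B18 : 18 <= B by lia.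
have {}B17 : B <= 2 ^ 17.
  by have e : nat_of_bin (2 ^ 17) = (2 ^ 17)%N by []; rewrite -e; move: B17;
      move: (2 ^ 17)%num => c; clear; lia.
move=> yB; rewrite /psi (@mangoldt_sum_widen R B.-1) //; last by lia.
have -> : B.-1.+1 = B by lia.
rewrite /prime_powers_below big_flatten big_map.
have -> : (\sum_(0 <= q < B | prime q) ln q%:R * \sum_(1 <= j < B) (0 < y %/ q ^ j)%:R =
  \sum_(q <- [seq nat_of_bin q | q <- primes_below B]) ln q%:R * (\sum_(1
      <= j < B) (0 < y %/ q ^ j)%:R) :> R)%R.
  rewrite -big_filter; apply: perm_big; apply: uniq_perm.
  - by rewrite filter_uniq // iota_uniq.
  - by rewrite map_inj_uniq ?uniq_primes_below //; move=> u v; clear; lia.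
  by move=> q; rewrite mem_filter mem_index_iota leq0n mem_map_primes_below andbC.
rewrite big_map; apply: eq_big_seq => q; rewrite mem_primes_below // => /andP [qB qp].
have q1 := prime_gt1 qp.
have -> : (\sum_(e <- powers_below 17 B q q) ((e.1 : nat) <= y)%:R * ln (nat_of_bin e.2)%:R =
    (\sum_(e <- powers_below 17 B q q) ((e.1 : nat) <= y))%:R * ln (nat_of_bin q)%:R :> R)%R.
  rewrite natr_sum mulr_suml; apply: eq_big_seq => e /powers_below_base ->.
  by [].
rewrite powers_below_sum ?(ltnW q1) // mulrC; congr (_ * _)%R; rewrite -natr_sum; congr (_%:R)%R.
(* As [y < B <= 2 ^ 17], exponents above [17] contribute nothing; this justifies the fuel in
   [prime_powers_below]. *)
rewrite (big_cat_nat (n := 18)) //= [X in _ + X]big1_seq ?addn0; last first.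
  move=> j; rewrite mem_index_iota => /andP [_ /andP [j18 _]].
  rewrite divn_small //; apply: (leq_trans yB); apply: (leq_trans B17).
  by apply: (@leq_trans (2 ^ j));
      [rewrite leq_exp2l // ltnW | rewrite leq_exp2r // (leq_trans _ j18)].
rewrite big_add1 /=; apply: eq_bigr => i _.
by rewrite divn_gt0 ?expn_gt0 ?(ltnW q1) // expnS.
Qed.

(* A pair [(m, e)] stands for [m * 2 ^ e]; [c] is the rounding added to the mantissa. *)
Definition scale_by (c q : N) (me : N * N) : N * N :=
  let m := N.mul me.1 q in
  if N.ltb m (2 ^ 44) then (m, me.2) else (N.add (N.shiftr m 20) c, N.add me.2 20).

(* [fa] and [fb] bound [psi] in units of [10 ^ -4]; on [prev, v), [psi] is constant. *)
Fixpoint psi_walk (fa fb : N -> N) (prev : N) (l : seq (N * N)) (lo hi : N * N) : bool :=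
  if l is (v, q) :: l' then
    if N.leb (277 * fa v) (192 * 100 * 100 * (lo.2 + N.log2 lo.1)) then
      if N.leb (314 * 100 * 100 * (hi.2 + N.succ (N.log2 hi.1))) (453 * fb prev) then
        psi_walk fa fb v l' (scale_by 0 q lo) (scale_by 1 q hi)
      else false
    else false
  else true.

Definition ln_me (me : N * N) : R := (ln (nat_of_bin me.1)%:R + (nat_of_bin me.2)%:R * ln 2)%R.

Local Open Scope ring_scope.

Lemma shiftr20 (m : N) : (2 ^ 20 * N.shiftr m 20 <= m < 2 ^ 20 * N.succ (N.shiftr m 20))%num.
Proof.
rewrite N.shiftr_div_pow2; split; first exact: N.Div0.mul_div_le.
exact: N.mul_succ_div_gt.
Qed.

Lemma ln_2e20 (k : nat) : (0 < k)%N -> ln ((nat_of_bin (2 ^ 20) * k)%:R : R) = ln k%:R + 20 * ln 2.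
Proof.
move=> k0; have key (a : nat) : ln ((2 ^ a * k)%N%:R : R) = ln k%:R + a%:R * ln 2.
  rewrite natrM natrX lnM ?posrE ?exprn_gt0 ?ltr0n //.
  by rewrite lnXn // addrC mulr_natl.
have -> : nat_of_bin (2 ^ 20) = (2 ^ (10 + 10))%N; last exact: key.
have : nat_of_bin (2 ^ 10) = (2 ^ 10)%N by [].
rewrite (N.pow_add_r 2 10 10 : (2 ^ 20 = _)%num) expnD.
by move: (2 ^ 10)%num (2 ^ 10)%N => c d; clear; lia.
Qed.

Lemma ln_nat_le (a b : nat) : (0 < a <= b)%N -> ln (a%:R : R) <= ln b%:R.
Proof.
by move=> /andP [a0 ab]; rewrite ler_ln ?posrE ?ltr0n ?ler_nat // (leq_trans a0).
Qed.

Lemma scale_by_lo (q : N) me (t : R) : (0 < nat_of_bin q)%N -> (0 < nat_of_bin me.1)%N ->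
  ln_me me <= t ->
  (0 < nat_of_bin (scale_by 0 q me).1)%N /\ ln_me (scale_by 0 q me) <= t + ln (nat_of_bin q)%:R.
Proof.
case: me => m e q0; rewrite /scale_by /ln_me.
have : (2 ^ 20 <= 2 ^ 44)%num by [].
have := shiftr20 (m * q); have := ln_2e20.
have := (fun c : N => ltac:(lia) : (0 < c)%num -> (0 < nat_of_bin c)%N) (2 ^ 20)%num erefl.
move: (N.shiftr (m * q) 20) (2 ^ 44)%num (2 ^ 20)%num => u c44 c20 c20_gt0 ln20 [s1 s2] c2044 /= m0 h.
have E : nat_of_bin (N.mul m q) = (nat_of_bin m * nat_of_bin q)%N by lia.
have L : ln (nat_of_bin (N.mul m q))%:R = ln (nat_of_bin m)%:R + ln (nat_of_bin q)%:R :> R.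
  by rewrite E natrM lnM ?posrE ?ltr0n.
have mq0 : (0 < nat_of_bin (N.mul m q))%N by rewrite E muln_gt0 m0.
case: N.ltb_spec => hc /=; first by rewrite L; split=> //; lra.
have s0 : (0 < nat_of_bin u)%N.
  rewrite lt0n; apply/negP => /eqP u0; have {}u0 : u = 0%num by move: u0; clear; lia.
  by move: s2 c2044 hc; rewrite u0 N.mul_1_r; move: (m * q)%num; clear; lia.
rewrite N.add_0_r; split=> //.
have := @ln_nat_le (nat_of_bin c20 * nat_of_bin (u)) (nat_of_bin (m * q)%num).
have -> : (nat_of_bin (e + 20)%num = nat_of_bin e + 20)%N by lia.
rewrite ln20 // L natrD => /(_ _) h2.
have {}h2 := h2 ltac:(move: s1 s0 c20_gt0; move: (m * q)%num; clear; nia).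
lra.
Qed.

Lemma scale_by_hi (q : N) me (t : R) : (0 < nat_of_bin q)%N -> (0 < nat_of_bin me.1)%N ->
  t <= ln_me me ->
  (0 < nat_of_bin (scale_by 1 q me).1)%N /\ t + ln (nat_of_bin q)%:R <= ln_me (scale_by 1 q me).
Proof.
case: me => m e q0; rewrite /scale_by /ln_me.
have : (2 ^ 20 <= 2 ^ 44)%num by [].
have := shiftr20 (m * q); have := ln_2e20.
have := (fun c : N => ltac:(lia) : (0 < c)%num -> (0 < nat_of_bin c)%N) (2 ^ 20)%num erefl.
move: (N.shiftr (m * q) 20) (2 ^ 44)%num (2 ^ 20)%num => u c44 c20 c20_gt0 ln20 [s1 s2] c2044 /= m0 h.
have E : nat_of_bin (N.mul m q) = (nat_of_bin m * nat_of_bin q)%N by lia.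
have L : ln (nat_of_bin (N.mul m q))%:R = ln (nat_of_bin m)%:R + ln (nat_of_bin q)%:R :> R.
  by rewrite E natrM lnM ?posrE ?ltr0n.
have mq0 : (0 < nat_of_bin (N.mul m q))%N by rewrite E muln_gt0 m0.
case: N.ltb_spec => hc /=; first by rewrite L; split=> //; lra.
rewrite N.add_1_r.
have s0 : (0 < nat_of_bin (N.succ (u)))%N by clear; lia.
split=> //.
have := @ln_nat_le (nat_of_bin (m * q)%num) (nat_of_bin c20 * nat_of_bin (N.succ (u))).
have -> : (nat_of_bin (e + 20)%num = nat_of_bin e + 20)%N by lia.
rewrite ln20 // L natrD => /(_ _) h2.
have {}h2 := h2 ltac:(move: s2 mq0; move: (N.succ _) (m * q)%num; clear; nia).
lra.
Qed.

Lemma ln_me_ge me : (0 < nat_of_bin me.1)%N ->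
  (nat_of_bin (me.2 + N.log2 me.1)%num)%:R * ln 2 <= ln_me me.
Proof.
case: me => m e /= m0; rewrite /ln_me /=.
have [h _] := N.log2_spec m ltac:(move: m0; clear; lia).
have -> : nat_of_bin (e + N.log2 m)%num = (nat_of_bin e + nat_of_bin (N.log2 m))%N.
  by move: (N.log2 m) => u; clear; lia.
rewrite natrD mulrDl addrC lerD2r mulr_natl -lnXn // -natrX; apply: ln_nat_le.
rewrite expn_gt0 /=; move: h; move: (N.log2 m) => u; clear; lia.
Qed.

Lemma ln_me_le me : (0 < nat_of_bin me.1)%N ->
  ln_me me <= (nat_of_bin (me.2 + N.succ (N.log2 me.1))%num)%:R * ln 2.
Proof.
case: me => m e /= m0; rewrite /ln_me /=.
have [_ h] := N.log2_spec m ltac:(move: m0; clear; lia).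
have -> : nat_of_bin (e + N.succ (N.log2 m))%num = (nat_of_bin e + nat_of_bin (N.succ (N.log2 m)))%N.
  by move: (N.log2 m) => u; clear; lia.
rewrite natrD mulrDl addrC lerD2l [leRHS]mulr_natl -lnXn // -natrX; apply: ln_nat_le.
rewrite m0 /=; move: h; move: (N.log2 m) => u; clear; lia.
Qed.

Lemma le_fst_trans : transitive le_fst.
Proof. by move=> f e g /N.leb_spec0 h1 /N.leb_spec0 h2; apply/N.leb_spec0; apply: N.le_trans h2. Qed.

(** [t] is the part of [psi] from the prime powers already passed. The walk checks nothing beyond
    the last prime power of the list, hence the hypothesis that one of them exceeds [y]. *)
Lemma psi_walkP (fa fb : N -> N) prev l lo hi (t : R) (y : N) :
  (forall u v, (u <= v)%num -> (fa u <= fa v)%num) ->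
  (forall u v, (u <= v)%num -> (fb u <= fb v)%num) ->
  psi_walk fa fb prev l lo hi -> sorted le_fst l -> {in l, forall e, (0 < nat_of_bin e.2)%N} ->
  (0 < nat_of_bin lo.1)%N -> (0 < nat_of_bin hi.1)%N -> ln_me lo <= t <= ln_me hi ->
  (prev <= y)%num -> (exists2 e, e \in l & (y < e.1)%num) ->
  (nat_of_bin (fa y))%:R / (100 * 100) <=
    t + \sum_(e <- l) ((nat_of_bin e.1 <= nat_of_bin y)%N)%:R * ln (nat_of_bin e.2)%:R <=
  (nat_of_bin (fb y))%:R / (100 * 100).
Proof.
move=> mfa mfb; elim: l prev lo hi t => [|[v q] l IH] prev lo hi t; first by move=> _ _ _ _ _ _ _ [].
cbn [psi_walk].
case: N.leb_spec => // hlo; case: N.leb_spec => // hhi hw hs hq lo0 hi0 /andP [tlo thi] py hy.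
have hall : all (le_fst (v, q)) l by apply: order_path_min hs; exact: le_fst_trans.
have q0 : (0 < nat_of_bin q)%N := hq _ (mem_head _ _).
rewrite big_cons /=.
have [yv|vy] := N.lt_ge_cases y v.
  have -> : (nat_of_bin v <= nat_of_bin y)%N = false by move: yv; clear; lia.
  rewrite mul0r add0r big1_seq ?addr0 => [|e /andP [_ el]]; last first.
    have -> : (nat_of_bin e.1 <= nat_of_bin y)%N = false; last by rewrite mul0r.
    by have /N.leb_spec0 := allP hall e el; rewrite /=; move: yv (e.1) => h u; move: h; clear; lia.
  apply/andP; split.
    apply: le_trans tlo; apply: le_trans (ln_me_ge lo0).
    have h2 := mfa y v (N.lt_le_incl _ _ yv).
    have h3 := @ln2_ge R.
    have : (277 * nat_of_bin (fa y) <= 192 * (100 * 100) * nat_of_bin (lo.2 + N.log2 lo.1)%num)%N.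
      move: hlo h2; move: (fa y) (fa v) (lo.2 + _)%num; clear; lia.
    rewrite -(ler_nat R) !natrM.
    have : 0 <= (nat_of_bin (lo.2 + N.log2 lo.1)%num)%:R :> R by [].
    move: ((nat_of_bin (fa y))%:R) (_%:R) => a b; nra.
  apply: le_trans thi _; apply: le_trans (ln_me_le hi0) _.
  have h2 := mfb prev y py.
  have h3 := @ln2_le R.
  have : (314 * (100 * 100) * nat_of_bin (hi.2
      + N.succ (N.log2 hi.1))%num <= 453 * nat_of_bin (fb y))%N.
    by move: hhi h2; move: (fb y) (fb prev) (hi.2 + _)%num; clear; lia.
  rewrite -(ler_nat R) !natrM.
  have : 0 <= (nat_of_bin (hi.2 + N.succ (N.log2 hi.1))%num)%:R :> R by [].
  move: ((nat_of_bin (fb y))%:R) (_%:R) => a b; nra.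
have -> : (nat_of_bin v <= nat_of_bin y)%N by move: vy; clear; lia.
rewrite mul1r addrA.
have [l1 l2] := scale_by_lo q0 lo0 tlo.
have [u1 u2] := scale_by_hi q0 hi0 thi.
apply: (IH _ _ _ _ hw) => //.
- exact: path_sorted hs.
- by move=> e el; apply: hq; rewrite inE el orbT.
- by rewrite l2 u2.
case: hy => e; rewrite inE => /orP [/eqP -> /= h|el h]; last by exists e.
by exfalso; move: vy h; clear; lia.
Qed.

Lemma psi_walk_bounds (fa fb : N -> N) (y : nat) :
  (forall u v, (u <= v)%num -> (fa u <= fa v)%num) ->
  (forall u v, (u <= v)%num -> (fb u <= fb v)%num) ->
  psi_walk fa fb 1 (sorted_prime_powers B) (1%num, 0%num) (1%num, 0%num) ->
  (0 < y < nat_of_bin B)%N ->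
  has (fun e => N.ltb (bin_of_nat y) e.1) (sorted_prime_powers B) ->
  (nat_of_bin (fa (bin_of_nat y)))%:R / (100 * 100) <= psi R y <=
  (nat_of_bin (fb (bin_of_nat y)))%:R / (100 * 100).
Proof.
move=> mfa mfb hw /andP [y0 yB] hl.
have z1 : ln_me (1%num, 0%num) = 0 by rewrite /ln_me /= ln1 mul0r addr0.
have -> : psi R y = 0 + \sum_(e <- sorted_prime_powers B)
    ((nat_of_bin e.1 <= nat_of_bin (bin_of_nat y))%N)%:R * ln (nat_of_bin e.2)%:R.
  rewrite add0r bin_of_natK psi_prime_powers //.
  by apply: perm_big; rewrite perm_sym perm_sort.
have srt : sorted le_fst (sorted_prime_powers B).
  apply: sort_sorted => e f; rewrite /le_fst; case: N.leb_spec => //= h.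
  by apply/N.leb_spec0; exact: N.lt_le_incl.
have pos : {in sorted_prime_powers B, forall e, (0 < nat_of_bin e.2)%N}.
  move=> e; rewrite mem_sort => /flattenP [s /mapP [q]].
  by rewrite mem_primes_below // => /andP [_ /prime_gt0 q0] -> /powers_below_base ->.
apply: (psi_walkP mfa mfb hw srt pos erefl erefl).
- by rewrite z1 lexx.
- by move: y0; rewrite -{1}(bin_of_natK y); move: (bin_of_nat y); clear; lia.
by case/hasP: hl => e el /N.ltb_spec0 h; exists e.
Qed.

End Base.

Definition psi_floor (v : N) : N :=
  (if N.ltb v 120 then 0 else if N.ltb v 400 then 9450 * v else 9688 * v)%num.

(** The minimum keeps the function monotone across [400], where the slope drops; [psi_walkP] relies
    on monotonicity. *)
Definition psi_ceil (v : N) : N :=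
  (if N.ltb v 400 then N.min (10515 * v) (10308 * 400) else 10308 * v)%num.

Lemma psi_floor_mono u v : (u <= v)%num -> (psi_floor u <= psi_floor v)%num.
Proof. by rewrite /psi_floor; do !case: N.ltb_spec; lia. Qed.

Lemma psi_ceil_mono u v : (u <= v)%num -> (psi_ceil u <= psi_ceil v)%num.
Proof. by rewrite /psi_ceil; do !case: N.ltb_spec; lia. Qed.

Lemma psi_walk_ok :
  psi_walk psi_floor psi_ceil 1 (sorted_prime_powers 100480) (1%num, 0%num) (1%num, 0%num).
Proof. by vm_cast_no_check (erefl true). Qed.

Lemma sorted_prime_powers_has : has (fun e : N * N => N.leb 100000 e.1) (sorted_prime_powers 100480).
Proof. by vm_cast_no_check (erefl true). Qed.

Lemma psi_base (R : realType) (y : nat) : (0 < y)%N -> N.lt (bin_of_nat y) 100000 ->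
  ((nat_of_bin (psi_floor (bin_of_nat y)))%:R / (100 * 100) <= psi R y <=
  (nat_of_bin (psi_ceil (bin_of_nat y)))%:R / (100 * 100))%R.
Proof.
move=> y0 hy; have := sorted_prime_powers_has; have := psi_walk_ok.
have : N.lt 100000 100480 by [].
have := @psi_walk_bounds R 100480 isT isT psi_floor psi_ceil y psi_floor_mono psi_ceil_mono.
move: (100000%num) (100480%num) hy (sorted_prime_powers _) => C B hy L h CB hw hl.
apply: h hw _ _.
  by rewrite y0; move: hy CB; rewrite -{2}(bin_of_natK y); move: (bin_of_nat y); clear; lia.
case/hasP: hl => e eL /N.leb_spec0 he; apply/hasP; exists e => //.
by apply/N.ltb_spec0; apply: N.lt_le_trans he.
Qed.

End SmallArguments.

(** * The weights of the combinations *)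

Section ChebyshevWeights.
Import Order.TTheory GRing.Theory Num.Theory.

(* An entry [(p, (a, b), (c, d))] records that [2 ^ a <= p ^ b] and [p ^ d <= 2 ^ c]. *)
Definition log2_table : seq (N * (N * N) * (N * N)) := ([::
   (2, (1, 1), (1, 1)); (3, (84, 53), (317, 200)); (5, (339, 146), (476, 205));
   (7, (306, 109), (379, 135)); (11, (723, 209), (128, 37)); (13, (37, 10), (766, 207));
   (17, (748, 183), (327, 80)); (19, (497, 117), (514, 121)); (23, (864, 191), (95, 21));
   (29, (855, 176), (821, 169)); (31, (540, 109), (649, 131)); (37, (995, 191), (771, 148));
   (41, (959, 179), (884, 165)); (43, (331, 61), (1031, 190)); (47, (611, 110), (661, 119));
   (53, (842, 147), (779, 136)); (59, (100, 17), (1153, 196)); (61, (599, 101), (771, 130));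
   (67, (643, 106), (734, 121)); (71, (1150, 187), (1273, 207))])%num.

Section Weights.
Local Open Scope Z_scope.

Let on_factors (s : seq (seq Z * Z)) : seq (seq N * Z) := [seq (map Z.to_N e.1, e.2) | e <- s].
Let on_N (s : seq (Z * Z)) : seq (N * Z) := [seq (Z.to_N e.1, e.2) | e <- s].

(* Found by linear programming: they optimize the fixed points of [stage_value] subject to
   [covers], for [k <= 71], and are rounded to integers. *)
Definition upper_weights := on_factors [::
   ([:: 2], -500000); ([:: 3], -333333); ([:: 5], -200000); ([:: 2; 3], 166667);
   ([:: 7], -142857); ([:: 2; 5], 100000); ([:: 11], -90909); ([:: 13], -66133);
   ([:: 2; 7], 71429); ([:: 3; 5], 66667); ([:: 17], -34815); ([:: 19], -52632);
   ([:: 3; 7], 47619); ([:: 2; 11], 45455); ([:: 23], -34743); ([:: 2; 13], 33066);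
   ([:: 29], -21017); ([:: 2; 3; 5], -33333); ([:: 31], -19078); ([:: 3; 11], 20335);
   ([:: 2; 17], 9981); ([:: 5; 7], 24111); ([:: 2; 19], 13063); ([:: 41], -19104);
   ([:: 2; 3; 7], -23810); ([:: 43], -10092); ([:: 2; 23], 11893); ([:: 47], -5921);
   ([:: 3; 17], 4951); ([:: 53], -3791); ([:: 5; 11], 2040); ([:: 3; 19], 5311);
   ([:: 2; 29], 10509); ([:: 59], -14303); ([:: 61], -727); ([:: 2; 3; 11], -10167);
   ([:: 67], -4410); ([:: 3; 23], 5030); ([:: 2; 5; 7], -12056); ([:: 71], -4895); ([::], 999999)].

Definition upper_steps := on_N [::
   (13, -140274); (17, -408143); (23, -200907); (29, -390496); (31, -408597); (33, 328956);
   (34, 252489); (35, 156108); (37, -496382); (39, 859726); (41, -216741); (43, -566065);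
   (46, 252036); (47, -721719); (51, 339367); (55, 88692); (57, 697289); (59, -156108);
   (61, -364251); (65, 859726); (71, -652489); (73, -496382); (77, 1000000); (79, -216741);
   (86, 25791); (87, 609504); (92, 111762); (93, 591403); (94, 278281); (95, 1000000);
   (97, -671044); (101, -1000000); (103, -1000000); (105, -642985); (107, -1000000);
   (109, -1000000); (110, -112215); (117, 859726); (118, 843892); (119, 591857); (120, 1419008);
   (131, -18101); (149, -565612); (171, 243439); (183, 261540); (210, 913122); (225, -1000000);
   (240, -270137); (257, 43439); (295, 1008143); (315, -676920); (337, 114029); (361, -408597);
   (386, -18555); (413, 956108); (442, -859726); (473, 487785); (506, 146603); (542, -747511);
   (580, 157468); (621, -234388); (664, 930316); (710, -130770); (760, -59272); (814, 76920);
   (870, 70591); (931, -224430); (997, 451582); (1067, 165158); (1141, -163798); (1221, 53397);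
   (1307, -97742); (1398, 445707); (1496, -33028); (1601, 478734); (1841, -869684);
   (2117, -14926); (2435, 44346); (2800, 523080); (3220, 282363); (3703, -243439);
   (4259, 368333); (4898, -20802); (5633, -556108); (6000, 10430590)].

Definition lower_weights := on_factors [::
   ([:: 2], 500000); ([:: 3], 333333); ([:: 5], 200000); ([:: 2; 3], -166667); ([:: 7], 142857);
   ([:: 2; 5], -100000); ([:: 11], 90909); ([:: 13], 70588); ([:: 2; 7], -71429);
   ([:: 3; 5], -66667); ([:: 17], 25726); ([:: 19], 50087); ([:: 3; 7], -47619);
   ([:: 2; 11], -45455); ([:: 23], 43478); ([:: 2; 13], -35294); ([:: 29], 17266);
   ([:: 2; 3; 5], 33333); ([:: 31], 29656); ([:: 3; 11], -18496); ([:: 2; 17], -12863);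
   ([:: 5; 7], -16400); ([:: 37], 10513); ([:: 2; 19], -17714); ([:: 3; 13], -9314);
   ([:: 41], 10869); ([:: 2; 3; 7], 25231); ([:: 43], 20950); ([:: 2; 23], -4761);
   ([:: 47], 4099); ([:: 3; 17], -5332); ([:: 53], 6488); ([:: 5; 11], -2844);
   ([:: 3; 19], -4886); ([:: 2; 29], -979); ([:: 59], 9425); ([:: 61], 2357);
   ([:: 2; 31], -14828); ([:: 5; 13], -6864); ([:: 2; 3; 11], 17256); ([:: 3; 23], -3784);
   ([:: 2; 5; 7], 7774); ([::], -999999)].

Definition lower_steps := on_N [::
   (13, 82355); (17, 562660); (19, 48347); (29, 499294); (31, 80656); (33, -389616);
   (35, -426004); (37, 611006); (38, -278525); (43, 39449); (47, 26356); (53, 490733);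
   (55, -843565); (57, -673128); (61, 856205); (71, 290938); (73, 1000000); (74, -388994);
   (79, 84735); (83, 554385); (84, -59683); (85, -437340); (86, -401574); (91, -917645);
   (92, -780989); (93, -919344); (94, -144309); (101, 610384); (102, 271949); (103, 1000000);
   (105, 573996); (107, 656124); (109, 1000000); (110, 156435); (113, 611006); (115, -1000000);
   (116, -443917); (117, -554385); (118, -556083); (119, -86433); (131, 545261); (140, 29812);
   (183, -143795); (196, 1284757); (210, -1394771); (225, 248368); (240, 1000000);
   (250, -605111); (315, 1573996); (337, -1945077); (361, 357197); (413, -227908); (442, 474864);
   (506, 297455); (542, -8275); (580, -341664); (664, -190611); (710, -95054); (760, 1018989);
   (800, -850873); (870, 636740); (931, -49078); (997, -361394); (1067, 333844); (1141, -73794);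
   (1221, 128213); (1307, 812450); (1398, -685768); (1601, 192260); (1841, 1381854);
   (2117, -1218656); (2435, -27146); (2800, -388253); (3220, 1057658); (3703, -896612);
   (4259, -79670); (4898, 276432); (5633, 147497); (6000, 10769499)].

(** Both are slightly below [10 ^ 6] and [- 10 ^ 6], leaving room for the rounding of the weights;
    the negative one produces the lower bounds for [psi]. *)
Definition upper_scale : Z := 999924.
Definition lower_scale : Z := -1000077.

Definition log_scale : Z := 100000000.

Definition log2_bounds (p : N) : (N * N) * (N * N) :=
  odflt ((0, 1), (0, 1))%num (foldr (fun e o => if N.eqb e.1.1 p then Some (e.1.2,
      e.2) else o) None log2_table).

Definition lnlo (p : N) : Z :=
  let: (a, b) := (log2_bounds p).1 in
  log_scale * Z.of_N a * 192 / (Z.of_N b * 277).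

Definition lnhi (p : N) : Z :=
  let: (c, d) := (log2_bounds p).2 in
  cdiv (log_scale * Z.of_N c * 314) (Z.of_N d * 453).

Definition log2_entry_ok (e : N * (N * N) * (N * N)) : bool :=
  let: (p, (a, b), (c, d)) := e in
  [&& N.ltb 0 p, N.ltb 0 b, N.ltb 0 d, N.leb (2 ^ a) (p ^ b) & N.leb (p ^ d) (2 ^ c)].

Lemma log2_table_ok : all log2_entry_ok log2_table.
Proof. by vm_cast_no_check (erefl true). Qed.

Definition factors_in_table (W : seq (seq N * Z)) : bool :=
  all (fun e : seq N * Z => all (mem (unzip1 (unzip1 log2_table))) e.1) W.

Lemma weights_in_table : factors_in_table upper_weights && factors_in_table lower_weights.
Proof. by vm_cast_no_check (erefl true). Qed.

Lemma upper_covers : covers upper_weights upper_steps upper_scale 6000.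
Proof. by vm_cast_no_check (erefl true). Qed.

Lemma lower_covers : covers lower_weights lower_steps lower_scale 6000.
Proof. by vm_cast_no_check (erefl true). Qed.

(** The final comparison bounds [D * psi x / x] by [D * v / 10 ^ 4], so [v] is an upper or a lower
    bound according to the sign of [D]. *)
Definition stage_check (W : seq (seq N * Z)) (H : seq (N * Z)) (D : Z) (alo ahi : N -> Z) (X v : Z)
    : bool :=
  [&& 1 <? X, all (fun e => key e <=? X) W,
      all (fun e : N * Z => (0 <=? alo e.1) && (alo e.1 <=? 10000) && (0 <=? ahi e.1)) H,
      all (fun e : N * Z => N.leb 2 e.1 && N.leb e.1 6000) H &
      10000 * stage_value W H log_scale lnlo lnhi alo ahi X (Z.log2_up X * 314 / 453 + 1)
        <=? v * (log_scale * D)].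

End Weights.

End ChebyshevWeights.

(** * One step of the bootstrap *)

Section ChebyshevSteps.
Import Order.TTheory GRing.Theory Num.Theory.

Section Steps.
Variable R : realType.
Local Open Scope ring_scope.

Lemma log2_boundsP (p : N) : p \in unzip1 (unzip1 log2_table) ->
  [/\ (0 < nat_of_bin p)%N, zR R (lnlo p) / zR R log_scale <= ln (nat_of_bin p)%:R
    & ln (nat_of_bin p)%:R <= zR R (lnhi p) / zR R log_scale].
Proof.
have S0 : Z.lt 0 log_scale by [].
rewrite /lnlo /lnhi; move: log_scale S0 => S S0 hp.
have : log2_entry_ok (p, (log2_bounds p).1, (log2_bounds p).2).
  rewrite /log2_bounds; move: hp log2_table_ok; move: log2_table; elim=> //= [[[q u] v] t IH].
  rewrite inE => /orP [/eqP ->|pt] /andP [ok /IH {}IH].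
    by rewrite N.eqb_refl.
  by case: N.eqb_spec => [<- //|_]; exact: IH.
case: (log2_bounds p) => [[a b] [c d]] /= /and5P [/N.ltb_spec0 p0 /N.ltb_spec0 b0 /N.ltb_spec0 d0
    /N.leb_spec0 h1 /N.leb_spec0 h2].
have p0' : (0 < nat_of_bin p)%N by move: p0; clear; lia.
have S0' : 0 < zR R S by apply: zR_gt0.
have b0' : 0 < (nat_of_bin b)%:R :> R by rewrite ltr0n; move: b0; clear; lia.
have d0' : 0 < (nat_of_bin d)%:R :> R by rewrite ltr0n; move: d0; clear; lia.
have l2 := @ln2_ge R; have l2' := @ln2_le R.
have lnX (q : N) (k : N) : (0 < nat_of_bin q)%N -> ln (nat_of_bin (q ^ k)%num)%:R = (nat_of_bin
    k)%:R * ln (nat_of_bin q)%:R :> R.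
  move=> q0; have -> : nat_of_bin (q ^ k)%num = (nat_of_bin q ^ nat_of_bin k)%N by lia.
  by rewrite natrX lnXn ?ltr0n // mulr_natl.
have pw (q k : N) : (0 < nat_of_bin q)%N -> (0 < nat_of_bin (q ^ k)%num)%N.
  by move=> q0; have -> : nat_of_bin (q ^ k)%num = (nat_of_bin q ^ nat_of_bin k)%N by [lia];
      rewrite expn_gt0 q0.
have {}h1 : (nat_of_bin a)%:R * ln 2 <= (nat_of_bin b)%:R * ln (nat_of_bin p)%:R :> R.
  rewrite -lnX // -(lnX 2%num) //; apply: ln_nat_le; rewrite pw //=; move: h1;
      move: (2 ^ a)%num (p ^ b)%num; clear; lia.
have {}h2 : (nat_of_bin d)%:R * ln (nat_of_bin p)%:R <= (nat_of_bin c)%:R * ln 2 :> R.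
  rewrite -lnX // -(lnX 2%num) //; apply: ln_nat_le; rewrite pw //=; move: h2;
      move: (2 ^ c)%num (p ^ d)%num; clear; lia.
split=> //.
- rewrite ler_pdivrMr //; apply: le_trans (_ : zR R S * (nat_of_bin a)%:R * 192 / ((nat_of_bin
    b)%:R * 277) <= _).
    rewrite ler_pdivlMr ?mulr_gt0 //.
    have m0 : Z.lt 0 (Z.mul (Z.of_N b) 277) by move: b0; clear; lia.
    have := zR_le R (Z.mul_div_le (Z.mul (Z.mul S (Z.of_N a)) 192) _ m0).
    by rewrite !zRM !zR_N (zR_nat R 277) (zR_nat R 192) mulrC.
  rewrite ler_pdivrMr ?mulr_gt0 //.
  move: h1 l2; have : 0 <= (nat_of_bin a)%:R :> R by [].
  move: (nat_of_bin a)%:R (nat_of_bin b)%:R (ln (nat_of_bin p)%:R) (ln 2) S0' b0' => x y z w s0 y0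
      x0 h1 l2.
  have : x * 192 <= z * y * 277 by nra.
  by move: (zR R S) s0 => s s0 hh; nra.
rewrite ler_pdivlMr //; apply: le_trans (_ : zR R S * (nat_of_bin c)%:R * 314 / ((nat_of_bin d)%:R
    * 453) <= _); last first.
  have m0 : Z.lt 0 (Z.mul (Z.of_N d) 453) by move: d0; clear; lia.
  have := cdivP R (Z.mul (Z.mul S (Z.of_N c)) 314) m0.
  by rewrite !zRM !zR_N (zR_nat R 453) (zR_nat R 314).
rewrite ler_pdivlMr ?mulr_gt0 //.
move: h2 l2'; have : 0 <= (nat_of_bin c)%:R :> R by [].
move: (nat_of_bin c)%:R (nat_of_bin d)%:R (ln (nat_of_bin p)%:R) (ln 2) S0' d0' => x y z w s0 y0 x0
    h3 l3.
have : z * y * 453 <= x * 314 by nra.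
by move: (zR R S) s0 => s s0 hh; nra.
Qed.

Lemma ln_log2_up (X : Z) : Z.lt 1 X ->
  ln (zR R X) <= zR R (Z.add (Z.div (Z.mul (Z.log2_up X) 314) 453) 1).
Proof.
move=> X1; have [_ h] := Z.log2_up_spec X X1.
have k0 := Z.log2_up_nonneg X.
move: (Z.log2_up X) k0 h => k k0 h.
have E : Z.pow 2 k = Z.of_nat (2 ^ Z.to_nat k)%N by rewrite -{1}(Z2Nat.id k k0);
    move: (Z.to_nat k) => j; lia.
apply: le_trans (_ : ln ((2 ^ Z.to_nat k)%N%:R) <= _).
  rewrite -zR_nat -E ler_ln ?posrE ?zR_gt0 //; [exact: zR_le|lia|lia].
rewrite natrX lnXn // -[_ *+ Z.to_nat k]mulr_natl.
have <- : zR R k = (Z.to_nat k)%:R by rewrite -zR_nat Z2Nat.id.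
have h1 := zR_ge0 R k0; have l2 := @ln2_le R.
apply: le_trans (_ : zR R k * (314 / 453) <= _); first exact: ler_wpM2l.
rewrite mulrA ler_pdivrMr // -(zR_nat R 314) -(zR_nat R 453) -!zRM; apply: zR_le.
by have := Z.mul_succ_div_gt (Z.mul k 314) 453 erefl; move: (Z.div _ _) => d; clear; lia.
Qed.

Lemma psi_stage (W : seq (seq N * Z)) (H : seq (N * Z)) (D : Z) (alo ahi : N -> Z) (X v : Z) (x :
    nat) :
  factors_in_table W -> covers W H D 6000 -> stage_check W H D alo ahi X v ->
  Z.le X (Z.of_nat x) ->
  (forall m : N, (1 < nat_of_bin m)%N -> (m <= 6000)%num ->
    zR R (alo m) / (100 * 100) * (x %/ m)%N%:R <= psi R (x %/ m) <=
    zR R (ahi m) / (100 * 100) * (x %/ m)%N%:R) ->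
  zR R D * psi R x <= zR R D * (zR R v / (100 * 100) * x%:R).
Proof.
move=> hW hc /and5P [/Z.ltb_spec0 X1 hkeys hb hH hv] Xx hpsi.
have S0 : Z.lt 0 log_scale by [].
have X0 : Z.lt 0 X by move: X1; clear; lia.
have hl e p : e \in W -> p \in e.1 ->
    [/\ (0 < nat_of_bin p)%N, zR R (lnlo p) / zR R log_scale <= ln (nat_of_bin p)%:R
    & ln (nat_of_bin p)%:R <= zR R (lnhi p) / zR R log_scale].
  by move=> eW pe; apply: log2_boundsP; have /allP := allP hW e eW; apply.
have LX1 : Z.le 1 (Z.add (Z.div (Z.mul (Z.log2_up X) 314) 453) 1).
  have : Z.le 0 (Z.div (Z.mul (Z.log2_up X) 314) 453).
    by apply: Z.div_pos => //; have := Z.log2_up_nonneg X; clear; lia.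
  by clear; lia.
have hs := @stage_bound R W H D 6000 log_scale lnlo lnhi alo ahi X _ S0 X0 _ _ hc (ln_log2_up X1)
    LX1 hkeys x Xx _ hb.
apply: le_trans (hs _ _ _) _ => {hs}.
- by move=> e eW p pe; have [_ -> ->] := hl e p eW pe.
- by move=> e eW p pe; have [] := hl e p eW pe.
- move=> e eH; have /andP [/N.leb_spec0 m2 /N.leb_spec0 m6] := allP hH e eH.
  by apply: hpsi => //; move: m2; move: (e.1) => m; clear; lia.
have S0' : 0 < zR R log_scale by apply: zR_gt0.
move: hv; move: (stage_value _ _ _ _ _ _ _ _ _) => sv /Z.leb_spec0 /(zR_le R).
rewrite !zRM => hv.
have {}hv : 100 * 100 * zR R sv <= zR R v * (zR R log_scale * zR R D).
  by rewrite -(zR_nat R 100) -zRM.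
move: hv S0' (ler0n R x); clear; move: (zR R sv) (zR R v) (zR R D) (zR R log_scale) (x%:R : R).
move=> a b c d r hv d0 r0.
rewrite [leRHS](_ : _ = r * (b * c / (100 * 100))); last by ring.
apply: ler_wpM2l => //; rewrite ler_pdivrMr // mulrAC ler_pdivlMr ?mulr_gt0 //.
by lra.
Qed.

Definition stage_ok (alo ahi : N -> Z) (X a b : Z) : bool :=
  stage_check upper_weights upper_steps upper_scale alo ahi X b &&
  stage_check lower_weights lower_steps lower_scale alo ahi X a.

Lemma psi_stage_step (alo ahi : N -> Z) (X a b : Z) (x : nat) :
  stage_ok alo ahi X a b -> Z.le X (Z.of_nat x) ->
  (forall m : N, (1 < nat_of_bin m)%N -> (m <= 6000)%num ->
    zR R (alo m) / (100 * 100) * (x %/ m)%N%:R <= psi R (x %/ m) <=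
    zR R (ahi m) / (100 * 100) * (x %/ m)%N%:R) ->
  zR R a / (100 * 100) * x%:R <= psi R x <= zR R b / (100 * 100) * x%:R.
Proof.
have /andP [wu wl] := weights_in_table.
move=> /andP [hu hl] Xx hpsi.
have := psi_stage wu upper_covers hu Xx hpsi.
have := psi_stage wl lower_covers hl Xx hpsi.
have u0 : 0 < zR R upper_scale by apply: zR_gt0.
have l0 : zR R lower_scale < 0.
  by rewrite -oppr_gt0 -zRN; apply: zR_gt0.
by rewrite ler_nM2l // ler_pM2l // => -> ->.
Qed.

End Steps.

Section Constants.
Local Open Scope Z_scope.

(** For [x >= 100000], [m <= 250] gives [x / m >= 400] and [m <= 833] gives [x / m >= 120], where
    [psi_floor] has its jumps. *)
Definition alo1 (m : N) : Z := if N.leb m 250 then 9688 else if N.leb m 833 then 9450 else 0.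
Definition ahi1 (m : N) : Z := if N.leb m 250 then 10308 else 10515.

(** The resulting bounds are those assumed at [x / m] for [m <= 250], so they reproduce themselves
    at all larger arguments. *)
Lemma stage1_ok : stage_ok alo1 ahi1 100000 9688 10308.
Proof. by vm_cast_no_check (erefl true). Qed.

Lemma stage2_ok : stage_ok (fun=> 9688) (fun=> 10308) 10000000 9739 10267.
Proof. by vm_cast_no_check (erefl true). Qed.

Lemma stage3_ok : stage_ok (fun=> 9739) (fun=> 10267) 60010000000 9756 10249.
Proof. by vm_cast_no_check (erefl true). Qed.

End Constants.

End ChebyshevSteps.

(** * Bootstrapped bounds for [psi] *)

Section Bounds.
Import Order.TTheory GRing.Theory Num.Theory.
Variable R : realType.
Local Open Scope ring_scope.

Definition psi_within (a b y0 : Z) : Prop := forall y : nat, Z.le y0 (Z.of_nat y) ->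
  zR R a / (100 * 100) * y%:R <= psi R y <= zR R b / (100 * 100) * y%:R.

Lemma psi_within_base (a b : Z) (u v : N) (y : nat) :
  Z.le 0 a -> Z.le 0 b -> Z.le (Z.mul a (Z.of_nat y)) (Z.of_N u) ->
  Z.le (Z.of_N v) (Z.mul b (Z.of_nat y)) ->
  (nat_of_bin u)%:R / (100 * 100) <= psi R y <= (nat_of_bin v)%:R / (100 * 100) ->
  zR R a / (100 * 100) * y%:R <= psi R y <= zR R b / (100 * 100) * y%:R.
Proof.
move=> a0 b0 h1 h2 /andP [h3 h4]; apply/andP; split.
  apply: le_trans h3; rewrite mulrAC ler_pM2r ?invr_gt0 ?mulr_gt0 //.
  by rewrite -(zR_nat R y) -zR_N -zRM; apply: zR_le.
apply: le_trans h4 _; rewrite mulrAC ler_pM2r ?invr_gt0 ?mulr_gt0 //.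
by rewrite -(zR_nat R y) -zR_N -zRM; apply: zR_le.
Qed.

Lemma psi0 : psi R 0 = 0.
Proof.
rewrite /psi /mangoldt_sum big1 // => q _; rewrite big1 ?mulr0 // => j _.
by rewrite div0n.
Qed.

Lemma psi_at0 (c d : R) : c * 0%N%:R <= psi R 0 <= d * 0%N%:R.
Proof. by rewrite psi0 !mulr0 lexx. Qed.

Lemma Zdivn_ge (c : Z) (m : N) (x : nat) : (0 < nat_of_bin m)%N -> Z.le (Z.mul c (Z.of_N m))
    (Z.of_nat x) ->
  Z.le c (Z.of_nat (x %/ m)).
Proof.
move=> m0 h; rewrite -Zdiv_divn //; apply: Z.div_le_lower_bound; first by move: m0; clear; lia.
by rewrite Z.mul_comm.
Qed.

(** Strong induction: the walk gives the bounds below [100000], the first stage from there on. The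
    two weaker bounds serve the large [m], for which [y / m] may be small. *)
Lemma psi_within1_aux (y : nat) :
  [/\ Z.le 400 (Z.of_nat y) -> zR R 9688 / (100 * 100) * y%:R <= psi R y
      <= zR R 10308 / (100 * 100) * y%:R,
      Z.le 120 (Z.of_nat y) -> zR R 9450 / (100 * 100) * y%:R <= psi R y
          <= zR R 10515 / (100 * 100) * y%:R
    & zR R 0 / (100 * 100) * y%:R <= psi R y <= zR R 10515 / (100 * 100) * y%:R].
Proof.
elim/ltn_ind: y => y IH.
have wk (a b a' b' : Z) : Z.le a' a -> Z.le b b' ->
    zR R a / (100 * 100) * y%:R <= psi R y <= zR R b / (100 * 100) * y%:R ->
    zR R a' / (100 * 100) * y%:R <= psi R y <= zR R b' / (100 * 100) * y%:R.
  move=> ha hb /andP [h1 h2]; apply/andP; split.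
    by apply: le_trans h1; rewrite ler_wpM2r // ler_pM2r ?invr_gt0 ?mulr_gt0 //; exact: zR_le.
  by apply: le_trans h2 _; rewrite ler_wpM2r // ler_pM2r ?invr_gt0 ?mulr_gt0 //; exact: zR_le.
have [hy|hy] := N.lt_ge_cases (bin_of_nat y) 100000.
  have Ey : Z.of_nat y = Z.of_N (bin_of_nat y) by rewrite -{1}(bin_of_natK y);
      move: (bin_of_nat y); clear; lia.
  have [->|y0] := posnP y; first by split=> [_|_|]; exact: psi_at0.
  have := psi_base R y0 hy; move: (bin_of_nat y) Ey => v Ey hb.
  rewrite Ey; split=> [h|h|].
  - apply: (psi_within_base _ _ _ _ hb); rewrite ?Ey /psi_floor /psi_ceil; move: h;
      do ?[case: N.ltb_spec]; clear; lia.
  - apply: (psi_within_base _ _ _ _ hb); rewrite ?Ey /psi_floor /psi_ceil; move: h;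
      do ?[case: N.ltb_spec]; clear; lia.
  - apply: (psi_within_base _ _ _ _ hb); rewrite ?Ey /psi_floor /psi_ceil; do ?[case: N.ltb_spec];
      clear; lia.
have step : zR R 9688 / (100 * 100) * y%:R <= psi R y <= zR R 10308 / (100 * 100) * y%:R.
  apply: (psi_stage_step stage1_ok).
    by move: hy; rewrite -{2}(bin_of_natK y); move: (bin_of_nat y); clear; lia.
  move=> m m1 m6.
  have [i1 i2 i3] := IH (y %/ m)%N ltac:(by apply: ltn_Pdiv => //; move: hy;
      rewrite -{2}(bin_of_natK y); move: (bin_of_nat y); clear; lia).
  rewrite /alo1 /ahi1; case: N.leb_spec => h1.
    apply: i1; apply: Zdivn_ge; first by move: m1; clear; lia.
    by move: h1 hy; rewrite -{2}(bin_of_natK y); move: (bin_of_nat y); clear; lia.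
  case: N.leb_spec => h2; last exact: i3.
  apply: i2; apply: Zdivn_ge; first by move: m1; clear; lia.
  by move: h2 hy; rewrite -{2}(bin_of_natK y); move: (bin_of_nat y); clear; lia.
split=> [_|_|]; first exact: step; apply: (wk _ _ _ _ _ _ step); clear; lia.
Qed.

Lemma psi_within1 : psi_within 9688 10308 400.
Proof. by move=> y hy; have [h _ _] := psi_within1_aux y; exact: h. Qed.

Lemma psi_le_10515 (y : nat) : psi R y <= zR R 10515 / (100 * 100) * y%:R.
Proof. by have [_ _ /andP []] := psi_within1_aux y. Qed.

(** Every [x / m] with [m <= 6000] must lie in the range of the previous bounds; hence the
    thresholds [10 ^ 7 >= 400 * 6000] and [60010000000 >= 10 ^ 7 * 6000]. *)
Lemma psi_within_step (a b a' b' y0 X : Z) : stage_ok (fun=> a) (fun=> b) X a' b' ->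
  Z.le 0 y0 -> Z.le (Z.mul y0 6000) X -> psi_within a b y0 -> psi_within a' b' X.
Proof.
move=> hs y00 hX h y hy; apply: (psi_stage_step hs hy) => m m1 m6; apply: h.
have m0 : (0 < nat_of_bin m)%N by move: m1; clear; lia.
by apply: Zdivn_ge => //; move: y00 hX hy m6; clear; nia.
Qed.

Lemma psi_within2 : psi_within 9739 10267 10000000.
Proof. by apply: (psi_within_step stage2_ok _ _ psi_within1); clear; lia. Qed.

Lemma psi_within3 : psi_within 9756 10249 60010000000.
Proof. by apply: (psi_within_step stage3_ok _ _ psi_within2); clear; lia. Qed.

End Bounds.

(** * Prime gaps *)

Section Certificates.
Import GroupScope GRing.Theory.
Local Open Scope nat_scope.

(** Modulo [q], the number [a ^ h] has order exactly [2 ^ (m + 1)]: its power of exponent [2 ^ m] is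
    [-1], which differs from [1] as [q] is odd. By Euler's theorem this order divides [q - 1]. *)
Lemma two_power_dvd_pred (q a m h : nat) : prime q -> q != 2 -> q %| a ^ (h * 2 ^ m) + 1 ->
  2 ^ m.+1 %| q.-1.
Proof.
move=> qp q2 hq.
have E : ((a%:R : 'F_q) ^+ h ^+ (2 ^ m) = -1)%R.
  apply/eqP; rewrite -addr_eq0 -exprM -natrX -(natrD _ _ 1).
  by rewrite -(dvdn_pcharf (pchar_Fp qp)).
have u0 : ((a%:R : 'F_q) ^+ h != 0)%R.
  by apply/eqP => z; move: E; rewrite z expr0n expn_eq0 /= => /eqP; rewrite eq_sym oppr_eq0 oner_eq0.
have neg1 : (-1 : 'F_q)%R != 1%R.
  rewrite -subr_eq0 -opprD oppr_eq0 -(natrD _ 1 1) -(dvdn_pcharf (pchar_Fp qp)) dvdn_prime2 //.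
have uU : ((a%:R : 'F_q) ^+ h)%R \is a GRing.unit by rewrite unitfE.
pose u := FinRing.unit 'F_q uU.
have valX k : val (u ^+ k)%g = ((a%:R : 'F_q) ^+ h ^+ k)%R by rewrite FinRing.val_unitX.
have d1 : #[u]%g %| 2 ^ m.+1.
  by rewrite order_dvdn; apply/eqP/val_inj; rewrite valX expnSr exprM E sqrrN expr1n.
have /(dvdn_pfactor _ _ (isT : prime 2)) [j jm Ej] := d1.
have jE : j = m.+1.
  apply/eqP; rewrite eqn_leq jm ltnNge; apply/negP => jm'.
  have : #[u]%g %| 2 ^ m by rewrite Ej dvdn_exp2l.
  rewrite order_dvdn => /eqP /(congr1 val); rewrite valX E /= => /eqP h1.
  by rewrite h1 in neg1.
rewrite -jE -Ej order_dvdn; apply/eqP/val_inj; rewrite valX /= -exprM -natrX expnM.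
have cop : coprime (a ^ h) q.
  rewrite coprime_sym prime_coprime // (dvdn_pcharf (pchar_Fp qp)) natrX.
  exact: u0.
have := Euler_exp_totient cop; rewrite totient_prime // => E1.
by rewrite -(Fp_nat_mod qp) E1 (Fp_nat_mod qp).
Qed.

Fixpoint pow_mod (a n : N) (e : positive) : N :=
  match e with
  | xH => N.modulo a n
  | xO e' => let r := pow_mod a n e' in N.modulo (N.mul r r) n
  | xI e' => let r := pow_mod a n e' in N.modulo (N.mul (N.modulo (N.mul r r) n) a) n
  end.

Lemma pow_modE a n e : n <> 0%num -> pow_mod a n e = N.modulo (N.pow a (Npos e)) n.
Proof.
move=> n0; elim: e => [e IH|e IH|]; last by rewrite N.pow_1_r.
  have -> : Npos e~1 = (Npos e + Npos e + 1)%num by lia.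
  by rewrite !N.pow_add_r N.pow_1_r /= IH -N.Div0.mul_mod N.Div0.mul_mod_idemp_l.
have -> : Npos e~0 = (Npos e + Npos e)%num by lia.
by rewrite N.pow_add_r /= IH -N.Div0.mul_mod.
Qed.

(* [2 ^ m] divides [n - 1], so every prime factor of [n] is [1] modulo [2 ^ m]. *)
Fixpoint no_divisor (n step d : N) (fuel : nat) : bool :=
  if fuel is f.+1 then
    if N.ltb n (N.mul d d) then true
    else if N.eqb (N.modulo n d) 0 then false else no_divisor n step (N.add d step) f
  else false.

(** Started at [2] with [n - 1 = 2 * e], this is the largest power of two dividing [n - 1]. *)
Fixpoint split_two (e : positive) (two : N) : N :=
  if e is xO e' then split_two e' (N.double two) else two.

Definition certified_prime (n : N) : bool :=
  match N.div2 n with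
  | N0 => false
  | Npos e =>
    let two := split_two e 2 in
    if N.eqb n (N.succ (N.double (Npos e))) then
      if N.eqb (N.succ (pow_mod 3 n e)) n then no_divisor n two (N.succ two) 100 else false
    else false
  end.

Lemma split_twoP (e : positive) (t : nat) : exists m h, nat_of_pos e = h * 2 ^ m /\
  nat_of_bin (split_two e (bin_of_nat (2 ^ t))) = 2 ^ (t + m).
Proof.
elim: e t => [e IH|e IH|] t; try by exists 0, (nat_of_pos e~1); rewrite muln1 addn0 /= bin_of_natK.
  have [m [h [E1 E2]]] := IH t.+1; exists m.+1, h; split.
    by rewrite /= NatTrec.doubleE E1 expnS -muln2; lia.
  rewrite /= -addSnnS -E2; congr (nat_of_bin (split_two _ _)).
  by apply: (can_inj nat_of_binK); rewrite bin_of_natK expnS; have := bin_of_natK (2 ^ t); lia.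
by exists 0, 1; rewrite addn0 /= bin_of_natK.
Qed.

Lemma no_divisorP (n step d : N) fuel : no_divisor n step d fuel -> 0 < nat_of_bin d ->
  forall i, (d + i * step) ^ 2 <= n -> ~~ (d + i * step %| n).
Proof.
elim: fuel d => //= f IH d; case: N.ltb_spec => h.
  move=> _ d0 i hi; exfalso; have : nat_of_bin d * nat_of_bin d <= n.
    by apply: leq_trans hi; rewrite -mulnn; apply: leq_mul; lia.
  by lia.
case: N.eqb_spec => // hm hd d0 [|i] hi.
  rewrite addn0; apply/negP => /dvdnP [c Ec]; apply: hm.
  have -> : n = (bin_of_nat c * d)%num.
    by apply: (can_inj nat_of_binK); rewrite Ec; have := bin_of_natK c; lia.
  by apply: N.Div0.mod_mul.
have E : d + i.+1 * step = nat_of_bin (N.add d step) + i * step by lia.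
by rewrite E; apply: IH hd _ _ _; [lia | rewrite -E].
Qed.

Lemma certified_primeP (n : N) : certified_prime n -> prime n.
Proof.
rewrite /certified_prime; case: (N.div2 n) => // e.
case: N.eqb_spec => // En; case: N.eqb_spec => // Epow.
have [m [h [E1]]] := split_twoP e 1; have -> : bin_of_nat (2 ^ 1) = 2%num by [].
rewrite add1n => E2 hnd.
have n0 : n <> 0%num by rewrite En; lia.
rewrite pow_modE // in Epow.
have n1 : 1 < n by rewrite En; have := @prime_gt0; lia.
have hq q : prime q -> q %| n -> 2 ^ m.+1 %| q.-1.
  move=> qp qn; apply: (@two_power_dvd_pred q 3 m h qp).
    by apply/eqP => q2; move: qn; rewrite q2 dvdn2 En; lia.
  rewrite -E1; apply: dvdn_trans qn _; apply/dvdnP.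
  have := N.div_mod (3 ^ N.pos e) n n0.
  move: (N.modulo _ _) (N.div _ _) Epow => r c Er Ed.
  exists (nat_of_bin c + 1).
  have -> : 3 ^ nat_of_pos e = nat_of_bin (3 ^ N.pos e) by lia.
  by rewrite Ed; nia.
have [//|hp] := boolP (prime n).
have q1 := pdiv_prime n1; have qd := pdiv_dvd n.
have qq : pdiv n ^ 2 <= n.
  by rewrite leqNgt; apply/negP => /ltn_pdiv2_prime h'; rewrite h' // in hp; lia.
have /dvdnP [c Ec] := hq _ q1 qd.
have c0 : 0 < c by case: c Ec => // ; have := prime_gt1 q1; lia.
have Eq : pdiv n = nat_of_bin (N.succ (split_two e 2)) + c.-1 * nat_of_bin (split_two e 2).
  have := prime_gt1 q1.
  have -> : nat_of_bin (N.succ (split_two e 2)) = (2 ^ m.+1).+1 by rewrite -E2; lia.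
  by rewrite E2; case: c c0 Ec => // c _ /=; nia.
have := no_divisorP hnd _ _; rewrite /= => /(_ _ c.-1).
by rewrite -Eq qd; move=> /(_ ltac:(lia) qq).
Qed.

End Certificates.

(** Consecutive primes have ratio at most about [1.024]. For each, [n - 1] is divisible by so large
    a power of two that fewer than 100 trial divisors reach the square root. *)
Definition prime_chain : seq N := [::
  102593; 104849; 107273; 109841; 112361; 115001; 117617; 120401; 123209; 126041; 128993; 131969;
  135089; 138209; 141497; 144737; 148193; 151673; 155201; 158849; 162641; 166457; 170441; 174329;
  178481; 182681; 187049; 191537; 196073; 200657; 205433; 210257; 215297; 220361; 225569; 230969;
  236297; 241817; 247601; 253481; 259169; 265337; 271553; 277961; 284633; 291377; 298169; 305297;
  312617; 320081; 327737; 335417; 343433; 351497; 359897; 368513; 377297; 386297; 395537; 404969;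
  414641; 424577; 434561; 444929; 455537; 465809; 476849; 487889; 499361; 511169; 523169; 535697;
  548417; 561521; 574913; 588641; 602753; 617153; 631937; 647057; 662513; 678401; 694481; 711089;
  728129; 745601; 763457; 781601; 799553; 818561; 838193; 858161; 878609; 899681; 921233; 943073;
  965249; 987809; 1011377; 1035473; 1060097; 1085153; 1111169; 1137809; 1164689; 1192337;
  1220897; 1250177; 1280129; 1310801; 1342241; 1374257; 1407041; 1440737; 1475297; 1510337;
  1546241; 1583249; 1620977; 1659809; 1699457; 1739201; 1780577; 1823009; 1866593; 1910369;
  1956161; 2003009; 2050817; 2099393; 2149409; 2200673; 2253473; 2307233; 2362433; 2419073;
  2476673; 2535233; 2596001; 2658209; 2720897; 2786177; 2852609; 2921057; 2991041; 3062561;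
  3135809; 3210881; 3287777; 3366497; 3447233; 3529601; 3613889; 3700289; 3788321; 3878753;
  3971393; 4065953; 4163297; 4263137; 4365281; 4468577; 4575521; 4683713; 4795841; 4910177;
  5027969; 5148257; 5271521; 5397569; 5526977; 5658593; 5793761; 5932673; 6074753; 6220289;
  6369569; 6522209; 6678593; 6838529; 7001921; 7168193; 7340033; 7516097; 7696193; 7880321;
  8069057; 8261441; 8459393; 8662337; 8868737; 9081473; 9299201; 9522113; 9750017; 9982913;
  10221377; 10466177; 10717313; 10970369; 11233601; 11501249; 11775809; 12057281; 12346241;
  12641537; 12943169; 13253633; 13571009; 13895489; 14228801; 14568833; 14918273; 15275201;
  15641729; 16016321; 16400513; 16793921; 17196929; 17608769; 18030977; 18462401; 18901313;
  19354817; 19815617; 20289281; 20775809; 21274049; 21784193; 22306241; 22841537; 23387009;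
  23946113; 24520193; 25108289; 25705601; 26321153; 26952833; 27598721; 28260737; 28934273;
  29627393; 30337793; 31065857; 31808129; 32569601; 33349889; 34147457; 34964609; 35802497;
  36660737; 37538561; 38437121; 39356033; 40299521; 41265281; 42255617; 43268993; 44306177;
  45366401; 46454657; 47569409; 48709889; 49877249; 51070337; 52295297; 53550209; 54833153;
  56148737; 57493889; 58869761; 60281729; 61728257; 63208961; 64723457; 66276737; 67866881;
  69490433; 71156993; 72863873; 74611073; 76398977; 78228737; 80106113; 82024961; 83992193;
  86007041; 88071041; 90181121; 92343809; 94559873; 96826241; 99144449; 101523329; 103957121;
  106451201; 108997121; 111612929; 114290177; 117019649; 119825921; 122695169; 125637377;
  128651009; 131733761; 134894849; 138124289; 141438977; 144824321; 148299521; 151856897;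
  155496449; 159228161; 163042049; 166949633; 170954753; 175057409; 179247617; 183543809;
  187946753; 192456449; 197063681; 201789953; 206630657; 211586561; 216660737; 221860097;
  227184641; 232628993; 238209281; 243926273; 249776129; 255759617; 261897473; 268179713;
  274614017; 281202689; 287950337; 294837761; 301907201; 309152513; 316571393; 324157697;
  331936769; 339900161; 348051713; 356392961; 364940801; 373695233; 382660097; 391843073;
  401243393; 410872577; 420709889; 430804481; 441134081; 451717121; 462553601; 473648129;
  485012993; 496648193; 508550657; 520746497; 533241857; 546030593; 559129601; 572528129;
  586264577; 600329729; 614735873; 629489153; 644594177; 660047873; 675868673; 692088833;
  708691457; 725690369; 743082497; 760913921; 779172353; 797867009; 817005569; 836592641;
  856638977; 877181441; 898216961; 919771649; 941834753; 964406273; 987544577; 1011238913;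
  1035493889; 1060344833; 1085788673; 1111845377; 1138524161; 1165841921; 1193806337; 1222454273;
  1251785729; 1281812993; 1312565249; 1344065537; 1376321537; 1409351681; 1443174401; 1477806593;
  1513271297; 1549583873; 1586767361; 1624834049; 1663830017; 1703741441; 1744611329; 1786470401;
  1829324801; 1873205249; 1918154753; 1964188673; 2011303937; 2059540481; 2108953601; 2159503361;
  2211312641; 2264323073; 2318660609; 2374306817; 2431237121; 2489586689; 2549334017; 2610515969;
  2673157121; 2737312769; 2803007489; 2870228993; 2939109377; 3009633281; 3081825281; 3155731457;
  3231456257; 3308987393; 3388346369; 3469634561; 3552904193; 3638118401; 3725424641; 3814832129;
  3906343937; 4000061441; 4096055297; 4194304001; 4294955009; 4398020609; 4503562241; 4611647489;
  4722313217; 4835639297; 4951656449; 5070469121; 5192144897; 5316748289; 5444310017; 5574949889;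
  5708738561; 5845728257; 5986020353; 6129673217; 6276782081; 6427411457; 6581665793; 6739603457;
  6901319681; 7066839041; 7236352001; 7410012161; 7587844097; 7769952257; 7956422657; 8147335169;
  8342855681; 8543045633; 8748064769; 8958005249; 9172897793; 9392975873; 9618380801; 9849204737;
  10085582849; 10327490561; 10575339521; 10829111297; 11088904193; 11355006977; 11627456513;
  11906357249; 12192102401; 12484642817; 12784248833; 13091024897; 13405143041; 13726855169;
  14056222721; 14393571329; 14738944001; 15092654081; 15454799873; 15825713153; 16205486081;
  16594395137; 16992612353; 17400383489; 17817942017; 18245472257; 18683324417; 19131701249;
  19590860801; 20061024257; 20542455809; 21035468801; 21540278273; 22057203713; 22586509313;
  23128545281; 23683551233; 24251809793; 24833812481; 25429596161; 26039879681; 26664835073;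
  27304701953; 27959922689; 28630835201; 29317967873; 30021468161; 30741864449; 31479463937;
  32234831873; 33008312321; 33800507393; 34611712001; 35442368513; 36292796417; 37163671553;
  38055313409; 38968631297; 39903858689; 40861536257; 41842118657; 42846294017; 43874516993;
  44927389697; 46005563393; 47109677057; 48240271361; 49397985281; 50583408641; 51797241857;
  53040332801; 54313295873; 55616647169; 56951296001; 58318102529; 59717718017; 61150707713]%num.

(** [N.succ prev] is the smallest [x] that has to use [s], the worst case for the ratio. *)
Fixpoint ratio_le (hi prev : N) (l : seq N) : bool :=
  if N.leb hi prev then true else
  if l is s :: l' then if N.leb (1000 * s) (1024 * N.succ prev) then ratio_le hi s l' else false
  else false.

Lemma ratio_leP (hi prev : N) (l : seq N) (x : N) : ratio_le hi prev l ->
  (prev < x)%num -> (x <= hi)%num -> exists2 s, s \in l & (x <= s /\ 1000 * s <= 1024 * x)%num.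
Proof.
elim: l prev => [|s l IH] prev.
  by cbn [ratio_le]; case: N.leb_spec => // h _ h1 h2; exfalso; move: h h1 h2; clear; lia.
cbn [ratio_le]; case: N.leb_spec => h; first by move=> _ h1 h2; exfalso; move: h h1 h2; clear; lia.
case: N.leb_spec => // hs /IH {}IH h1 h2.
have [xs|sx] := N.le_gt_cases x s.
  by exists s; [exact: mem_head | split=> //; move: hs h1; clear; lia].
by have [//|s' s'l hs'] := IH sx; exists s' => //; rewrite inE s'l orbT.
Qed.

Lemma prime_chain_certified : all certified_prime prime_chain.
Proof. by vm_cast_no_check (erefl true). Qed.

Lemma prime_chain_ratio : ratio_le 61100000000 100300 prime_chain.
Proof. by vm_cast_no_check (erefl true). Qed.

Lemma sieved_primes_gap : gaps_le 100 100300 0 sieved_primes.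
Proof. by vm_cast_no_check (erefl true). Qed.

(** Up to [100300] the sieve gives gaps of at most [100], the origin of the additive term; above,
    the chain is used. *)
Lemma exists_prime_below (x : N) : (0 < x)%num -> (x <= 61100000000)%num ->
  exists s : N, [/\ prime s, (x <= s)%num & (1000 * s < 1024 * x + 1000 * 100)%num].
Proof.
move=> x0 hx; have [h|h] := N.le_gt_cases x 100300.
  have [|s sL] := gaps_leP (x := nat_of_bin x) sieved_primes_gap.
    by move: x0 h; move: (100300%num); clear; lia.
  move: sL; rewrite mem_sieved_primes => /andP [_ sp] /andP [h1 h2].
  exists s; split=> //; move: h1 h2; clear; first by lia.
  by have -> : nat_of_bin 100 = 100 by []; lia.
have [s sL [h1 h2]] := ratio_leP prime_chain_ratio h hx.
exists s; split=> //; last by move: h2; clear; lia.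
by apply: certified_primeP; have /allP := prime_chain_certified; apply.
Qed.

(** * Sums of primes *)

Section Theta.
Import Order.TTheory GRing.Theory Num.Theory.
Local Open Scope ring_scope.
Variable R : realType.
Implicit Types (x y j : nat).

Definition theta x : R := \sum_(0 <= q < x.+1 | prime q) ln q%:R.

Lemma thetaS x : theta x.+1 = theta x + (if prime x.+1 then ln x.+1%:R else 0).
Proof. by rewrite /theta big_mkcond big_nat_recr //= -big_mkcond. Qed.

Lemma theta_mono x y : (x <= y)%N -> theta x <= theta y.
Proof.
elim: y => [|y IH]; first by rewrite leqn0 => /eqP ->.
rewrite leq_eqVlt => /predU1P [-> //|]; rewrite ltnS => /IH h; apply: le_trans h _.
by rewrite thetaS lerDl; case: ifP => // _; exact: ln_prime_ge0.
Qed.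

Lemma theta_lt_prime x y : theta x < theta y -> exists2 q, prime q & (x < q <= y)%N.
Proof.
elim: y => [|y IH]; first by move=> h; have := lt_le_trans h (theta_mono (leq0n x)); rewrite ltxx.
move=> h; have [pr|npr] := boolP (prime y.+1).
  exists y.+1 => //; rewrite leqnn andbT ltnNge; apply/negP => /theta_mono h'.
  by have := lt_le_trans h h'; rewrite ltxx.
move: h; rewrite thetaS (negbTE npr) addr0 => /IH [q qp /andP [xq qy]].
by exists q; rewrite // xq (leq_trans qy).
Qed.

Lemma theta_le_psi x : theta x <= psi R x.
Proof.
rewrite /theta /psi /mangoldt_sum big_nat_cond [leRHS]big_nat_cond.
apply: ler_sum => q /andP [/andP [_ qx] qp]; rewrite ler_peMr ?ln_prime_ge0 //.
have x0 : (0 < x)%N by move: qx (prime_gt0 qp); lia.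
rewrite big_ltn // expn1 divn_gt0 ?prime_gt0 // -ltnS qx lerDl.
by apply: sumr_ge0 => j _; exact: ler0n.
Qed.

Lemma sum_even_odd (f : nat -> R) (M : nat) :
  \sum_(0 <= j < M.*2) f j = \sum_(0 <= i < M) (f i.*2 + f i.*2.+1).
Proof.
elim: M => [|M IH]; first by rewrite !big_geq.
by rewrite doubleS !big_nat_recr //= IH addrA.
Qed.

(** The exponents [2 * i] and [2 * i + 1] of a prime are paired: each contributes only if
    [q ^ i <= s], so for [i > 0] a pair costs at most two terms of [psi s]. *)
Lemma psi_le_theta x s : (0 < x)%N -> (x < s.+1 * s.+1)%N -> (s <= x)%N -> psi R x <= theta x
    + 2 * psi R s.
Proof.
move=> x0 xs sx; rewrite {2}/psi (mangoldt_sum_widen sx) //.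
rewrite /theta /psi /mangoldt_sum mulr_sumr -big_split /=.
rewrite big_nat_cond [leRHS]big_nat_cond.
apply: ler_sum => q /andP [/andP [_ qx] qp].
have q1 := prime_gt1 qp; have q0 := prime_gt0 qp.
rewrite mulrCA -{2}[ln _]mulr1 -mulrDr; apply: ler_wpM2l; first exact: ln_prime_ge0.
pose f j : R := (0 < x %/ q ^ j)%:R.
pose g j : R := (0 < s %/ q ^ j)%:R.
rewrite -!/(f _) -!/(g _).
have fg i : f i.*2 <= g i.
  rewrite /f /g ler_nat; have := divn_gt0 x (_ : 0 < q ^ i.*2)%N.
  rewrite !divn_gt0 ?expn_gt0 ?q0 // => _.
  have [h|h] := leqP (q ^ i)%N s; first exact: leq_b1.
  have : (s.+1 * s.+1 <= q ^ i.*2)%N by rewrite -addnn expnD; exact: leq_mul.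
  by move=> h2; rewrite [(_ <= x)%N]leqNgt (leq_trans xs h2).
have ff i : f i.+1 <= f i.
  rewrite /f ler_nat !divn_gt0 ?expn_gt0 ?q0 //.
  have [h|//] := leqP (q ^ i.+1)%N x.
  by rewrite (leq_trans _ h) // leq_exp2l.
have f1 : f 1%N <= 1 by rewrite /f lern1 leq_b1.
have f0 j : 0 <= f j by exact: ler0n.
apply: (@le_trans _ _ (\sum_(1 <= j < (x.+1).*2) f j)).
  rewrite [leRHS](@big_cat_nat _ _ _ x.+1) //=; last by lia.
  by rewrite lerDl; apply: sumr_ge0.
have E : \sum_(0 <= j < (x.+1).*2) f j = f 0%N + \sum_(1 <= j < (x.+1).*2) f j by rewrite big_ltn.
have := sum_even_odd f x.+1; rewrite E [in RHS]big_ltn // -[0.*2]/(0%N) -addrA => /addrI ->.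
rewrite mulr_sumr; apply: lerD => //.
rewrite big_nat_cond [leRHS]big_nat_cond; apply: ler_sum => i _.
by have h1 := fg i; have h2 := ff i.*2; lra.
Qed.

(** Abel summation: [q * ln q] counts the jump of [theta] at [q] once for each [j < q]. *)
Lemma sum_prime_ln x :
  \sum_(0 <= q < x.+1 | prime q) q%:R * ln q%:R = \sum_(0 <= j < x) (theta x - theta j) :> R.
Proof.
elim: x => [|x IH]; first by rewrite [RHS]big_geq // big_mkcond big_nat1.
rewrite big_mkcond big_nat_recr //= -big_mkcond /= IH.
rewrite [RHS]big_nat_recr //= thetaS.
have -> : \sum_(0 <= j < x) (theta x + (if prime x.+1 then ln x.+1%:R else 0) - theta j) =
    \sum_(0 <= j < x) (theta x - theta j) + x%:R * (if prime x.+1 then ln x.+1%:R else 0).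
  rewrite -[x in x%:R * _]subn0 mulr_natl -sumr_const_nat -big_split /=.
  by apply: eq_bigr => j _; ring.
by case: ifP => _; rewrite -?natr1; ring.
Qed.

(** Each [theta x - theta j] is at least [T - c - b * j]; the sum is cut where this bound reaches
    zero and equals the area of a triangle, [(T - c) ^ 2 / (2 * b)], up to rounding. *)
Lemma sum_primes_ge x (T b c : R) : 0 < b -> 0 <= c -> c <= T -> T <= theta x -> T - c <= b * x%:R ->
  (forall j, theta j <= b * j%:R + c) ->
  (T - c) ^+ 2 / (2 * b) - b / 2 <= ln x%:R * (\sum_(0 <= q < x.+1 | prime q) q)%N%:R.
Proof.
move=> b0 c0 cT Tx Tbx hth.
apply: (@le_trans _ _ (\sum_(0 <= q < x.+1 | prime q) q%:R * ln q%:R)); last first.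
  rewrite natr_sum mulr_sumr big_nat_cond [leRHS]big_nat_cond.
  apply: ler_sum => q /andP [/andP [_ qx] qp]; rewrite mulrC; apply: ler_wpM2r => //.
  by rewrite ler_ln ?posrE ?ltr0n ?ler_nat ?(prime_gt0 qp) // (leq_trans (prime_gt0 qp)).
rewrite sum_prime_ln.
have U0 : 0 <= (T - c) / b by rewrite divr_ge0 ?subr_ge0 // ltW.
pose J := Num.truncn ((T - c) / b).
have /andP [J1 J2] := truncn_itv U0.
have Jx : (J <= x)%N.
  by rewrite -(ler_nat R) (le_trans J1) // ler_pdivrMr // mulrC.
rewrite (@big_cat_nat _ _ _ J) //=.
apply: (@le_trans _ _ (\sum_(0 <= j < J) (theta x - theta j))); last first.
  rewrite lerDl big_nat_cond; apply: sumr_ge0 => j /andP [/andP [_ jx] _].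
  by rewrite subr_ge0 theta_mono // ltnW.
(* With [u = (T - c) / b], truncation gives [(u - J) ^ 2 <= 1], hence
   [u * J - J ^ 2 / 2 >= (u ^ 2 - 1) / 2]. *)
apply: (@le_trans _ _ (J%:R * (T - c) - b * J%:R * J%:R / 2)).
  have Eu : T - c = b * ((T - c) / b) by field; lra.
  move: J1 J2; rewrite -/J -natr1; move: ((T - c) / b) Eu => u Eu J1 J2.
  rewrite Eu.
  have -> : (b * u) ^+ 2 / (2 * b) - b / 2 = b * ((u ^+ 2 - 1) / 2) by field; lra.
  have -> : J%:R * (b * u) - b * J%:R * J%:R / 2 = b * (J%:R * u - J%:R * J%:R / 2) by field.
  rewrite ler_pM2l //; nra.
have hs m : m%:R * (T - c) - b * m%:R * m%:R / 2 <= \sum_(0 <= j < m) (theta x - theta j).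
  elim: m => [|m IH]; first by rewrite big_geq // !mulr0n !(mul0r, mulr0) subr0.
  rewrite big_nat_recr //= -natr1; have := hth m; move: (m%:R) IH => k IH h.
  nra.
exact: hs.
Qed.

End Theta.

(** * From sums of primes to the square of [p] *)

Section LargePrimes.
Import Order.TTheory GRing.Theory Num.Theory.

(** The primes below [k], which lie outside the exchange argument, have sum at most [p], and [p]
    itself divides [landau n]; so the sum may run over all primes up to [r]. *)
Lemma sum_primes_le_landau_of_gap (n p k r g : nat) : prime p -> p %| landau n ->
  r < p -> k <= r -> p < k * k -> k.-1 * k.-1 <= p ->
  p * g < (p - r) * (p - r) + p -> 2 * (k + g) <= p - r ->
  (forall x, k <= x -> (x <= 2 * r - p) || (x <= k) -> exists2 s, prime s & x <= s < x + g) ->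
  \sum_(0 <= q < r.+1 | prime q) q <= n + r.
Proof.
move=> pp pg rp kr pk kp hg hkg hgap.
have ps : prime p by [].
pose l := [seq q <- index_iota k r.+1 | prime q].
have hl q : q \in l -> [/\ prime q, p < q * q & q <= r].
  rewrite mem_filter mem_index_iota => /andP [qp /andP [kq qr]]; split=> //.
  by apply: (leq_trans pk); apply: leq_mul.
have ul : uniq l by rewrite filter_uniq // iota_uniq.
have := sum_primes_le_landau pp pg rp ul hl.
have hs : \sum_(0 <= q < r.+1 | prime q) q <= \sum_(q <- l) q + p.
  rewrite (@big_cat_nat _ _ _ k) //=; last by rewrite (leq_trans kr).
  rewrite /l big_filter addnC leq_add2l.
  apply: (@leq_trans (\sum_(0 <= q < k) q)).
    by rewrite big_mkcond; apply: leq_sum => q _; case: ifP.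
  (* [k * (k - 1) / 2 <= (k - 1) ^ 2] once [k >= 2]. *)
  rewrite bin2_sum bin2; apply: leq_trans kp.
  have := odd_double_half (k * k.-1); move: (_./2) => u; clear.
  by case: k => [|[|m]]; rewrite -muln2 /=; nia.
move=> h; apply: leq_trans hs _; apply: h.
apply: (nondividing_pair_absurd pp pg (ltnW rp)) => r1 r2 _ _ _ h12 h3.
by apply: (@exists_swap_prime p r g k p p (fun s => prime s)) h12 h3 => //; rewrite ?leqnn.
Qed.

Local Open Scope ring_scope.

Section Asymptotics.
Variable R : realType.

Lemma theta_ge (a b y0 : Z) (t y : nat) : psi_within R a b y0 -> Z.le y0 (Z.of_nat y) ->
  (0 < t)%N -> (t * t <= y)%N ->
  (zR R a / (100 * 100) - 2 * (zR R 10515 / (100 * 100)) / t%:R) * y%:R <= theta R y.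
Proof.
move=> h hy t0 tty; have /andP [h1 _] := h y hy.
have [s1 s2] := Nat.sqrt_spec y ltac:(lia).
move: (Nat.sqrt y) s1 s2 => s s1 s2.
have st : (t <= s)%N by clear -s2 tty; nia.
have sty : (s * t <= y)%N by clear -s1 st; nia.
have y0' : (0 < y)%N by apply: leq_trans tty; rewrite muln_gt0 t0.
have h2 := @psi_le_theta R y s y0' ltac:(by clear -s2; lia) ltac:(by clear -s1; nia).
have h3 := psi_le_10515 R s.
have t0' : 0 < t%:R :> R by rewrite ltr0n.
have h4 : s%:R <= y%:R / t%:R :> R by rewrite ler_pdivlMr // -natrM ler_nat.
have c0 : 0 <= zR R 10515 / (100 * 100) by rewrite divr_ge0 ?mulr_ge0 // zR_ge0.
move: (zR R a / _) (zR R 10515 / _) c0 h1 h3 => u v v0 h1 h3.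
have h5 := ler_wpM2l v0 h4.
rewrite mulrBl; have -> : 2 * v / t%:R * y%:R = 2 * (v * (y%:R / t%:R)) by ring.
lra.
Qed.

(** The additive constant pays for [j < y0], where only the slope [1.0515] is available. *)
Lemma theta_le (a b y0 : Z) (j : nat) : psi_within R a b y0 -> Z.le 0 y0 -> Z.le b 10515 ->
  theta R j <= zR R b / (100 * 100) * j%:R
    + (zR R 10515 / (100 * 100) - zR R b / (100 * 100)) * zR R y0.
Proof.
move=> h y00 hb; apply: le_trans (theta_le_psi R j) _.
have c0 : 0 <= zR R 10515 / (100 * 100) - zR R b / (100 * 100).
  by rewrite subr_ge0 ler_pM2r ?invr_gt0 ?mulr_gt0 // zR_le.
have [hj|hj] := Z.le_gt_cases y0 (Z.of_nat j).
  have /andP [_ h2] := h j hj; apply: le_trans h2 _.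
  by rewrite lerDl mulr_ge0 // zR_ge0.
have h1 := psi_le_10515 R j.
have h2 : j%:R <= zR R y0 by rewrite -zR_nat; apply: zR_le; move: hj; clear; lia.
have h3 := ler_wpM2l c0 h2.
move: (zR R b / _) (zR R 10515 / _) c0 h1 h3 => u v c0 h1 h3.
rewrite mulrBl in h3; lra.
Qed.

(** From [n >= N0 = mu * x ^ 2 / ln x] follows [ln n >= 2 * ln x - ln (ln x / mu)]. The iterated
    logarithm is bounded by its tangent at [c0], so division by [ln x] leaves only a constant and
    [(kappa - 1) / ln x]. *)
Lemma nlnn_ge (n x : nat) (mu c0 kappa l0 : R) : 0 < mu -> 0 < c0 -> ln c0 <= kappa -> 1 <= kappa ->
  0 < l0 -> l0 <= ln x%:R -> (0 < x)%N -> mu * x%:R ^+ 2 <= n%:R * ln x%:R ->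
  mu * (2 - 1 / (c0 * mu) - (kappa - 1) / l0) * x%:R ^+ 2 <= n%:R * ln n%:R.
Proof.
move=> mu0 c00 hk k1 l00 hl x0 hn.
have x0' : 0 < x%:R :> R by rewrite ltr0n.
have lx0 : 0 < ln x%:R :> R by apply: lt_le_trans hl.
pose N0 := mu * x%:R ^+ 2 / ln x%:R.
have N00 : 0 < N0 by rewrite divr_gt0 // mulr_gt0 // exprn_gt0.
have nN0 : N0 <= n%:R by rewrite ler_pdivrMr.
have n0 : 0 < n%:R :> R by apply: lt_le_trans nN0.
have ln0 : 0 <= ln n%:R :> R by apply: ln_ge0; rewrite ler1n; move: n0; rewrite ltr0n.
apply: le_trans (_ : N0 * ln n%:R <= _); last by apply: ler_wpM2r.
apply: le_trans (_ : N0 * ln N0 <= _); last by rewrite ler_pM2l // ler_ln ?posrE.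
have Eln : ln N0 = 2 * ln x%:R - ln (ln x%:R / mu).
  have -> : N0 = x%:R ^+ 2 / (ln x%:R / mu) by rewrite /N0; field; rewrite !gt_eqF.
  rewrite [LHS]ln_div ?posrE ?exprn_gt0 ?divr_gt0 //; congr (_ - _).
  by rewrite lnXn // mulr_natl.
have h1 : ln (ln x%:R / mu) <= kappa + ln x%:R / (mu * c0) - 1.
  have -> : ln x%:R / mu = c0 * (ln x%:R / (mu * c0)) by field; rewrite !gt_eqF.
  rewrite lnM ?posrE ?divr_gt0 ?mulr_gt0 //.
  have := @ln_le_subr1 R (ln x%:R / (mu * c0)) ltac:(by rewrite divr_gt0 // mulr_gt0).
  lra.
have h2 : (kappa - 1) / ln x%:R <= (kappa - 1) / l0.
  by apply: ler_wpM2l; rewrite ?subr_ge0 // lef_pV2 ?posrE.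
have E2 : N0 * ln N0 = mu * x%:R ^+ 2 * (2 - ln (ln x%:R / mu) / ln x%:R).
  by rewrite Eln /N0; move: (ln (_ / mu)) => w; field; rewrite gt_eqF.
rewrite E2 -[leLHS]mulrA [_ * x%:R ^+ 2]mulrC mulrA; apply: ler_wpM2l.
  by rewrite mulr_ge0 ?exprn_ge0 // ltW.
have h3 : ln (ln x%:R / mu) / ln x%:R <= (kappa - 1) / ln x%:R + 1 / (c0 * mu).
  rewrite ler_pdivrMr //; apply: le_trans h1 _; rewrite le_eqVlt; apply/orP; left; apply/eqP.
  by field; rewrite !gt_eqF.
lra.
Qed.

(** [e] bounds [(T - c) / x] from below, [w] absorbs the summand [x] on the right of the first
    hypothesis and the rounding loss [b / 2], and [xi] bounds [p / x]. *)
Lemma square_le_of_sum (n p x : nat) (T b c e w mu xi c0 kappa l0 : R) :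
  (\sum_(0 <= q < x.+1 | prime q) q <= n + x)%N ->
  T <= theta R x -> (forall j, theta R j <= b * j%:R + c) -> 0 < b <= 2 -> 0 <= c ->
  0 <= e -> e * x%:R <= T - c -> T - c <= b * x%:R ->
  ln x%:R + 1 <= w * x%:R -> (0 < x)%N ->
  mu <= e ^+ 2 / (2 * b) - w -> 0 < mu ->
  0 < c0 -> ln c0 <= kappa -> 1 <= kappa -> 0 < l0 -> l0 <= ln x%:R ->
  p%:R <= xi * x%:R -> xi ^+ 2 <= (166 / 125) ^+ 2 * (mu * (2 - 1 / (c0 * mu) - (kappa - 1) / l0)) ->
  p%:R ^+ 2 <= (166 / 125) ^+ 2 * (n%:R * ln n%:R) :> R.
Proof.
move=> hS hT hth /andP [b0 b2] cc0 e0 eT Tb hlx x0 hmu mu0 c00 hk k1 l00 hl hp hxi.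
have x0' : 1 <= x%:R :> R by rewrite ler1n.
have x00 : 0 < x%:R :> R by rewrite ltr0n.
have ex0 : 0 <= e * x%:R by rewrite mulr_ge0 // ltW.
have cT : c <= T by rewrite -subr_ge0 (le_trans ex0).
have hS' := @sum_primes_ge R x T b c b0 cc0 cT hT Tb hth.
have lx0 : 0 <= ln x%:R :> R by apply: ln_ge0.
have hn : mu * x%:R ^+ 2 <= n%:R * ln x%:R.
  have h1 : (\sum_(0 <= q < x.+1 | prime q) q)%N%:R <= n%:R + x%:R :> R by rewrite -natrD ler_nat.
  have h2 := ler_wpM2l lx0 h1.
  have h3 : (e * x%:R) ^+ 2 <= (T - c) ^+ 2 by rewrite lerXn2r ?nnegrE ?subr_ge0.
  have h4 : (e * x%:R) ^+ 2 / (2 * b)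
      <= (T - c) ^+ 2 / (2 * b) by rewrite ler_pM2r // invr_gt0 mulr_gt0.
  have h5 : (e * x%:R) ^+ 2 / (2 * b) = e ^+ 2 / (2 * b) * x%:R ^+ 2 by field; rewrite gt_eqF.
  have h6 : x%:R * (ln x%:R + 1) <= x%:R * (w * x%:R) :> R by rewrite ler_pM2l.
  have h7 : mu * x%:R ^+ 2 <= (e ^+ 2 / (2 * b) - w) * x%:R ^+ 2.
    by apply: ler_wpM2r => //; rewrite exprn_ge0 // ltW.
  rewrite h5 in h4; move: h1 h2 h4 h6 h7 hS' b2 x0'; clear.
  move: ((T - c) ^+ 2 / (2 * b)) (e ^+ 2 / (2 * b)) (ln (x%:R : R)) => u v l.
  move: ((\sum_(0 <= q < x.+1 | prime q) q)%N%:R : R) (x%:R : R) (n%:R : R) => S X N; lra.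
have h := nlnn_ge mu0 c00 hk k1 l00 hl x0 hn.
apply: le_trans (_ : (xi * x%:R) ^+ 2 <= _).
  by rewrite lerXn2r ?nnegrE // (le_trans _ hp).
rewrite exprMn.
have h8 := ler_wpM2r (exprn_ge0 2 (ltW x00)) hxi.
apply: le_trans h8 _; rewrite -mulrA; apply: ler_wpM2l h.
by rewrite exprn_ge0 // divr_ge0.
Qed.

End Asymptotics.

End LargePrimes.

(** * Primes from 100000 on, in two zones *)

Section Zones.
Import Order.TTheory GRing.Theory Num.Theory.
Local Open Scope ring_scope.
Variable R : realType.

Lemma ln_bounds (x : nat) (K : nat) : 2 ^+ K <= x%:R :> R ->
  K%:R * (192 / 277) <= ln (x%:R : R) <= K%:R * (314 / 453) + x%:R / 2 ^+ K - 1.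
Proof.
move=> h; have K0 : 0 < 2 ^+ K :> R by rewrite exprn_gt0.
have x0 : 0 < x%:R :> R by apply: lt_le_trans h.
have E : ln (2 ^+ K) = K%:R * ln 2 :> R by rewrite lnXn // mulr_natl.
apply/andP; split.
  apply: le_trans (_ : ln (2 ^+ K) <= _); last by rewrite ler_ln ?posrE.
  by rewrite E; apply: ler_wpM2l => //; exact: ln2_ge.
have -> : ln (x%:R : R) = ln (2 ^+ K) + ln (x%:R / 2 ^+ K) by rewrite ln_div ?posrE // subrKC.
have := @ln_le_subr1 R (x%:R / 2 ^+ K) ltac:(by rewrite divr_gt0).
have := ler_wpM2l (ler0n R K) (@ln2_le R).
rewrite E; lra.
Qed.

Lemma zR_9688 : zR R 9688 = 8 * 1211.
Proof. by rewrite (zRM R 8 1211 : zR R 9688 = _) (zR_nat R 8) (zR_nat R 1211). Qed.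
Lemma zR_9756 : zR R 9756 = 12 * 813.
Proof. by rewrite (zRM R 12 813 : zR R 9756 = _) (zR_nat R 12) (zR_nat R 813). Qed.
Lemma zR_10249 : zR R 10249 = 37 * 277.
Proof. by rewrite (zRM R 37 277 : zR R 10249 = _) (zR_nat R 37) (zR_nat R 277). Qed.
Lemma zR_10267 : zR R 10267 = 100 * 102 + 67.
Proof.
rewrite (zRD R (Z.mul 100 102) 67 : zR R 10267 = _) (zRM R 100 102).
by rewrite (zR_nat R 100) (zR_nat R 102) (zR_nat R 67).
Qed.
Lemma zR_10308 : zR R 10308 = 12 * 859.
Proof. by rewrite (zRM R 12 859 : zR R 10308 = _) (zR_nat R 12) (zR_nat R 859). Qed.
Lemma zR_10515 : zR R 10515 = 15 * 701.
Proof. by rewrite (zRM R 15 701 : zR R 10515 = _) (zR_nat R 15) (zR_nat R 701). Qed.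
Lemma zR_1e7 : zR R 10000000 = 100 * 100 * 1000.
Proof.
rewrite (zRM R (Z.mul 100 100) 1000 : zR R 10000000 = _) (zRM R 100 100).
by rewrite (zR_nat R 100) (zR_nat R 1000).
Qed.

(** The ratio [108 / 125] fits gaps of 2.4 percent. The exchange needs primes up to
    [2 * r - p <= 91 / 125 * p], which stays below the end [61100000000] of the chain exactly
    because [p < 83900000000]. *)
Lemma landau_low_sum (n : nat) (p : N) : prime p -> (p %| landau n)%N ->
  (100000 <= p)%num -> (p < 83900000000)%num ->
  (\sum_(0 <= q < ((108 * p) %/ 125).+1 | prime q) q <= n + (108 * p) %/ 125)%N.
Proof.
move=> pp pg p1 p2.
have [s1 s2] := Nat.sqrt_spec (nat_of_bin p) ltac:(lia).
have hp : (100 * 1000 <= p)%N by move: p1; clear; lia.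
pose r := ((108 * p) %/ 125)%N.
have r1 : (125 * r <= 108 * p)%N by rewrite mulnC leq_divM.
have r2 : (108 * p < 125 * r + 125)%N by have := ltn_ceil (108 * p) (isT : (0 < 125)%N);
    rewrite -/r; lia.
pose d := (3 * (2 * r - p) %/ 125)%N.
have d1 : (125 * d <= 3 * (2 * r - p))%N by rewrite mulnC leq_divM.
have d2 : (3 * (2 * r - p) < 125 * d + 125)%N by have :=
    ltn_ceil (3 * (2 * r - p)) (isT : (0 < 125)%N); rewrite -/d; lia.
have sp : (300 * Nat.sqrt p <= p)%N.
  by clear -s1 s2 hp; nia.
apply: (@sum_primes_le_landau_of_gap n p (Nat.sqrt p).+1 r (d + 101) pp pg).
- by move: r1 hp; clear; lia.
- by move: r2 hp sp; clear; lia.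
- by move: s2; clear; lia.
- by move: s1; clear; lia.
- move: r1 r2 d1 hp; move: (nat_of_bin p) => q; clear => r1 r2 d1 hp.
  (* [(17 / 125) ^ 2 = 289 / 15625] exceeds the allowed gap ratio
     [3 / 125 * (91 / 125) = 273 / 15625]; the surplus covers the constant [101]. *)
  have e1 : (125 * (q - r) >= 17 * q)%N by lia.
  have e2 : (125 * 125 * (d + 101) <= 273 * q + 125 * 125 * 101)%N by lia.
  have e3 : (125 * (q - r) * (125 * (q - r)) >= 17 * q * (17 * q))%N by apply: leq_mul.
  have e4 : (q * (125 * 125 * (d + 101)) <= q * (273 * q
      + 125 * 125 * 101))%N by rewrite leq_mul2l e2 orbT.
  have e5 : (100 * 1000 * q <= q * q)%N by rewrite leq_mul2r hp orbT.
  by move: e3 e4 e5 hp; move: (q - r)%N => t; clear; lia.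
- by move: r1 r2 d1 hp sp; clear; lia.
move=> x kx hx.
have x1 : (x <= 2 * r - p)%N by move: kx hx sp r2 hp; clear; lia.
have hx61 : N.le (bin_of_nat x) 61100000000.
  by move: x1 r1 p2; rewrite -{1}(bin_of_natK x); move: (bin_of_nat x); clear; lia.
have hx0 : N.lt 0 (bin_of_nat x).
  by move: kx; rewrite -{1}(bin_of_natK x); move: (bin_of_nat x); clear; lia.
have [q [qp q1 q2]] := exists_prime_below hx0 hx61.
exists (nat_of_bin q) => //; move: q1 q2 x1 d2 (bin_of_natK x); move: (bin_of_nat x); clear; lia.
Qed.

(** Beyond the chain, gaps come from the third bounds on [psi], of ratio [5 / 97]; the fraction
    [9 / 11] satisfies [(2 / 11) ^ 2 > 5 / 97 * (7 / 11)]. *)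
Lemma landau_high_sum (n : nat) (p : N) : prime p -> (p %| landau n)%N ->
  (83900000000 <= p)%num ->
  (\sum_(0 <= q < ((9 * p) %/ 11).+1 | prime q) q <= n + (9 * p) %/ 11)%N.
Proof.
move=> pp pg p1.
have [s1 s2] := Nat.sqrt_spec (nat_of_bin p) ltac:(lia).
have hp : (1000 * 1000 <= p)%N by move: p1; clear; lia.
pose r := ((9 * p) %/ 11)%N.
have r1 : (11 * r <= 9 * p)%N by rewrite mulnC leq_divM.
have r2 : (9 * p < 11 * r + 11)%N by have := ltn_ceil (9 * p) (isT : (0 < 11)%N); rewrite -/r; lia.
pose d := (5 * (2 * r - p) %/ 97)%N.
have d1 : (97 * d <= 5 * (2 * r - p))%N by rewrite mulnC leq_divM.
have d2 : (5 * (2 * r - p) < 97 * d + 97)%N by have :=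
    ltn_ceil (5 * (2 * r - p)) (isT : (0 < 97)%N); rewrite -/d; lia.
have sp : (900 * Nat.sqrt p <= p)%N.
  by clear -s1 s2 hp; nia.
apply: (@sum_primes_le_landau_of_gap n p (Nat.sqrt p).+1 r (d + 101) pp pg).
- by move: r1 hp; clear; lia.
- by move: r2 hp sp; clear; lia.
- by move: s2; clear; lia.
- by move: s1; clear; lia.
- move: r1 r2 d1 hp; move: (nat_of_bin p) => q; clear => r1 r2 d1 hp.
  have e1 : (11 * (q - r) >= 2 * q)%N by lia.
  have e2 : (97 * 11 * (d + 101) <= 35 * q + 97 * 11 * 101)%N by lia.
  have e3 : (11 * (q - r) * (11 * (q - r)) >= 2 * q * (2 * q))%N by apply: leq_mul.
  have e4 : (q * (97 * 11 * (d + 101)) <= q * (35 * q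
      + 97 * 11 * 101))%N by rewrite leq_mul2l e2 orbT.
  have e5 : (1000 * 1000 * q <= q * q)%N by rewrite leq_mul2r hp orbT.
  by move: e3 e4 e5 hp; move: (q - r)%N => t; clear; lia.
- by move: r1 r2 d1 hp sp; clear; lia.
move=> x kx hx.
have x1 : (x <= 2 * r - p)%N by move: kx hx sp r2 hp; clear; lia.
have hx0 : N.lt 0 (bin_of_nat x).
  by move: kx; rewrite -{1}(bin_of_natK x); move: (bin_of_nat x); clear; lia.
have [hx61|hx61] := N.le_gt_cases (bin_of_nat x) 61100000000.
  have [q [qp q1 q2]] := exists_prime_below hx0 hx61.
  exists (nat_of_bin q) => //; move: q1 q2 x1 d2 (bin_of_natK x); move: (bin_of_nat x); clear; lia.
(* [1 + 5 / 97] exceeds [1.0249 / (0.9756 - 2 * 1.0515 / 4000)], so [theta] must grow between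
   [x - 1] and [x + t]. *)
pose t := ((5 * x) %/ 97)%N.
have t1 : (97 * t <= 5 * x)%N by rewrite mulnC leq_divM.
have t2 : (5 * x < 97 * t + 97)%N by have := ltn_ceil (5 * x) (isT : (0 < 97)%N); rewrite -/t; lia.
have xb : Z.le 61100000000 (Z.of_nat x).
  by move: hx61 (bin_of_natK x); move: (bin_of_nat x); clear; lia.
have hth : theta R x.-1 < theta R (x + t).
  have h1 := theta_ge (t := 4000) (y := x + t) (@psi_within3 R) ltac:(by move: xb; clear; lia) isT
    ltac:(by move: xb; clear; lia).
  have /andP [_ h2] := @psi_within3 R x.-1 ltac:(by move: xb; clear; lia).
  have h3 := theta_le_psi R x.-1.
  rewrite zR_9756 zR_10515 in h1; rewrite zR_10249 in h2.
  have h4 : x.-1%:R + 1 = x%:R :> R by rewrite natr1 prednK //; move: xb; clear; lia.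
  have h5 : 5 * x%:R <= 97 * t%:R + 97 :> R by rewrite -!natrM -natrD ler_nat; move: t2; clear; lia.
  have h6 : 1000 * 1000 * 1000 <= x%:R :> R by rewrite -!natrM ler_nat; move: xb; clear; lia.
  rewrite natrD in h1; move: h1 h2 h3 h4 h5 h6; clear.
  move: (theta R _) (theta R _) (psi R _) (x.-1%:R) (x%:R : R) (t%:R : R) => u v w x1 y z h1 h2 h3
      h4 h5 h6; lra.
have [q qp /andP [q1 q2]] := theta_lt_prime hth.
exists q => //; move: q1 q2 t1 x1 d2 xb; clear; lia.
Qed.

End Zones.

Section ZoneBounds.
Import Order.TTheory GRing.Theory Num.Theory.
Local Open Scope ring_scope.
Variable R : realType.

Lemma largest_prime_bound_low (n : nat) (p : N) : prime p -> (p %| landau n)%N ->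
  (100000 <= p)%num -> (p < 83900000000)%num -> largest_prime_bound R n p.
Proof.
move=> pp pg p1 p2; apply: bound_of_square.
have hS := landau_low_sum pp pg p1 p2.
pose x := ((108 * p) %/ 125)%N.
have x1 : (108 * p < 125 * x + 125)%N by have := ltn_ceil (108 * p) (isT : (0 < 125)%N);
    rewrite -/x; lia.
have x2 : (256 * 256 <= x)%N by move: x1 p1; clear; lia.
have x2' : 256 * 256 <= x%:R :> R by rewrite -natrM ler_nat.
have E16 : 2 ^+ 16 = 256 * 256 :> R by ring.
have /andP [l1 l2] := @ln_bounds R x 16 ltac:(by rewrite E16).
rewrite E16 in l2.
have h400 : Z.le 400 (Z.of_nat x) by move: x2; clear; lia.
have hT := theta_ge (t := 256) (@psi_within1 R) h400 isT x2.
have hth j := @theta_le R 9688 10308 400 j (@psi_within1 R) ltac:(by clear; lia) ltac:(by clear; lia).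
have z400 : zR R 400 = 400 := zR_nat R 400.
rewrite -/x in hS; move: hT hth; rewrite zR_9688 zR_10308 zR_10515 z400 => hT hth.
have hp : p%:R <= 463 / 400 * x%:R :> R.
  have : 108 * (nat_of_bin p)%:R <= 125 * x%:R + 125 :> R by rewrite -!natrM -natrD ler_nat ltnW.
  move: x2'; clear; move: (x%:R : R) ((nat_of_bin p)%:R : R) => u v h1 h2; lra.
have xge : (0 < x)%N by move: x2; clear; lia.
(* [e] is just below [0.9688 - 2 * 1.0515 / 256] minus the effect of [c], and [463 / 400] just above
   [125 / 108]. [c0] is a power of two near [ln x / mu] at the start of the zone, where the estimate
   is tightest. *)
apply: (square_le_of_sum (e := (96 * 100 + 3) / (100 * 100)) (w := 1 / (50 * 100)) (mu :=
    447 / 1000) (c0 := 32)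
  (kappa := 5 * (314 / 453)) (l0 := 16 * (192 / 277)) hS hT hth _ _ _ _ _ _ xge _ _ _ _ _ _ l1 hp).
- by clear; lra.
- by clear; lra.
- by clear; lra.
- by move: x2'; clear; move: (x%:R : R) => u h; lra.
- by move: x2'; clear; move: (x%:R : R) => u h; lra.
- by move: l2 x2'; clear; move: (ln (x%:R : R)) (x%:R : R) => l u h1 h2; lra.
- by clear; lra.
- by clear; lra.
- by clear; lra.
- have -> : 32 = 2 ^+ 5 :> R by ring.
  by rewrite lnXn // -[_ *+ 5]mulr_natl; apply: ler_wpM2l => //; exact: ln2_le.
- by clear; lra.
- by clear; lra.
by clear; lra.
Qed.

Lemma largest_prime_bound_high (n : nat) (p : N) : prime p -> (p %| landau n)%N ->
  (83900000000 <= p)%num -> largest_prime_bound R n p.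
Proof.
move=> pp pg p1; apply: bound_of_square.
have hS := landau_high_sum R pp pg p1.
pose x := ((9 * p) %/ 11)%N.
have x1 : (9 * p < 11 * x + 11)%N by have := ltn_ceil (9 * p) (isT : (0 < 11)%N); rewrite -/x; lia.
have x2 : (4000 * 4000 <= x)%N by move: x1 p1; clear; lia.
have x3 : (2048 * (4096 * 4096) <= x)%N by move: x1 p1; clear; lia.
have x2' : 2048 * (4096 * 4096) <= x%:R :> R by rewrite -!natrM ler_nat.
have E35 : 2 ^+ 35 = 2048 * (4096 * 4096) :> R.
  by rewrite (_ : 35%N = (11 + (12 + 12))%N) // !exprD; congr (_ * (_ * _)); ring.
have /andP [l1 l2] := @ln_bounds R x 35 ltac:(by rewrite E35).
rewrite E35 in l2.
have h3 : Z.le 60010000000 (Z.of_nat x) by move: x1 p1; clear; lia.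
have hT := theta_ge (t := 4000) (@psi_within3 R) h3 isT x2.
have hth j := @theta_le R 9739 10267 10000000 j (@psi_within2 R) ltac:(by clear;
    lia) ltac:(by clear; lia).
rewrite -/x in hS; move: hT hth; rewrite zR_9756 zR_10267 zR_10515 zR_1e7 => hT hth.
have hp : p%:R <= (12 * 1000 + 223) / (100 * 100) * x%:R :> R.
  have : 9 * (nat_of_bin p)%:R <= 11 * x%:R + 11 :> R by rewrite -!natrM -natrD ler_nat ltnW.
  move: x2'; clear; move: (x%:R : R) ((nat_of_bin p)%:R : R) => u v h1 h2; lra.
have xge : (0 < x)%N by move: x2; clear; lia.
(* Here [theta] is bounded above by the second bounds on [psi]: the third ones start so late that
   the additive constant of [theta_le] would be comparable to [x]. *)
apply: (square_le_of_sum (e := 39 / 40) (w := 1 / (50 * 100)) (mu := 4627 / (100 * 100)) (c0 := 64)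
  (kappa := 6 * (314 / 453)) (l0 := 35 * (192 / 277)) hS hT hth _ _ _ _ _ _ xge _ _ _ _ _ _ l1 hp).
- by clear; lra.
- by clear; lra.
- by clear; lra.
- by move: x2'; clear; move: (x%:R : R) => u h; lra.
- by move: x2'; clear; move: (x%:R : R) => u h; lra.
- by move: l2 x2'; clear; move: (ln (x%:R : R)) (x%:R : R) => l u h1 h2; lra.
- by clear; rewrite lerBrDr ler_pdivlMr; lra.
- by clear; lra.
- by clear; lra.
- have -> : 64 = 2 ^+ 6 :> R by ring.
  by rewrite lnXn // -[_ *+ 6]mulr_natl; apply: ler_wpM2l => //; exact: ln2_le.
- by clear; lra.
- by clear; lra.
by clear; lra.
Qed.

Lemma largest_prime_bound_all (n p : nat) : (5 <= n)%N -> prime p -> (p %| landau n)%N ->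
  largest_prime_bound R n p.
Proof.
move=> n5 pp pg.
have [h1|h1] := ltnP p 73; first exact: largest_prime_bound_small.
have [h2|h2] := ltnP p 503; first by apply: largest_prime_bound_search; rewrite ?h1.
have [h3|h3] := ltnP p (nat_of_bin 100000).
  by apply: largest_prime_bound_checkpoints; rewrite ?h2.
rewrite -(bin_of_natK p) in pp pg h3 *; move: (bin_of_nat p) pp pg h3 => {h1 h2}p pp pg h3.
have {}h3 : (100000 <= p)%num by move: h3; move: (100000%num); clear; lia.
have [h4|h4] := N.lt_ge_cases p 83900000000; first exact: largest_prime_bound_low.
exact: largest_prime_bound_high.
Qed.

End ZoneBounds.

Import GRing.Theory Num.Theory.
Local Open Scope ring_scope.

Theorem mainTheorem1 (R : realType) (n : nat) (hn : (5 <= n)%N) :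
  (max_pdiv (landau n))%:R <=
    1328%:R / 1000%:R * Num.sqrt (n%:R * ln (n%:R : R)).
Proof.
have g1 : (1 < landau n)%N.
  by apply: landau_max => //; rewrite -[2%N]expn1 ell_prime_pow //; exact: leq_trans hn.
exact: largest_prime_bound_all hn (max_pdiv_prime g1) (max_pdiv_dvd _).
Qed.
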